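(* Let $d\in\mathbb{N}$ and let $V$ be one of the spaces $H^1(\mathbb{R}^d)$, $L^2_{w}(\mathbb{R}^d)$, $\mathbb{H}^1(\mathbb{R}^d)$. Let $\Lambda\subset\mathbb{R}^{2d}$ be a lattice and let $g\in V$. If $(g,\Lambda)$ is a frame sequence in $L^2(\mathbb{R}^d)$, then the associated canonical dual window $\gamma=S^\dagger g$ satisfies $\gamma\in V$.
   Context: Function spaces (complex-valued functions): $H^1(\mathbb{R}^d)=W^{1,2}(\mathbb{R}^d)$ is the space of $f\in L^2(\mathbb{R}^d)$ whose distributional partial derivatives $\partial_jf$ all belong to $L^2(\mathbb{R}^d)$; $L^2_w(\mathbb{R}^d)=\{f:\mathbb{R}^d\to\mathbb{C}: wf\in L^2\}$ with $w(x)=1+|x|$; $\mathbb{H}^1(\mathbb{R}^d)=H^1(\mathbb{R}^d)\cap L^2_w(\mathbb{R}^d)$. A lattice in $\mathbb{R}^{2d}$ is a set $\Lambda=A\mathbb{Z}^{2d}$ with $A\in\mathbb{R}^{2d\times2d}$ invertible. $T_af(x)=f(x-a)$, $M_bf(x)=e^{2\pi ib\cdot x}f(x)$, $\pi(a,b)=T_aM_b$ for $a,b\in\mathbb{R}^d$, and $(g,\Lambda)=\{\pi(\lambda)g:\lambda\in\Lambda\}$. A countable family $(h_i)_{i\in I}$ in a Hilbert space $\mathcal{H}$ is a frame sequence if it is a frame for $\mathcal{H}'=\overline{\operatorname{span}}\{h_i:i\in I\}$, i.e. there are $0<A\le B<\infty$ with $A\|f\|^2\le\sum_{i}|\langle f,h_i\rangle|^2\le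 B\|f\|^2$ for all $f\in\mathcal{H}'$. Then the frame operator $S:\mathcal{H}\to\mathcal{H}$, $Sf=\sum_i\langle f,h_i\rangle h_i$, is bounded and self-adjoint, $S|_{\mathcal{H}'}:\mathcal{H}'\to\mathcal{H}'$ is boundedly invertible, and the pseudo-inverse of $S$ is $S^\dagger=(S|_{\mathcal{H}'})^{-1}\circ P_{\mathcal{H}'}$, where $P_{\mathcal{H}'}$ is the orthogonal projection onto $\mathcal{H}'$. For a Gabor frame sequence $(g,\Lambda)$ in $\mathcal{H}=L^2(\mathbb{R}^d)$, with $S$ its frame operator, the canonical dual window is $\gamma:=S^\dagger g$. *)

(* Defs.v *)
From HB Require Import structures.
From mathcomp Require Import all_boot all_order all_algebra.
From mathcomp Require Import finmap complex.
From mathcomp Require Import all_classical all_reals all_analysis.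
From mathcomp.analysis Require showcase.summability.

Set Implicit Arguments.
Unset Strict Implicit.
Unset Printing Implicit Defensive.

Import Order.TTheory GRing.Theory Num.Theory.
Import numFieldNormedType.Exports.

Local Open Scope classical_set_scope.
Local Open Scope ring_scope.

(* The product (= Borel) sigma-algebra on R^d, as for [n.-tuple R]. *)
Section measurable_rV.
Context {R : realType} (d : nat).

Let coors (i : 'I_d) (x : 'rV[R]_d) : R := x ord0 i.

Let rV_set0 : g_sigma_preimage coors set0.
Proof. exact: sigma_algebra0. Qed.

Let rV_setC A : g_sigma_preimage coors A -> g_sigma_preimage coors (~` A).
Proof. exact: sigma_algebraC. Qed.

Let rV_bigcup (F : _^nat) : (forall i, g_sigma_preimage coors (F i)) ->
  g_sigma_preimage coors (\bigcup_i (F i)).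
Proof. exact: sigma_algebra_bigcup. Qed.

HB.instance Definition _ := @isMeasurable.Build default_measure_display
  'rV[R]_d (g_sigma_preimage coors) rV_set0 rV_setC rV_bigcup.

Lemma measurable_coord (i : 'I_d) :
  measurable_fun [set: 'rV[R]_d] (fun x : 'rV[R]_d => x ord0 i).
Proof.
move=> _ Y mY; rewrite setTI; apply: sub_sigma_algebra => /=.
rewrite -bigcup_seq/=; exists i => /=; first by rewrite mem_index_enum.
by exists Y => //; rewrite setTI.
Qed.

Lemma measurable_fun_rVP d' (T : measurableType d') (f : T -> 'rV[R]_d) :
  (forall i, measurable_fun [set: T] (fun t => f t ord0 i)) ->
  measurable_fun [set: T] f.
Proof.
move=> mf _ A mA; rewrite setTI.
suff: smallest (sigma_algebra [set: 'rV[R]_d])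
    (\big[setU/set0]_(i < d) preimage_set_system setT (coors i) measurable)
    `<=` [set A | measurable (f @^-1` A)] by apply.
apply: smallest_sub.
  split=> /=.
  - by rewrite preimage_set0.
  - by move=> B mB; rewrite setTD preimage_setC; exact: measurableC.
  - by move=> F mF; rewrite preimage_bigcup; exact: bigcup_measurable.
move=> B; rewrite -bigcup_seq/= => -[i _ [C mC <-]] /=.
rewrite setTI -comp_preimage -[X in measurable X]setTI.
exact: mf.
Qed.

End measurable_rV.

Section lebesgue_rV.
Context {R : realType}.

Definition cons_rV d (p : R * 'rV[R]_d) : 'rV[R]_d.+1 :=
  \row_i oapp (fun j => p.2 ord0 j) p.1 (unlift ord0 i).

Definition uncons_rV d (x : 'rV[R]_d.+1) : R * 'rV[R]_d :=
  (x ord0 ord0, \row_j x ord0 (lift ord0 j)).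

Lemma cons_rVK d : cancel (@cons_rV d) (@uncons_rV d).
Proof.
case=> x v; rewrite /uncons_rV /cons_rV; congr pair; first by rewrite mxE unlift_none.
by apply/rowP => j; rewrite !mxE liftK.
Qed.

Lemma measurable_cons_rV d : measurable_fun [set: R * 'rV[R]_d] (@cons_rV d).
Proof.
apply: measurable_fun_rVP => i; rewrite /cons_rV.
case: (unliftP ord0 i) => [j|] ->.
- under eq_fun do rewrite mxE liftK /=.
  exact: (measurableT_comp (@measurable_coord R d j) measurable_snd).
- by under eq_fun do rewrite mxE unlift_none /=; exact: measurable_fst.
Qed.

Lemma measurable_uncons_rV d : measurable_fun [set: 'rV[R]_d.+1] (@uncons_rV d).
Proof.
apply: measurable_fun_pair; first exact: measurable_coord.
apply: measurable_fun_rVP => j.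
by under eq_fun do rewrite mxE; exact: measurable_coord.
Qed.

Definition lebesgue_cons d (mu : {sigma_finite_measure set 'rV[R]_d -> \bar R}) :
    set 'rV[R]_d.+1 -> \bar R :=
  pushforward (lebesgue_measure \x mu)%E (@cons_rV d).

Section lebesgue_cons.
Context d (mu : {sigma_finite_measure set 'rV[R]_d -> \bar R}).

HB.instance Definition _ := Measure.copy (lebesgue_cons mu)
  (measure_function_pushforward__canonical__measure_function_Measure
    (lebesgue_measure \x mu)%E (@measurable_cons_rV d)).

Let lebesgue_cons_sigma_finite : sigma_finite setT (lebesgue_cons mu).
Proof.
have /sigma_finiteP[F [TF ndF Foo]] := sigma_finiteT (@lebesgue_measure R).
have /sigma_finiteP[G [TG ndG Goo]] := sigma_finiteT mu.
exists (fun n => @uncons_rV d @^-1` (F n `*` G n)).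
  rewrite -preimage_bigcup; apply/esym/seteqP; split=> // x _ /=.
  have [n _ Fn] : (\bigcup_n F n) (uncons_rV x).1 by rewrite -TF.
  have [k _ Gk] : (\bigcup_n G n) (uncons_rV x).2 by rewrite -TG.
  exists (maxn n k) => //; split.
  - by move: Fn; exact/subsetPset/ndF/leq_maxl.
  - by move: Gk; exact/subsetPset/ndG/leq_maxr.
move=> n; have [mF Fn] := Foo n; have [mG Gn] := Goo n; split.
  by rewrite -[X in measurable X]setTI; apply: measurable_uncons_rV => //;
    exact: measurableX.
rewrite /lebesgue_cons /pushforward -comp_preimage.
rewrite (_ : _ \o _ = id); last by apply/funext => p /=; rewrite cons_rVK.
rewrite preimage_id product_measure1E// lte_mul_pinfty//.
by rewrite ge0_fin_numE.
Qed.

HB.instance Definition _ := Measure_isSigmaFinite.Build _ _ _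
  (lebesgue_cons mu) lebesgue_cons_sigma_finite.

End lebesgue_cons.

(* Lebesgue measure on R^d, as the d-fold product of the one on R. *)
Fixpoint lebesgue_rV d : {sigma_finite_measure set 'rV[R]_d -> \bar R} :=
  match d with
  | 0 => \d_ (0 : 'rV[R]_0)
  | d'.+1 => lebesgue_cons (lebesgue_rV d')
  end.

End lebesgue_rV.

Lemma lebesgue_rV_box {R : realType} d (A : 'I_d -> set R) :
  (forall i, measurable (A i)) ->
  lebesgue_rV d [set x : 'rV[R]_d | forall i, A i (x ord0 i)] =
  (\prod_(i < d) lebesgue_measure (A i))%E.
Proof.
elim: d A => [|d IH] A mA.
  by rewrite big_ord0 /= diracE mem_set//= => -[].
rewrite big_ord_recl /= /lebesgue_cons /pushforward.
pose B := [set x : 'rV[R]_d | forall i, A (lift ord0 i) (x ord0 i)].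
have mB : measurable B.
  rewrite (_ : B = \bigcap_(i in [set: 'I_d])
      ((fun x : 'rV[R]_d => x ord0 i) @^-1` A (lift ord0 i))).
    apply: fin_bigcap_measurable => // i _.
    by rewrite -[X in measurable X]setTI; exact: measurable_coord.
  by apply/seteqP; split => x /= Bx i *; exact: Bx.
have -> : @cons_rV R d @^-1` [set x | forall i, A i (x ord0 i)] = A ord0 `*` B.
  apply/seteqP; split => -[x v] /=.
    move=> Axv; split => [|i] /=.
      by have := Axv ord0; rewrite mxE unlift_none.
    by have := Axv (lift ord0 i); rewrite mxE liftK.
  case=> Ax Bv i; rewrite mxE.
  by case: (unliftP ord0 i) => [j|] -> //=; exact: Bv.
have := product_measure1E lebesgue_measure (lebesgue_rV d) (mA ord0) mB.
move=> /= ->; congr (_ * _)%E; exact: IH (fun i => A (lift ord0 i)) (fun i => mA _).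
Qed.

Section function_spaces.
Context {R : realType} {d : nat}.

Local Notation Rd := 'rV[R]_d.
Local Notation C := R[i].
Local Notation mu := (lebesgue_rV d).

Definition dot (x y : Rd) : R := \sum_(i < d) x ord0 i * y ord0 i.

Definition enorm (x : Rd) : R := Num.sqrt (dot x x).

Definition cintegral (F : Rd -> C) : C :=
  ((\int[mu]_x complex.Re (F x)) +i* (\int[mu]_x complex.Im (F x)))%C.

(* L^2 is handled through representatives: every class contains a Borel
   function, and f, g represent the same class iff L2norm (f - g) = 0. *)
Definition L2 : set (Rd -> C) := [set f : Rd -> C |
  [/\ measurable_fun setT (fun x => complex.Re (f x)),
      measurable_fun setT (fun x => complex.Im (f x)) &
      finite_norm mu 2%:E (fun x => Normc.normc (f x))]].

Definition L2norm (f : Rd -> C) : R :=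
  fine (Lnorm mu 2%:E (fun x => (Normc.normc (f x))%:E)).

Definition inner (f g : Rd -> C) : C :=
  cintegral (fun x => f x * (g x)^*%C).

Definition partial (j : 'I_d) (phi : Rd -> R) : Rd -> R :=
  fun x => 'D_(delta_mx ord0 j) phi x.

Definition smooth (phi : Rd -> R) : Prop := forall s : seq 'I_d,
  continuous (foldr partial phi s) /\
  forall x j, derivable (foldr partial phi s) x (delta_mx ord0 j).

(* C_c^infty; by linearity, real-valued test functions suffice. *)
Definition test_function (phi : Rd -> R) : Prop :=
  smooth phi /\ compact (closure [set x | phi x != 0]).

Definition distributional_partial (j : 'I_d) (f g : Rd -> C) : Prop :=
  forall phi, test_function phi ->
    cintegral (fun x => f x * (partial j phi x)%:C%C) =
    - cintegral (fun x => g x * (phi x)%:C%C).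

Definition H1 : set (Rd -> C) := [set f : Rd -> C |
  L2 f /\ forall j, exists2 g, L2 g & distributional_partial j f g].

Definition weight (x : Rd) : R := 1 + enorm x.

Definition L2w : set (Rd -> C) := [set f : Rd -> C |
  L2 (fun x => (weight x)%:C%C * f x)].

Definition HH1 : set (Rd -> C) := H1 `&` L2w.

End function_spaces.

Section frames.
Context {R : realType} {d : nat} {I : choiceType}.

Local Notation Rd := 'rV[R]_d.
Local Notation C := R[i].

Implicit Types (h : I -> Rd -> C) (f p u v : Rd -> C).

Definition lincomb (c : I -> C) h (F : {fset I}) : Rd -> C :=
  fun x => \sum_(i <- F) c i * h i x.

Definition closed_span h : set (Rd -> C) := [set f | L2 f /\
  forall e : R, 0 < e -> exists (F : {fset I}) (c : I -> C),
    L2norm (fun x => f x - lincomb c h F x) < e].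

Definition frame_sequence h : Prop :=
  (forall i, L2 (h i)) /\
  exists A B : R, [/\ 0 < A, A <= B & forall f, closed_span h f ->
    ((A * L2norm f ^+ 2)%:E <=
       \esum_(i in [set: I]) (Normc.normc (inner f (h i)) ^+ 2)%:E /\
     \esum_(i in [set: I]) (Normc.normc (inner f (h i)) ^+ 2)%:E <=
       (B * L2norm f ^+ 2)%:E)%E].

(* [p] represents [S f]: the series [\sum_i <f, h_i> h_i] converges to [p]
   unconditionally in L^2. *)
Definition frame_operator h f p : Prop := L2 p /\
  L2norm (fun x => p x - lincomb (fun i => inner f (h i)) h F x)
    @[F --> summability.totally] --> (0 : R).

(* [p] represents the orthogonal projection of [f] onto [H]. *)
Definition orthogonal_projection (H : set (Rd -> C)) f p : Prop :=
  H p /\ forall v, H v -> inner (fun x => f x - p x) v = 0.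

(* [u] represents [(S|_H')^-1 (P_H' f)], with [H'] the closed span of [h]. *)
Definition pseudo_inverse h f u : Prop := closed_span h u /\
  exists2 p, orthogonal_projection (closed_span h) f p & frame_operator h u p.

End frames.

Section gabor.
Context {R : realType} {d : nat}.

Local Notation Rd := 'rV[R]_d.
Local Notation C := R[i].

Definition cis (t : R) : C := (cos t +i* sin t)%C.

Definition translation (a : Rd) (f : Rd -> C) : Rd -> C := fun x => f (x - a).

Definition modulation (b : Rd) (f : Rd -> C) : Rd -> C :=
  fun x => cis (2 * pi * dot b x) * f x.

Definition tf_shift (l : 'rV[R]_(d + d)) (f : Rd -> C) : Rd -> C :=
  translation (lsubmx l) (modulation (rsubmx l) f).

(* Vectors are rows, so [A z] becomes [z *m A^T]. *)
Definition is_lattice n (L : set 'rV[R]_n) : Prop :=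
  exists2 A : 'M[R]_n, A \in unitmx &
    L = [set map_mx intr z *m A^T | z in [set: 'rV[int]_n]].

Definition gabor (g : Rd -> C) (L : set 'rV[R]_(d + d)) : L -> Rd -> C :=
  fun l => tf_shift (set_val l) g.

Arguments gabor : clear implicits.

Definition canonical_dual_window (g : Rd -> C) (L : set 'rV[R]_(d + d))
    (gamma : Rd -> C) : Prop :=
  pseudo_inverse (gabor g L) g gamma.

End gabor.

Arguments gabor {R d} g L l.

(* Main.v *)
Require Import Defs.
From HB Require Import structures.
From mathcomp Require Import all_boot all_order all_algebra.
From mathcomp Require Import finmap complex ring lra.
From mathcomp Require Import all_classical all_reals all_analysis measurable_realfun.

(* For every time-frequency shift T there is a bound
   |T gamma - gamma| <= K |T g - g| with K depending only on the frame bounds: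
   T maps the frame sequence to one with the same bounds, consisting of
   unimodular multiples of the shifts of T g, so that gamma and T gamma are both
   recovered by mixed frame operators, and their difference expands into mixed
   operators having T g - g in one slot. For Gabor systems the slots of a mixed
   operator can be exchanged, and a symmetric operator bounded for the Bessel
   norm is bounded for the Hilbert norm (Lax), so these terms are controlled by
   |T g - g| alone. Finally, f lies in H^1 iff |T f - f| = O(t) for translations
   by t e_j (it suffices to let t run over the 1/n), and in L^2_w iff the same
   holds for modulations, so both properties pass from g to gamma. *)

Set Implicit Arguments.
Unset Strict Implicit.
Unset Printing Implicit Defensive.

Import Order.TTheory GRing.Theory Num.Theory.
Import numFieldNormedType.Exports.
Import Normc.

Local Open Scope ring_scope.

Local Notation Re := complex.Re.
Local Notation Im := complex.Im.

(** * Semi-inner product spaces *)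

(** Write D = T g - g. Comparing gamma with T gamma produces sums such as $\sum_i
    \langle\gamma,\pi_i g\rangle\,\pi_i D$. Their obvious bound involves the Bessel bound of D, for
    which only twice that of g is available and which need not shrink with |D|; this is why the
    slots have to be exchanged and Lax's argument is needed. A second obstacle is that the orbits of
    g and T g span different closed subspaces, while a lower frame bound acts only inside its own
    span. So gamma is first replaced by $w=\sum_i\langle\gamma,\pi_i\gamma\rangle\,\pi_i T g$, which
    lies in the span of the orbit of T g and is close to gamma; the lower bound is applied to T
    gamma - w. Elements of $L^2$ stay functions, not classes. The abstract part is therefore written
    for semi-inner products, and an equality of vectors appears as a distance zero or as an equality
    of inner products with every vector. That part uses only that the index set is a group acting
    isometrically up to phases, and that T commutes with this action up to phases; so T may be a
    shift by any point of $\mathbb{R}^{2d}$, inside or outside the lattice. *)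

Section complex_facts.
Context {R : rcfType}.
Implicit Types z w : R[i].

Lemma normc_ge0 z : 0 <= normc z.
Proof. by case: z => a b; exact: sqrtr_ge0. Qed.

Lemma normc_sqr z : normc z ^+ 2 = Re z ^+ 2 + Im z ^+ 2.
Proof. by case: z => a b /=; rewrite sqr_sqrtr// addr_ge0// sqr_ge0. Qed.

Lemma normc_conj z : normc z^*%C = normc z.
Proof. by case: z => a b /=; rewrite sqrrN. Qed.

Lemma mulcJ z : z * z^*%C = (normc z ^+ 2)%:C%C.
Proof.
by rewrite normc_sqr; case: z => a b; simpc; congr (_ +i* _)%C; ring.
Qed.

Lemma normcR (r : R) : normc r%:C%C = `|r|.
Proof. by rewrite /= expr0n/= addr0 sqrtr_sqr. Qed.

Lemma Re_le_normc z : `|Re z| <= normc z.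
Proof.
case: z => a b /=; rewrite -(sqrtr_sqr a) ler_wsqrtr// lerDl; exact: sqr_ge0.
Qed.

Lemma Im_le_normc z : `|Im z| <= normc z.
Proof.
case: z => a b /=; rewrite -(sqrtr_sqr b) ler_wsqrtr// lerDr; exact: sqr_ge0.
Qed.

Lemma normcD z w : normc (z + w) <= normc z + normc w.
Proof. exact: le_normcD. Qed.

Lemma cReD z w : Re (z + w) = Re z + Re w. Proof. by case: z w => [? ?] []. Qed.
Lemma cImD z w : Im (z + w) = Im z + Im w. Proof. by case: z w => [? ?] []. Qed.
Lemma cReN z : Re (- z) = - Re z. Proof. by case: z. Qed.
Lemma cImN z : Im (- z) = - Im z. Proof. by case: z. Qed.
Lemma cReM z w : Re (z * w) = Re z * Re w - Im z * Im w.
Proof. by case: z w => [? ?] []. Qed.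
Lemma cImM z w : Im (z * w) = Re z * Im w + Im z * Re w.
Proof. by case: z w => [? ?] []. Qed.

Lemma complex_eq z w : Re z = Re w -> Im z = Im w -> z = w.
Proof. by case: z w => [? ?] [? ?] /= -> ->. Qed.

Lemma unimodularV z : normc z = 1 -> z * z^*%C = 1.
Proof. by move=> z1; rewrite mulcJ z1 expr1n. Qed.

End complex_facts.

(** Definiteness is left out because the instance of interest lives on functions, where null
    functions have norm 0; [nrm s (u - v) = 0] plays the role of equality. *)
Record semi_inner (R : realType) (E : lmodType R[i]) := SemiInner {
  ip :> E -> E -> R[i];
  ipDl : forall u v w, ip (u + v) w = ip u w + ip v w;
  ipZl : forall a u w, ip (a *: u) w = a * ip u w;
  ipC : forall u v, ip v u = (ip u v)^*%C;
  ip_ge0 : forall u, 0 <= Re (ip u u) }.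

Section semi_inner_theory.
Context {R : realType} {E : lmodType R[i]} (s : semi_inner E).
Implicit Types (u v w : E) (a : R[i]).

Definition nrm u : R := Num.sqrt (Re (s u u)).

Lemma ipDr u v w : s u (v + w) = s u v + s u w.
Proof. by rewrite ipC ipDl rmorphD/= -!ipC. Qed.

Lemma ipZr a u v : s u (a *: v) = a^*%C * s u v.
Proof. by rewrite ipC ipZl rmorphM/= -ipC. Qed.

Lemma ip0l u : s 0 u = 0. Proof. by rewrite -(scale0r 0) ipZl mul0r. Qed.
Lemma ip0r u : s u 0 = 0. Proof. by rewrite ipC ip0l rmorph0. Qed.
Lemma ipNl u v : s (- u) v = - s u v. Proof. by rewrite -scaleN1r ipZl mulN1r. Qed.
Lemma ipNr u v : s u (- v) = - s u v. Proof. by rewrite ipC ipNl rmorphN/= -ipC. Qed.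
Lemma ipBl u v w : s (u - v) w = s u w - s v w. Proof. by rewrite ipDl ipNl. Qed.
Lemma ipBr u v w : s w (u - v) = s w u - s w v. Proof. by rewrite ipDr ipNr. Qed.

Lemma ip_suml (I : Type) (r : seq I) (f : I -> E) v :
  s (\sum_(i <- r) f i) v = \sum_(i <- r) s (f i) v.
Proof.
by elim: r => [|i r IH]; rewrite ?big_nil ?ip0l// !big_cons ipDl IH.
Qed.

Lemma ip_sumr (I : Type) (r : seq I) (f : I -> E) v :
  s v (\sum_(i <- r) f i) = \sum_(i <- r) s v (f i).
Proof.
by elim: r => [|i r IH]; rewrite ?big_nil ?ip0r// !big_cons ipDr IH.
Qed.

Lemma Im_ip u : Im (s u u) = 0.
Proof. by have := ipC s u u; case: (s u u) => a b /= []; lra. Qed.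

Lemma nrm_ge0 u : 0 <= nrm u. Proof. exact: sqrtr_ge0. Qed.

Lemma nrm_sqr u : nrm u ^+ 2 = Re (s u u).
Proof. by rewrite sqr_sqrtr// ip_ge0. Qed.

Lemma ip_nrm u : s u u = (nrm u ^+ 2)%:C%C.
Proof. by apply: complex_eq; rewrite ?nrm_sqr//= Im_ip. Qed.

Lemma nrmZ a u : nrm (a *: u) = normc a * nrm u.
Proof.
rewrite {1}/nrm ipZl ipZr mulrA mulcJ ip_nrm -rmorphM/=.
by rewrite -exprMn sqrtr_sqr ger0_norm// mulr_ge0// ?nrm_ge0// normc_ge0.
Qed.

Lemma nrmN u : nrm (- u) = nrm u.
Proof. by rewrite -scaleN1r nrmZ normcN normc1 mul1r. Qed.

Lemma nrm0 : nrm 0 = 0. Proof. by rewrite /nrm ip0l sqrtr0. Qed.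

Lemma nrm_distrC u v : nrm (u - v) = nrm (v - u).
Proof. by rewrite -nrmN opprB. Qed.

Lemma cauchy_schwarz u v : normc (s u v) <= nrm u * nrm v.
Proof.
have key (t : R) :
    0 <= nrm u ^+ 2 - 2 * t * normc (s u v) ^+ 2 + t ^+ 2 * normc (s u v) ^+ 2 * nrm v ^+ 2.
  have := ip_ge0 s (u - (t * Re (s u v) +i* (t * Im (s u v)))%C *: v).
  rewrite ipBl !ipBr !ipZl !ipZr (ipC s u v) (ip_nrm u) (ip_nrm v).
  set z := s u v; rewrite normc_sqr; case: z => a b.
  set x := nrm u ^+ 2; set y := nrm v ^+ 2; simpc => /=.
  move=> h; apply: le_trans h _; rewrite le_eqVlt; apply/orP; left; apply/eqP; ring.
have u0 := nrm_ge0 u; have v0 := nrm_ge0 v; have z0 := normc_ge0 (s u v).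
rewrite -(@ler_pXn2r _ 2)// ?nnegrE ?mulr_ge0// exprMn.
have [v2|v2] := eqVneq (nrm v ^+ 2) 0.
  rewrite v2 mulr0; move: (normc _ ^+ 2) key => q key.
  rewrite leNgt; apply/negP => qgt0.
  (* When |v| = 0, [key] is affine in t, and this t turns it into |u|^2 - (|u|^2 + 1) >= 0. *)
  have := key ((nrm u ^+ 2 + 1) / (2 * q)); rewrite v2 mulr0 addr0.
  rewrite (_ : 2 * _ * q = nrm u ^+ 2 + 1); first by move=> ?; lra.
  by field; rewrite gt_eqF.
have v2' : 0 < nrm v ^+ 2 by rewrite lt_neqAle eq_sym v2 sqr_ge0.
have := key (nrm v ^+ 2)^-1.
rewrite (_ : _ - _ + _ = nrm u ^+ 2 - normc (s u v) ^+ 2 / nrm v ^+ 2); last by field; rewrite sqrf_eq0 in v2.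
by rewrite subr_ge0 ler_pdivrMr.
Qed.

Lemma nrmD u v : nrm (u + v) <= nrm u + nrm v.
Proof.
have u0 := nrm_ge0 u; have v0 := nrm_ge0 v.
rewrite -(@ler_pXn2r _ 2)// ?nnegrE ?addr_ge0 ?nrm_ge0//.
rewrite nrm_sqr ipDl !ipDr !cReD -!nrm_sqr (ipC s u v).
have : Re (s u v) <= nrm u * nrm v.
  by rewrite (le_trans _ (cauchy_schwarz u v))// (le_trans (ler_norm _))// Re_le_normc.
by case: (s u v) => a b /=; nra.
Qed.

Lemma nrmB u v : nrm (u - v) <= nrm u + nrm v.
Proof. by rewrite -(nrmN v) nrmD. Qed.

Lemma nrm_triangle w u v : nrm (u - v) <= nrm (u - w) + nrm (w - v).
Proof. by rewrite -[u - v](subrKA w) nrmD. Qed.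

Lemma parallelogram u v :
  nrm (u + v) ^+ 2 + nrm (u - v) ^+ 2 = 2 * nrm u ^+ 2 + 2 * nrm v ^+ 2.
Proof.
by rewrite !nrm_sqr !ipDl !ipDr !ipNl !ipNr !(cReD, cReN); ring.
Qed.

Lemma nrm_sub_eq0 u v : nrm (u - v) = 0 -> forall w, s u w = s v w.
Proof.
move=> uv w; apply/eqP; rewrite -subr_eq0 -ipBl.
apply/eqP/eq0_normc/eqP; rewrite eq_le normc_ge0 andbT.
by rewrite (le_trans (cauchy_schwarz _ _))// uv mul0r.
Qed.

Lemma nrm_eq_ip u v : (forall w, s u w = s v w) -> nrm (u - v) = 0.
Proof. by move=> uv; rewrite /nrm ipBl uv subrr sqrtr0. Qed.

Lemma nrm_ip u v : (forall w, s u w = s v w) -> nrm u = nrm v.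
Proof. by move=> uv; rewrite /nrm uv ipC uv -ipC. Qed.

End semi_inner_theory.

(** * Unconditional sums and Bessel sequences *)

Section unconditional_sums.
Context {R : realType} {I : choiceType} {V : zmodType} (N : V -> R).
Context (ND : forall u v, N (u + v) <= N u + N v)
  (NN : forall u, N (- u) = N u).
Implicit Types (f : I -> V) (F : {fset I}).

(** Convergence along the directed set of finite subsets, for a seminorm [N]; it serves both scalar
    sums ([csum]) and vector sums ([vsum]). *)
Definition unsum f v := forall e : R, 0 < e -> exists F0 : {fset I},
  forall F, (F0 `<=` F)%fset -> N (v - \sum_(i <- F) f i) < e.

Lemma unsum_unique f v w : unsum f v -> unsum f w -> N (v - w) <= 0.
Proof.
move=> fv fw; apply/ler_addgt0Pl => e e0; rewrite addr0.
have [F0 H0] := fv (e / 2) (divr_gt0 e0 (ltr0Sn _ 1)).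
have [F1 H1] := fw (e / 2) (divr_gt0 e0 (ltr0Sn _ 1)).
have := H0 _ (fsubsetUl F0 F1); have := H1 _ (fsubsetUr F0 F1).
set S := \sum_(i <- _) _; have := ND (v - S) (S - w).
rewrite subrKA -(NN (S - w)) opprB; lra.
Qed.

Lemma unsumD f g v w : unsum f v -> unsum g w ->
  unsum (fun i => f i + g i) (v + w).
Proof.
move=> fv gw e e0.
have [F0 H0] := fv (e / 2) (divr_gt0 e0 (ltr0Sn _ 1)).
have [F1 H1] := gw (e / 2) (divr_gt0 e0 (ltr0Sn _ 1)).
exists (F0 `|` F1)%fset => F; rewrite fsubUset => /andP[F0F F1F].
have := H0 _ F0F; have := H1 _ F1F; rewrite big_split/= opprD addrACA.
have := ND (v - \sum_(i <- F) f i) (w - \sum_(i <- F) g i); lra.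
Qed.

Lemma unsum_reindex f v (p q : I -> I) : cancel p q -> cancel q p ->
  unsum f v -> unsum (f \o p) v.
Proof.
move=> pK qK fv e e0; have [F0 H0] := fv e e0.
exists (q @` F0)%fset => F F0F.
have := H0 (p @` F)%fset; rewrite big_imfset/=; last by move=> ? ? _ _ /(can_inj pK).
apply; apply/fsubsetP => i iF0; apply/imfsetP; exists (q i); rewrite ?qK//=.
by apply: (fsubsetP F0F); apply/imfsetP; exists i.
Qed.

Lemma unsum_le f v K : unsum f v -> (forall F, N (\sum_(i <- F) f i) <= K) ->
  N v <= K.
Proof.
move=> fv fK; apply/ler_addgt0Pl => e e0; have [F0 /(_ F0) H0] := fv e e0.
have := ND (v - \sum_(i <- F0) f i) (\sum_(i <- F0) f i); rewrite subrK.
have := H0 (fsubset_refl _); have := fK F0; lra.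
Qed.

Lemma unsum_map (W : zmodType) (M : W -> R) (phi : V -> W) f v K :
  (forall F, phi (v - \sum_(i <- F) f i) = phi v - \sum_(i <- F) phi (f i)) ->
  (forall u, M (phi u) <= K * N u) -> unsum f v ->
  forall e : R, 0 < e -> exists F0 : {fset I},
  forall F, (F0 `<=` F)%fset -> M (phi v - \sum_(i <- F) phi (f i)) < e.
Proof.
move=> phiB phiK fv e e0.
have K0 : 0 < `|K| + 1 by rewrite ltr_wpDl.
have [F0 H0] := fv _ (divr_gt0 e0 K0).
exists F0 => F F0F; rewrite -phiB (le_lt_trans (phiK _))//.
have := H0 _ F0F; rewrite ltr_pdivlMr// mulrC; apply: le_lt_trans.
have N0 u : 0 <= N u.
  have := ND 0 0; have := NN 0; have := ND u (- u); rewrite NN subrr addr0; lra.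
by rewrite ler_wpM2r// (le_trans (ler_norm _))// lerDl.
Qed.

End unconditional_sums.

Section complex_sums.
Context {R : realType} {I : choiceType}.
Implicit Types (f : I -> R[i]) (l : R[i]).

Definition csum f l := unsum (@normc R) f l.

Lemma csum_unique f l m : csum f l -> csum f m -> l = m.
Proof.
move=> fl fm; apply/eqP; rewrite -subr_eq0; apply/eqP/eq0_normc/eqP.
by rewrite eq_le normc_ge0 (unsum_unique (@normcD R) (@normcN R) fl fm).
Qed.

Lemma csumM f l a : csum f l -> csum (fun i => a * f i) (a * l).
Proof.
apply: (unsum_map (@normcD R) (@normcN R) (phi := *%R a) (K := normc a)).
- by move=> F; rewrite mulrBr mulr_sumr.
- by move=> u; rewrite normcM.
Qed.

Lemma csum_conj f l : csum f l -> csum (fun i => (f i)^*%C) l^*%C.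
Proof.
apply: (unsum_map (@normcD R) (@normcN R) (phi := conjc) (K := 1)).
- by move=> F; rewrite rmorphB/= rmorph_sum.
- by move=> u; rewrite mul1r normc_conj.
Qed.

Lemma ler_sum_fset (r : I -> R) (F G : {fset I}) : (forall i, 0 <= r i) ->
  (F `<=` G)%fset -> \sum_(i <- F) r i <= \sum_(i <- G) r i.
Proof.
move=> r0 FG; rewrite [leRHS](big_fsetID _ (mem F))/=.
rewrite (_ : [fset x in G | x \in F]%fset = F) ?lerDl ?sumr_ge0//.
apply/fsetP => i; rewrite !inE/= andb_idl//; exact: (fsubsetP FG).
Qed.

Lemma csum_ge (r : I -> R) l (F : {fset I}) : csum (fun i => (r i)%:C%C) l ->
  (forall i, 0 <= r i) -> \sum_(i <- F) r i <= Re l.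
Proof.
move=> fl r0; apply/ler_addgt0Pl => e e0; have [F0 H0] := fl _ e0.
have := H0 _ (fsubsetUl F0 F); rewrite -(rmorph_sum (real_complex R)) => lG.
have := ler_sum_fset r0 (fsubsetUr F0 F).
have := le_lt_trans (Re_le_normc _) lG; rewrite cReD cReN/= ltr_norml; lra.
Qed.

End complex_sums.

Section vector_sums.
Context {R : realType} {I : choiceType} {E : lmodType R[i]} (s : semi_inner E).
Implicit Types (h : I -> E) (F : {fset I}) (c a : I -> R[i]) (u v : E) (M K e : R).

Definition vsum h v := unsum (nrm s) h v.

Definition cauchy_seq (x : nat -> E) := forall e : R, 0 < e ->
  exists N, forall m n, (N <= m)%N -> (N <= n)%N -> nrm s (x m - x n) < e.

Definition hilbert := forall x, cauchy_seq x -> exists v, forall e : R, 0 < e ->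
  exists N, forall n, (N <= n)%N -> nrm s (v - x n) < e.

Lemma vsum_ip h v u : vsum h v -> csum (fun i => s (h i) u) (s v u).
Proof.
apply: (unsum_map (nrmD s) (nrmN s) (phi := s^~ u) (K := nrm s u)).
- by move=> F; rewrite ipBl ip_suml.
- by move=> w; rewrite mulrC cauchy_schwarz.
Qed.

(** This is the bound of the synthesis map, the form that passes easily to sums of windows and to
    images under bounded operators; [bessel_analysis] is the adjoint form. *)
Definition bessel h (b : R) := 0 <= b /\ forall F c,
  nrm s (\sum_(i <- F) c i *: h i) ^+ 2 <= b ^+ 2 * \sum_(i <- F) normc (c i) ^+ 2.

Lemma bessel_analysis h b F u : bessel h b ->
  \sum_(i <- F) normc (s u (h i)) ^+ 2 <= b ^+ 2 * nrm s u ^+ 2.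
Proof.
move=> [b0 hb]; set Q := \sum_(i <- F) _.
(* For this v, <u, v> = Q, so Q^2 <= |u|^2 |v|^2 <= b^2 |u|^2 Q, and one factor Q cancels. *)
pose v := \sum_(i <- F) s u (h i) *: h i.
have Q0 : 0 <= Q by apply: sumr_ge0 => i _; exact: sqr_ge0.
have vu : s u v = Q%:C%C.
  rewrite ip_sumr rmorph_sum/=; apply: eq_bigr => i _.
  by rewrite ipZr mulrC mulcJ.
have := cauchy_schwarz s u v; rewrite vu normcR ger0_norm// => Quv.
have v2 : nrm s v ^+ 2 <= b ^+ 2 * Q := hb F _.
have Q2 : Q ^+ 2 <= nrm s u ^+ 2 * nrm s v ^+ 2.
  by rewrite -exprMn ler_pXn2r// nnegrE// mulr_ge0 ?nrm_ge0.
have [Qe|Qn] := eqVneq Q 0; first by rewrite Qe mulr_ge0// sqr_ge0.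
have Qp : 0 < Q by rewrite lt_neqAle eq_sym Qn.
rewrite -(ler_pM2r Qp) -expr2 (le_trans Q2)// [leRHS]mulrAC [leRHS]mulrC.
by rewrite ler_wpM2l// sqr_ge0.
Qed.

Lemma bessel_le h b F c K : bessel h b -> \sum_(i <- F) normc (c i) ^+ 2 <= K ^+ 2 ->
  0 <= K -> nrm s (\sum_(i <- F) c i *: h i) <= b * K.
Proof.
move=> [b0 hb] cK K0; rewrite -(@ler_pXn2r _ 2)// ?nnegrE ?nrm_ge0// ?mulr_ge0//.
by rewrite exprMn (le_trans (hb _ _))// ler_wpM2l// sqr_ge0.
Qed.

Lemma bessel_single h b i : bessel h b -> nrm s (h i) <= b.
Proof.
move=> hb; have := @bessel_le h b [fset i]%fset (fun=> 1) 1 hb.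
by rewrite !big_seq_fset1 scale1r normc1 expr1n mulr1; apply.
Qed.

(** Take finite sets [F n] whose square sums of coefficients come within 1/(n+1) of the supremum.
    Whatever is added beyond [F n] then has square sum at most 1/(n+1), hence a small norm by the
    Bessel bound. Passing through unions, the partial sums over the [F n] are Cauchy, and their
    limit is the limit along all finite sets. *)
Lemma vsum_exists h b a M : hilbert -> bessel h b ->
  (forall F, \sum_(i <- F) normc (a i) ^+ 2 <= M ^+ 2) ->
  exists v, vsum (fun i => a i *: h i) v.
Proof.
move=> cpl [b0 hb] aM.
pose q (F : {fset I}) : R := \sum_(i <- F) normc (a i) ^+ 2.
pose A : set R := [set q F | F in [set: {fset I}]]%classic.
have supA : has_sup A.
  by split; [exists (q fset0), fset0|exists (M ^+ 2) => _ [F _ <-]; exact: aM].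
have near_sup (n : nat) : exists F, sup A - n.+1%:R^-1 < q F.
  have [|_ [F _ <-] ?] := @sup_adherent _ A n.+1%:R^-1 _ supA; first by rewrite invr_gt0.
  by exists F.
have [F FP] := choice near_sup.
pose S G := \sum_(i <- G) a i *: h i.
have tail n G : (F n `<=` G)%fset -> nrm s (S G - S (F n)) ^+ 2 <= b ^+ 2 * n.+1%:R^-1.
  move=> FG; have -> : S G - S (F n) = S (G `\` F n)%fset.
    rewrite /S [X in X - _](big_fsetID _ (mem (F n)))/=.
    rewrite (_ : [fset x in G | x \in F n]%fset = F n); last first.
      by apply/fsetP => i; rewrite !inE/= andb_idl//; exact: (fsubsetP FG).
    rewrite addrAC subrr add0r; apply: eq_fbigl => i.
    by rewrite !inE/= andbC.
  rewrite (le_trans (hb _ _))// ler_wpM2l ?sqr_ge0//.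
  have qG : q G = q (F n) + q (G `\` F n)%fset.
    rewrite /q [LHS](big_fsetID _ (mem (F n)))/=; congr (_ + _).
      by apply: eq_fbigl => i; rewrite !inE/= andb_idl//; exact: (fsubsetP FG).
    by apply: eq_fbigl => i; rewrite !inE/= andbC.
  have : q G <= sup A by apply: ub_le_sup; [exact: supA.2|exists G].
  have arith (x y z w : R) : z - w < y -> y + x <= z -> x <= w by lra.
  rewrite qG; exact: arith (FP n).
have small (e : R) : 0 < e -> exists N, forall n, (N <= n)%N -> b ^+ 2 * n.+1%:R^-1 < e ^+ 2.
  move=> e0; have e2 : 0 < e ^+ 2 by exact: exprn_gt0.
  exists (Num.truncn (b ^+ 2 / e ^+ 2)) => n Nn.
  rewrite ltr_pdivrMr// -ltr_pdivrMl// mulrC.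
  apply: lt_le_trans (truncnS_gt _) _; by rewrite ler_nat.
have small_tail (e : R) : 0 < e -> exists N, forall n G, (N <= n)%N -> (F n `<=` G)%fset ->
    nrm s (S G - S (F n)) < e.
  move=> e0; have [N HN] := small e e0; exists N => n G /HN Nn /(tail n G) FG.
  by rewrite -(@ltr_pXn2r _ 2)// ?nnegrE ?nrm_ge0 ?ltW// (le_lt_trans FG).
have [u eu|v vP] := cpl (fun n => S (F n)).
  have [N HN] := small_tail (u / 2) (divr_gt0 eu (ltr0Sn _ 1)).
  exists N => m n Nm Nn.
  have := nrm_triangle s (S (F m `|` F n)%fset) (S (F m)) (S (F n)).
  have := HN m _ Nm (fsubsetUl _ (F n)); have := HN n _ Nn (fsubsetUr (F m) _).
  rewrite (nrm_distrC s _ (S (F m))); lra.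
exists v => e e0.
have [N HN] := small_tail (e / 2) (divr_gt0 e0 (ltr0Sn _ 1)).
have [N' HN'] := vP (e / 2) (divr_gt0 e0 (ltr0Sn _ 1)).
pose n := maxn N N'; exists (F n) => G FG.
have := nrm_triangle s (S (F n)) v (S G); rewrite -/(S G).
have := HN n G (leq_maxl _ _) FG; have := HN' n (leq_maxr _ _).
rewrite (nrm_distrC s (S G)); lra.
Qed.

End vector_sums.

Lemma bernoulli (R : realFieldType) (r : R) n : -1 <= r -> 1 + n%:R * r <= (1 + r) ^+ n.
Proof.
move=> r1; elim: n => [|n IH]; first by rewrite mul0r addr0 expr0.
rewrite exprS; have r0 : 0 <= 1 + r by lra.
apply: le_trans (ler_wpM2l r0 IH).
have n0 : (0 : R) <= n%:R by [].
rewrite -natr1; have := sqr_ge0 r; nra.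
Qed.

(* Log-convexity makes y_{n+1} / y_n nondecreasing, so y_n >= (y_1 / y_0)^n y_0. *)
Lemma log_convex_growth (R : realType) (y : nat -> R) (K M : R) :
  0 <= K -> (forall n, 0 <= y n) ->
  (forall n, y n.+1 ^+ 2 <= y n.+2 * y n) ->
  (forall n, y n <= K ^+ n * M) -> y 1%N <= K * y 0%N.
Proof.
move=> K0 y0 ylc yM.
have [y00|y00] := eqVneq (y 0%N) 0.
  have := ylc 0%N; rewrite y00 !mulr0 => y1; rewrite le_eqVlt; apply/orP; left.
  by rewrite -sqrf_eq0 eq_le y1 sqr_ge0.
have y0p : 0 < y 0%N by rewrite lt_neqAle eq_sym y00 y0.
rewrite leNgt; apply/negP => Ky.
set q := y 1%N / y 0%N.
have Kq : K < q by rewrite ltr_pdivlMr.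
have q0 : 0 < q by exact: le_lt_trans Kq.
have step n : 0 < y n /\ q * y n <= y n.+1.
  elim: n => [|n [yn yq]]; first by rewrite /q divfK.
  have yn1 : 0 < y n.+1 by rewrite (lt_le_trans _ yq)// mulr_gt0.
  split=> //; rewrite -(ler_pM2r yn) (le_trans _ (ylc n))// expr2 mulrAC.
  by rewrite ler_pM2r// .
have geo n : q ^+ n * y 0%N <= y n.
  elim: n => [|n IH]; first by rewrite expr0 mul1r.
  by rewrite exprS -mulrA (le_trans _ (step n).2)// ler_wpM2l// ltW.
(* The ratio q / K used below requires K > 0; if K = 0, the growth bound at n = 1 already
   contradicts y 1 > 0. *)
have [Ke|Kn] := eqVneq K 0.
  by have := yM 1%N; have := (step 1%N).1; rewrite Ke expr1 mul0r ltNge => /negP.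
have Kp : 0 < K by rewrite lt_neqAle eq_sym Kn.
have M0 : 0 < M.
  by have := lt_le_trans y0p (yM 0%N); rewrite expr0 mul1r.
pose d := q / K - 1.
have d0 : 0 < d by rewrite subr_gt0 ltr_pdivlMr ?mul1r.
have bound n : 1 + n%:R * d <= M / y 0%N.
  apply: (le_trans (bernoulli n _)); first by lra.
  rewrite addrC subrK expr_div_n ler_pdivlMr// mulrAC ler_pdivrMr ?exprn_gt0//.
  by rewrite (le_trans (geo n))// mulrC.
have := bound (Num.truncn (M / y 0%N / d)).+1.
have := truncnS_gt (M / y 0%N / d); rewrite ltr_pdivrMr//; lra.
Qed.

(** * Orbits of projective representations *)

(** The group structure on the index set enters only through the laws that reindexing needs: left
    multiplications are bijections and inversion is an involution. The phase in [repM] is left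
    unspecified because only its modulus matters. *)
Record twisted_rep (R : realType) (I : choiceType) (E : lmodType R[i])
    (s : semi_inner E) := TwistedRep {
  rep :> I -> E -> E;
  rep_mul : I -> I -> I;
  rep_inv : I -> I;
  rep_one : I;
  repD : forall i u v, rep i (u + v) = rep i u + rep i v;
  repZ : forall i a u, rep i (a *: u) = a *: rep i u;
  rep_ip : forall i u v, s (rep i u) (rep i v) = s u v;
  rep1 : forall u, rep rep_one u = u;
  repM : forall j i, exists2 w : R[i], normc w = 1 &
    forall u, rep j (rep i u) = w *: rep (rep_mul j i) u;
  rep_mulK : forall j, cancel (rep_mul j) (rep_mul (rep_inv j));
  rep_mulVK : forall j, cancel (rep_mul (rep_inv j)) (rep_mul j);
  rep_mulV : forall j, rep_mul j (rep_inv j) = rep_one;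
  rep_invK : involutive rep_inv }.

Section twisted.
Context {R : realType} {I : choiceType} {E : lmodType R[i]} {s : semi_inner E}.
Context (cpl : hilbert s) (pi : twisted_rep I s).
Implicit Types (al be de f g u v : E) (a b c d : R) (F : {fset I}).

Local Notation mul := (rep_mul pi).
Local Notation inv := (rep_inv pi).

Definition orb g : I -> E := fun i => pi i g.
Definition bess g b := bessel s (orb g) b.

Lemma rep_sum j (J : Type) (r : seq J) (h : J -> E) :
  pi j (\sum_(i <- r) h i) = \sum_(i <- r) pi j (h i).
Proof.
elim: r => [|i r IH]; last by rewrite !big_cons repD IH.
by rewrite !big_nil -(scale0r 0) repZ !scale0r.
Qed.

Lemma nrm_rep j u : nrm s (pi j u) = nrm s u.
Proof. by rewrite /nrm rep_ip. Qed.

Lemma rep_surj j u : exists v, u = pi j v.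
Proof.
have [w w1 wP] := repM pi j (inv j).
have w0 : w != 0 by apply: contra_eq_neq w1 => ->; rewrite normc0 eq_sym oner_eq0.
exists (w^-1 *: pi (inv j) u).
by rewrite repZ wP scalerA mulVf// scale1r rep_mulV rep1.
Qed.

Lemma rep_adj i u v : normc (s (pi i u) v) = normc (s u (pi (inv i) v)).
Proof.
have [w w1 wP] := repM pi (inv i) i.
have iv : mul (inv i) i = rep_one pi by rewrite -{2}(rep_invK pi i) rep_mulV.
by rewrite -(rep_ip pi (inv i)) wP iv rep1 ipZl normcM w1 mul1r.
Qed.

Lemma nrm_le_bess g b : bess g b -> nrm s g <= b.
Proof. by move/bessel_single => /(_ (rep_one pi)); rewrite /orb rep1. Qed.

Lemma bess_ge0 g b : bess g b -> 0 <= b. Proof. by case. Qed.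

Lemma bessD g h a b : bess g a -> bess h b -> bess (g + h) (a + b).
Proof.
move=> ga hb; split; first by rewrite addr_ge0// (bess_ge0 ga, bess_ge0 hb).
move=> F c; set S := \sum_(i <- F) normc _ ^+ 2.
have S0 : 0 <= S by apply: sumr_ge0 => i _; exact: sqr_ge0.
rewrite -(sqr_sqrtr S0) -exprMn.
rewrite ler_pXn2r// ?nnegrE ?nrm_ge0// ?mulr_ge0 ?addr_ge0 ?sqrtr_ge0 ?(bess_ge0 ga) ?(bess_ge0 hb)//.
rewrite (eq_bigr (fun i => c i *: orb g i + c i *: orb h i)); last first.
  by move=> i _; rewrite /orb repD scalerDr.
rewrite big_split/= (le_trans (nrmD _ _ _))// mulrDl lerD//.
- by apply: (bessel_le ga); rewrite ?sqrtr_ge0// sqr_sqrtr.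
- by apply: (bessel_le hb); rewrite ?sqrtr_ge0// sqr_sqrtr.
Qed.

Lemma bessN g b : bess g b -> bess (- g) b.
Proof.
case=> b0 gb; split=> // F c; rewrite -nrmN -sumrN.
rewrite (eq_bigr (fun i => c i *: orb g i)); first exact: gb.
by move=> i _; rewrite /orb -scaleN1r repZ scaleN1r scalerN opprK.
Qed.

(** The mixed frame operator with analysis window [be] and synthesis window [de]. Its value is
    determined only up to null vectors, so one limit is picked by [xget], and the identities below
    are stated inside inner products or norms. The default 0 never occurs when both windows are
    Bessel, by [thetaP]. *)
Definition theta be de f : E :=
  xget 0 [set v | vsum s (fun i => s f (pi i be) *: pi i de) v]%classic.

Section theta.
Context be de b d (beb : bess be b) (ded : bess de d).

Lemma thetaP f : vsum s (fun i => s f (pi i be) *: pi i de) (theta be de f).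
Proof.
have [F|v vP] := @vsum_exists _ _ _ s _ _ (fun i => s f (pi i be)) (b * nrm s f) cpl ded.
  by rewrite exprMn; exact: bessel_analysis beb.
by rewrite /theta; case: xgetP => [w -> //|/(_ v)].
Qed.

Lemma theta_csum f u :
  csum (fun i => s f (pi i be) * s (pi i de) u) (s (theta be de f) u).
Proof. by have := vsum_ip u (thetaP f); under eq_fun do rewrite ipZl. Qed.

Lemma theta_bound f K : 0 <= K ->
  (forall F, \sum_(i <- F) normc (s f (pi i be)) ^+ 2 <= K ^+ 2) ->
  nrm s (theta be de f) <= d * K.
Proof.
move=> K0 fK; apply: (unsum_le (nrmD s) (thetaP f)) => F.
by apply: (bessel_le ded).
Qed.

Lemma theta_le f : nrm s (theta be de f) <= d * (b * nrm s f).
Proof.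
apply: theta_bound => [|F]; first by rewrite mulr_ge0 ?nrm_ge0// (bess_ge0 beb).
by rewrite exprMn; exact: bessel_analysis beb.
Qed.

Lemma theta_ipD f g u :
  s (theta be de (f + g)) u = s (theta be de f) u + s (theta be de g) u.
Proof.
apply: (csum_unique (theta_csum _ _)).
have := unsumD (@normcD R) (theta_csum f u) (theta_csum g u).
by under eq_fun do rewrite -mulrDl -ipDl.
Qed.

Lemma theta_ipZ (z : R[i]) f u : s (theta be de (z *: f)) u = z * s (theta be de f) u.
Proof.
apply: (csum_unique (theta_csum _ _)).
have := csumM z (theta_csum f u).
by under eq_fun do rewrite mulrA -(ipZl s z f).
Qed.

Lemma theta_ipB f g u :
  s (theta be de (f - g)) u = s (theta be de f) u - s (theta be de g) u.
Proof. by have := theta_ipD (f - g) g u; rewrite subrK => ->; rewrite addrK. Qed.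

Lemma theta_ip_sum (J : Type) (r : seq J) (h : J -> E) (c : J -> R[i]) u :
  s (theta be de (\sum_(i <- r) c i *: h i)) u =
  \sum_(i <- r) c i * s (theta be de (h i)) u.
Proof.
elim: r => [|i r IH]; last by rewrite !big_cons theta_ipD theta_ipZ IH.
by rewrite !big_nil -(scale0r 0) theta_ipZ mul0r.
Qed.

(** Mixed frame operators commute with the representation: reindex the sum by left multiplication by
    [j]. Each phase enters one factor as itself and the other as its conjugate, so it disappears. *)
Lemma theta_rep j f u : s (theta be de (pi j f)) (pi j u) = s (theta be de f) u.
Proof.
apply: (csum_unique _ (theta_csum f u)).
have := unsum_reindex (rep_mulK pi j) (rep_mulVK pi j) (theta_csum (pi j f) (pi j u)).
congr csum; apply/funext => k /=.
have [w w1 wP] := repM pi j k.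
rewrite -(rep_ip pi j f) -(rep_ip pi j _ u) !wP ipZl ipZr mulrACA.
by rewrite [_ * w]mulrC unimodularV// mul1r.
Qed.

Lemma rep_theta j f u : s (pi j (theta be de f)) u = s (theta be de (pi j f)) u.
Proof. by have [v ->] := rep_surj j u; rewrite rep_ip theta_rep. Qed.

End theta.

Lemma theta_adj be de b d : bess be b -> bess de d -> forall f u,
  s (theta be de f) u = s f (theta de be u).
Proof.
move=> beb ded f u; rewrite (ipC s _ f); apply: (csum_unique (theta_csum beb ded f u)).
have := csum_conj (theta_csum ded beb u f).
by under eq_fun do rewrite rmorphM/= -!ipC mulrC.
Qed.

Lemma theta_ipDr be de de' b d d' : bess be b -> bess de d -> bess de' d' ->
  forall f u, s (theta be (de + de') f) u = s (theta be de f) u + s (theta be de' f) u.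
Proof.
move=> beb ded ded' f u; apply: (csum_unique (theta_csum beb (bessD ded ded') f u)).
have := unsumD (@normcD R) (theta_csum beb ded f u) (theta_csum beb ded' f u).
by under eq_fun do rewrite -mulrDr -ipDl -repD.
Qed.

Lemma theta_ipDl be be' de b b' d : bess be b -> bess be' b' -> bess de d ->
  forall f u, s (theta (be + be') de f) u = s (theta be de f) u + s (theta be' de f) u.
Proof.
move=> beb beb' ded f u; apply: (csum_unique (theta_csum (bessD beb beb') ded f u)).
have := unsumD (@normcD R) (theta_csum beb ded f u) (theta_csum beb' ded f u).
by under eq_fun do rewrite -mulrDl -ipDr -repD.
Qed.

(** Since [theta be de] commutes with the representation, a synthesis sum of the orbit of
    [theta be de al] is the image of the same sum for [al]; the operator bound d b multiplies the
    Bessel bound a. *)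
Lemma bess_theta al be de a b d : bess al a -> bess be b -> bess de d ->
  bess (theta be de al) (d * (b * a)).
Proof.
move=> ala beb ded; split; first by rewrite !mulr_ge0 ?(bess_ge0 ala) ?(bess_ge0 beb) ?(bess_ge0 ded).
move=> F c; rewrite (@nrm_ip _ _ s _ (theta be de (\sum_(i <- F) c i *: orb al i))); last first.
  move=> u; rewrite ip_suml (theta_ip_sum beb ded); apply: eq_bigr => i _.
  by rewrite ipZl /orb (rep_theta beb ded).
have := theta_le beb ded (\sum_(i <- F) c i *: orb al i).
rewrite -(@ler_pXn2r _ 2)// ?nnegrE ?nrm_ge0 ?mulr_ge0 ?nrm_ge0 ?(bess_ge0 beb) ?(bess_ge0 ded)//.
move=> /le_trans; apply.
have := ler_wpM2l (sqr_ge0 (d * b)) (ala.2 F c); congr (_ <= _); first ring.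
by move: (\sum_(i <- F) normc _ ^+ 2) => z; ring.
Qed.

Lemma rep_inv_ip i u v (w : R[i]) :
  (forall x, pi i (pi (inv i) x) = w *: x) -> s (pi (inv i) u) v = w * s u (pi i v).
Proof. by move=> wP; rewrite -(rep_ip pi i) wP ipZl. Qed.

(** The exchange of slots: in $\sum_i\langle al,\pi_i be\rangle\langle\pi_i de,u\rangle$ move each
    $\pi_i$ to the other side of both inner products and reindex by inversion. This takes [de] out
    of the sum, so that its plain norm can enter an estimate. *)
Lemma theta_swap al be de u a b d c : bess al a -> bess be b -> bess de d -> bess u c ->
  s (theta be de al) u = s de (theta al u be).
Proof.
move=> ala beb ded uc; rewrite (ipC s _ de).
apply: (csum_unique _ (csum_conj (theta_csum ala uc be de))).
have := unsum_reindex (rep_invK pi) (rep_invK pi) (theta_csum beb ded al u).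
congr csum; apply/funext => i /=.
have [w w1 wP] := repM pi i (inv i).
have {}wP x : pi i (pi (inv i) x) = w *: x by rewrite wP rep_mulV rep1.
rewrite (ipC s _ al) !(rep_inv_ip _ _ wP) !rmorphM/= -!ipC.
by rewrite mulrACA [_ * w]mulrC unimodularV// mul1r.
Qed.

(* Lax: [W := fun x => theta al (theta be x al) be] is symmetric on the Bessel
   vectors and bounded for the Bessel norm by [(a * b) ^+ 2], hence it is bounded
   for the Hilbert norm by the same constant. *)
Lemma theta_lax al be de a b d : bess al a -> bess be b -> bess de d ->
  nrm s (theta be de al) <= a * b * nrm s de.
Proof.
move=> ala beb ded.
have a0 := bess_ge0 ala; have b0 := bess_ge0 beb; have d0 := bess_ge0 ded.
pose W x := theta al (theta be x al) be.
have Wip x y c e : bess x c -> bess y e ->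
    s (W x) y = s (theta be x al) (theta be y al).
  move=> xc ye; exact: theta_swap beb ala (bess_theta ala beb xc) ye.
have Wsym x y c e : bess x c -> bess y e -> s (W x) y = s x (W y).
  by move=> xc ye; rewrite (Wip _ _ _ _ xc ye) (ipC s _ x) (Wip _ _ _ _ ye xc) -ipC.
pose x n := iter n W de.
have xb n : bess (x n) (((a * b) ^+ 2) ^+ n * d).
  elim: n => [|n IH]; first by rewrite expr0 mul1r.
  have := bess_theta beb ala (bess_theta ala beb IH).
  rewrite [x n.+1]iterS -/(x n) => H; congr bess: H.
  by rewrite [in RHS]exprSr; move: (_ ^+ n) => z; ring.
pose y n := nrm s (x n).
(* Symmetry gives |W^(n+1) de|^2 = <W^n de, W^(n+2) de>, whence log-convexity of the norms; their
   geometric growth comes from the Bessel bounds [xb], which dominate the norms. *)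
have y1 : y 1%N <= (a * b) ^+ 2 * y 0%N.
  apply: (@log_convex_growth _ y _ d); first exact: sqr_ge0.
  - by move=> n; exact: nrm_ge0.
  - move=> n; rewrite /y nrm_sqr {1}[x n.+1]iterS (Wsym _ _ _ _ (xb n) (xb n.+1)) mulrC.
    by rewrite (le_trans (ler_norm _))// (le_trans (Re_le_normc _))// cauchy_schwarz.
  - by move=> n; exact: nrm_le_bess.
rewrite -(@ler_pXn2r _ 2)// ?nnegrE ?nrm_ge0 ?mulr_ge0 ?nrm_ge0//.
(* The squared norm of [theta be de al] is <W de, de>, at most |W de| |de| <= (a b)^2 |de|^2. *)
rewrite nrm_sqr -(Wip _ _ _ _ ded ded) exprMn [nrm s de ^+ 2]expr2 mulrA.
rewrite (le_trans (ler_norm _))// (le_trans (Re_le_normc _))//.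
by rewrite (le_trans (cauchy_schwarz _ _ _))// ler_wpM2r ?nrm_ge0.
Qed.

End twisted.

(** * Closed spans and canonical dual windows *)

Section spans.
Context {R : realType} {I : choiceType} {E : lmodType R[i]} (s : semi_inner E).
Implicit Types (h : I -> E) (u v w : E) (F : {fset I}) (c : I -> R[i]).

Definition comb h u := exists F c, u = \sum_(i <- F) c i *: h i.

Definition inspan h v := forall e : R, 0 < e -> exists2 u, comb h u & nrm s (v - u) < e.

Lemma comb0 h : comb h 0.
Proof. by exists fset0, (fun=> 0); rewrite big_seq_fset0. Qed.

Lemma combZ h (z : R[i]) u : comb h u -> comb h (z *: u).
Proof.
move=> [F [c ->]]; exists F, (fun i => z * c i).
by rewrite scaler_sumr; apply: eq_bigr => i _; rewrite scalerA.
Qed.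

Lemma combD h u v : comb h u -> comb h v -> comb h (u + v).
Proof.
move=> [F [c ->]] [G [d ->]].
pose r (H : {fset I}) (c : I -> R[i]) i := if i \in H then c i else 0.
have widen (H K : {fset I}) e : (H `<=` K)%fset ->
    \sum_(i <- H) e i *: h i = \sum_(i <- K) r H e i *: h i.
  move=> HK; rewrite -(big_fset_incl _ HK); last first.
    by move=> i _ iH; rewrite /r (negbTE iH) scale0r.
  by rewrite big_seq [RHS]big_seq; apply: eq_bigr => i iH; rewrite /r iH.
exists (F `|` G)%fset, (fun i => r F c i + r G d i).
rewrite (widen _ _ _ (fsubsetUl F G)) (widen _ _ _ (fsubsetUr F G)) -big_split/=.
by apply: eq_bigr => i _; rewrite scalerDl.
Qed.

Lemma comb_gen h i : comb h (h i).
Proof. by exists [fset i]%fset, (fun=> 1); rewrite big_seq_fset1 scale1r. Qed.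

Lemma comb_sum (J : Type) (r : seq J) (k : J -> E) h :
  (forall j, comb h (k j)) -> comb h (\sum_(j <- r) k j).
Proof.
move=> hk; elim: r => [|j r IH]; first by rewrite big_nil; exact: comb0.
by rewrite big_cons; exact: combD.
Qed.

Lemma inspan_gen h i : inspan h (h i).
Proof. by move=> e e0; exists (h i); [exact: comb_gen|rewrite subrr nrm0]. Qed.

Lemma inspanD h u v : inspan h u -> inspan h v -> inspan h (u + v).
Proof.
move=> hu hv e e0.
have [u' hu' uu'] := hu (e / 2) (divr_gt0 e0 (ltr0Sn _ 1)).
have [v' hv' vv'] := hv (e / 2) (divr_gt0 e0 (ltr0Sn _ 1)).
exists (u' + v'); first exact: combD.
rewrite opprD addrACA; have := nrmD s (u - u') (v - v'); lra.
Qed.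

Lemma inspanZ h (z : R[i]) u : inspan h u -> inspan h (z *: u).
Proof.
move=> hu e e0; have z0 : 0 < normc z + 1 by rewrite ltr_wpDl// normc_ge0.
have [u' hu' uu'] := hu _ (divr_gt0 e0 z0).
exists (z *: u'); first exact: combZ.
rewrite -scalerBr nrmZ; move: uu'; rewrite ltr_pdivlMr// mulrC; apply: le_lt_trans.
by rewrite ler_wpM2r ?nrm_ge0// lerDl.
Qed.

Lemma inspanB h u v : inspan h u -> inspan h v -> inspan h (u - v).
Proof. by move=> hu hv; rewrite -scaleN1r; apply: inspanD => //; exact: inspanZ. Qed.

Lemma inspan_sum (J : Type) (r : seq J) (k : J -> E) h :
  (forall j, inspan h (k j)) -> inspan h (\sum_(j <- r) k j).
Proof.
move=> hk; elim: r => [|j r IH]; last by rewrite big_cons; exact: inspanD.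
by rewrite big_nil => e e0; exists 0; [exact: comb0|rewrite subrr nrm0].
Qed.

Lemma inspan_closed h v :
  (forall e : R, 0 < e -> exists2 u, inspan h u & nrm s (v - u) < e) -> inspan h v.
Proof.
move=> hv e e0.
have [u hu vu] := hv (e / 2) (divr_gt0 e0 (ltr0Sn _ 1)).
have [u' hu' uu'] := hu (e / 2) (divr_gt0 e0 (ltr0Sn _ 1)).
exists u' => //; have := nrm_triangle s u v u'; lra.
Qed.

Lemma inspan_vsum h (k : I -> E) v :
  (forall i, inspan h (k i)) -> vsum s k v -> inspan h v.
Proof.
move=> hk kv; apply: inspan_closed => e /kv[F /(_ F (fsubset_refl _)) Fe].
by exists (\sum_(i <- F) k i) => //; exact: inspan_sum.
Qed.

(** The lower frame inequality with its infinite sum replaced by finite sums up to an error [e]. *)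
Definition frame_lower h (A : R) := 0 < A /\ forall v, inspan h v ->
  forall e : R, 0 < e -> exists F : {fset I},
    A * nrm s v ^+ 2 - e <= \sum_(i <- F) normc (s v (h i)) ^+ 2.

End spans.

Section dual_window.
Context {R : realType} {I : choiceType} {E : lmodType R[i]} {s : semi_inner E}.
Context (cpl : hilbert s) (pi : twisted_rep I s).

Local Notation bess := (bess pi).
Local Notation theta := (theta pi).

Lemma inspan_rep g v j : inspan s (orb pi g) v -> inspan s (orb pi g) (pi j v).
Proof.
move=> gv e /gv[u [F [c ->]] vu].
exists (pi j (\sum_(i <- F) c i *: orb pi g i)); last first.
  by rewrite -scaleN1r -repZ -repD nrm_rep scaleN1r.
rewrite rep_sum; apply: comb_sum => i; rewrite repZ; apply: combZ.
rewrite /orb; have [w w1 ->] := repM pi j i.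
exact/combZ/comb_gen.
Qed.

Lemma inspan_theta be de f b d g : bess be b -> bess de d ->
  (forall i, inspan s (orb pi g) (pi i de)) -> inspan s (orb pi g) (theta be de f).
Proof.
move=> beb ded gd; apply: inspan_vsum (thetaP cpl beb ded f) => i.
exact: inspanZ.
Qed.

(** Pairing the frame operator with [v] gives the sum of the squared coefficients, so A |v|^2 <= <S
    v, v> <= |S v| |v|. *)
Lemma frame_lower_theta g b A v : bess g b -> frame_lower s (orb pi g) A ->
  inspan s (orb pi g) v -> A * nrm s v <= nrm s (theta g g v).
Proof.
move=> gb [A0 gA] gv.
have v0 := nrm_ge0 s v.
have [ve|vn] := eqVneq (nrm s v) 0; first by rewrite ve mulr0 nrm_ge0.
have vp : 0 < nrm s v by rewrite lt_neqAle eq_sym vn.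
rewrite -(ler_pM2r vp) -mulrA -expr2; apply/ler_addgt0Pl => e e0.
have [F HF] := gA v gv e e0.
rewrite addrC -lerBlDr (le_trans HF)//.
have := theta_csum cpl gb gb v v.
have -> : (fun i => s v (pi i g) * s (pi i g) v) =
          (fun i => (normc (s v (pi i g)) ^+ 2)%:C%C).
  by apply/funext => i; rewrite (ipC s v) mulcJ.
move=> /csum_ge => /(_ F (fun i => sqr_ge0 _)) /le_trans; apply.
by rewrite (le_trans (ler_norm _))// (le_trans (Re_le_normc _))// cauchy_schwarz.
Qed.

Section fixed_window.
Context g ga b A (gb : bess g b) (gA : frame_lower s (orb pi g) A)
  (gga : inspan s (orb pi g) ga) (Sga : nrm s (theta g g ga - g) = 0).

Let A0 : 0 < A. Proof. exact: gA.1. Qed.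

Lemma theta_dual i u : s (theta g g (pi i ga)) u = s (pi i g) u.
Proof.
by have [v ->] := rep_surj pi i u; rewrite (theta_rep cpl gb gb) rep_ip (nrm_sub_eq0 Sga).
Qed.

(** The frame operator sends $\sum_i c_i\pi_i ga$ to $\sum_i c_i\pi_i g$ and is bounded below by A
    on the closed span, which contains the orbit of [ga]. *)
Lemma bess_dual : bess ga (b / A).
Proof.
split; first by rewrite divr_ge0 ?(bess_ge0 gb)// ltW.
move=> F c; set v := \sum_(i <- F) _.
have gv : inspan s (orb pi g) v.
  by apply: inspan_sum => i; apply: inspanZ; exact: inspan_rep.
have -> : (b / A) ^+ 2 * \sum_(i <- F) normc (c i) ^+ 2 =
    A ^- 2 * (b ^+ 2 * \sum_(i <- F) normc (c i) ^+ 2).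
  by rewrite expr_div_n mulrAC mulrC.
rewrite ler_pdivlMl ?exprn_gt0// -exprMn.
apply: le_trans (gb.2 F c).
rewrite (@nrm_ip _ _ s (\sum_(i <- F) c i *: orb pi g i) (theta g g v)); last first.
  move=> u; rewrite (theta_ip_sum cpl gb gb) ip_suml; apply: eq_bigr => i _.
  by rewrite ipZl theta_dual.
rewrite ler_pXn2r// ?nnegrE ?mulr_ge0 ?nrm_ge0 ?(ltW A0)//.
exact: (frame_lower_theta gb gA gv).
Qed.

Lemma inspan_eq0 z : inspan s (orb pi g) z -> (forall w, s (theta g g z) w = 0) ->
  nrm s z = 0.
Proof.
move=> gz z0; have := frame_lower_theta gb gA gz.
rewrite (@nrm_ip _ _ s (theta g g z) 0) ?nrm0; last by move=> w; rewrite z0 ip0l.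
by rewrite pmulr_rle0// => h; apply/eqP; rewrite eq_le h nrm_ge0.
Qed.

(** The frame operator is injective on the closed span up to null vectors, and it maps both sides to
    $\sum_i\langle u,\pi_i g\rangle\pi_i g$. *)
Lemma theta_synth_dual u : inspan s (orb pi g) u -> nrm s (theta g ga u - u) = 0.
Proof.
move=> gu; apply: inspan_eq0.
  apply: inspanB => //; apply: (inspan_theta _ gb bess_dual) => i.
  exact: inspan_rep.
move=> w; rewrite (theta_ipB cpl gb gb); apply/eqP; rewrite subr_eq0; apply/eqP.
rewrite (theta_adj cpl gb gb); apply: (csum_unique _ (theta_csum cpl gb gb u w)).
have := theta_csum cpl gb bess_dual u (theta g g w).
by under eq_fun do rewrite -(theta_adj cpl gb gb) theta_dual.
Qed.

(** [theta ga g] is the adjoint of [theta g ga], which acts as the identity on the closed span; so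
    the difference is orthogonal to the closed span while lying in it. *)
Lemma theta_analysis_dual f : inspan s (orb pi g) f -> nrm s (theta ga g f - f) = 0.
Proof.
move=> gf; set z := _ - f.
have gz : inspan s (orb pi g) z.
  apply: inspanB => //; apply: (inspan_theta _ bess_dual gb) => i.
  exact: (inspan_gen s (orb pi g) i).
have zu u : inspan s (orb pi g) u -> s z u = 0.
  move=> gu; rewrite ipBl (theta_adj cpl bess_dual gb) -ipBr ipC.
  by rewrite (nrm_sub_eq0 (v := 0)) ?ip0l ?rmorph0// subr0 theta_synth_dual.
by rewrite /nrm zu// sqrtr0.
Qed.

End fixed_window.

Theorem dual_lipschitz g ga b A : bess g b -> frame_lower s (orb pi g) A ->
  inspan s (orb pi g) ga -> nrm s (theta g g ga - g) = 0 ->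
  exists K, forall U : E -> E,
    (forall u v, U (u + v) = U u + U v) -> (forall z u, U (z *: u) = z *: U u) ->
    (forall u v, s (U u) (U v) = s u v) -> (forall u, exists v, u = U v) ->
    (forall i, exists2 z : R[i], normc z = 1 & forall u, pi i (U u) = z *: U (pi i u)) ->
    nrm s (U ga - ga) <= K * nrm s (U g - g).
Proof.
move=> gb gA gga Sga.
have [b0 A0] := (bess_ge0 gb, gA.1).
have gac := bess_dual gb gA gga Sga.
move: gac; set c := b / A => gac; have c0 := bess_ge0 gac.
(* The triangle inequality goes through the vector [w] below. The term c * c bounds |ga - w|, and
   the quotient by A bounds |U ga - w|; its four summands are the four terms of [key]. *)
exists ((1 + b * c + b * c + b * b * (c * c)) / A + c * c).
move=> U UD UZ Uip Usurj Upi.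
set g' := U g; set ga' := U ga; set D := g' - g.
have [z zP] := choice (fun i => let: ex_intro2 z z1 zU := Upi i in
  ex_intro (fun z => normc z = 1 /\ forall u, pi i (U u) = z *: U (pi i u)) z (conj z1 zU)).
have Usum (r : seq I) (h : I -> E) : U (\sum_(i <- r) h i) = \sum_(i <- r) U (h i).
  elim: r => [|i r IH]; last by rewrite !big_cons UD IH.
  by rewrite !big_nil -(scale0r 0) UZ !scale0r.
have Unrm u : nrm s (U u) = nrm s u by rewrite /nrm Uip.
have UB u v : U u - U v = U (u - v) by rewrite UD -(scaleN1r v) UZ scaleN1r.
have piU i u : pi i (U u) = U (z i *: pi i u) by rewrite (zP i).2 UZ.
(* Each [pi i g'] is the unimodular multiple [z i] of [U (pi i g)], so both frame bounds are carried
   over by the isometry [U]. *)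
have g'b : bess g' b.
  split=> // F e; rewrite (eq_bigr (fun i => U ((e i * z i) *: pi i g))).
    rewrite -Usum Unrm (le_trans (gb.2 F _))// ler_wpM2l ?sqr_ge0//.
    by apply: ler_sum => i _; rewrite normcM (zP i).1 mulr1.
  by move=> i _; rewrite /orb piU UZ UZ scalerA -UZ.
have g'A : frame_lower s (orb pi g') A.
  split=> // v g'v e e0; have [v0 vE] := Usurj v.
  have gv0 : inspan s (orb pi g) v0.
    move=> k /g'v[_ [F [a ->]]].
    rewrite (eq_bigr (fun i => U ((a i * z i) *: pi i g))); last first.
      by move=> i _; rewrite /orb piU UZ UZ scalerA -UZ.
    rewrite -Usum vE UB Unrm; exists (\sum_(i <- F) (a i * z i) *: pi i g) => //.
    by exists F, (fun i => a i * z i).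
  have [F HF] := gA.2 v0 gv0 e e0; exists F.
  rewrite vE Unrm (le_trans HF)//; apply: ler_sum => i _.
  by rewrite /orb piU Uip ipZr normcM normc_conj (zP i).1 mul1r.
have g'ga' : inspan s (orb pi g') ga'.
  move=> e /gga[_ [F [a ->]] Fe].
  exists (U (\sum_(i <- F) a i *: orb pi g i)); last by rewrite UB Unrm.
  rewrite Usum; apply: comb_sum => i; rewrite UZ; apply: combZ.
  have -> : U (orb pi g i) = (z i)^*%C *: orb pi g' i.
    by rewrite /orb piU UZ scalerA mulrC unimodularV ?(zP i).1// scale1r.
  exact/combZ/comb_gen.
have Sga' u : s (theta g' g' ga') u = s g' u.
  have [u0 ->] := Usurj u; rewrite Uip -(nrm_sub_eq0 Sga).
  apply: csum_unique (theta_csum cpl g'b g'b ga' (U u0)) _.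
  have := theta_csum cpl gb gb ga u0; congr csum; apply/funext => i /=.
  rewrite !piU !Uip ipZl ipZr mulrACA [_^*%C * _]mulrC unimodularV ?(zP i).1//.
  by rewrite mul1r.
have Db : bess D (b + b) by apply: bessD => //; exact: bessN.
have g'E : g' = g + D by rewrite /D addrC subrK.
set d := nrm s D; have d0 : 0 <= d := nrm_ge0 s D.
(* With g in place of g' this would reproduce [ga]. Hence [ga - w] is [- theta ga D ga] up to a null
   vector, and [w] lies in the closed span of the orbit of g', as the lower bound requires. *)
set w := theta ga g' ga.
have g'w : inspan s (orb pi g') w.
  apply: (inspan_theta _ gac g'b) => i; exact: inspan_gen.
have gaw : nrm s (ga - w) <= c * c * d.
  rewrite (@nrm_ip _ _ s _ (- theta ga D ga)) ?nrmN; last first.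
    move=> u; rewrite ipBl ipNl /w g'E (theta_ipDr cpl gac gb Db) opprD addrA.
    rewrite -(nrm_sub_eq0 (theta_analysis_dual gb gA gga Sga gga)) subrr.
    by rewrite add0r.
  exact: (theta_lax cpl gac gac Db).
have Dga : nrm s (theta D g' ga) <= b * (c * d).
  apply: (theta_bound cpl Db g'b); first by rewrite mulr_ge0.
  move=> F; rewrite exprMn.
  have := bessel_analysis (rep_inv pi @` F)%fset D gac.
  rewrite big_imfset/=; last by move=> i j _ _ /(can_inj (rep_invK pi)).
  congr (_ <= _); apply: eq_bigr => i _; rewrite /orb.
  by rewrite ipC normc_conj rep_adj rep_invK (ipC s (pi i D)) normc_conj.
have gD : nrm s (theta g D ga) <= b * c * d.
  by rewrite (mulrC b); exact: (theta_lax cpl gac gb Db).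
(* The frame operator of g' sends [ga'] to g'. Its value at [w] is its value at [ga] minus its value
   at [ga - w], and g' = g + D expands the value at [ga] into g plus two terms carrying D in one
   slot. *)
have key : A * nrm s (ga' - w) <= d + b * c * d + b * (c * d) + b * (b * (c * c * d)).
  apply: (le_trans (frame_lower_theta g'b g'A (inspanB g'ga' g'w))).
  rewrite (@nrm_ip _ _ s _ (D - theta g D ga - theta D g' ga + theta g' g' (ga - w))).
    apply: (le_trans (nrmD _ _ _)); apply: lerD; last first.
      apply: (le_trans (theta_le cpl g'b g'b _)).
      by rewrite ler_wpM2l// ler_wpM2l.
    apply: (le_trans (nrmB _ _ _)); apply: lerD => //.
    by apply: (le_trans (nrmB _ _ _)); apply: lerD.
  move=> u; rewrite (theta_ipB cpl g'b g'b) Sga' ipDl (theta_ipB cpl g'b g'b).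
  rewrite (ipBl s (D - _)) (ipBl s D).
  have -> : s (theta g' g' ga) u = s g u + s (theta g D ga) u + s (theta D g' ga) u.
    rewrite {1}g'E (theta_ipDl cpl gb Db g'b) {1}g'E (theta_ipDr cpl gb gb Db).
    by rewrite (nrm_sub_eq0 Sga).
  rewrite {1}g'E ipDl; move: (s g u) (s D u) => x y; ring.
have := nrm_triangle s w ga' ga; rewrite (nrm_distrC s w) -/d.
move: key; rewrite mulrC -ler_pdivlMr// => key.
rewrite mulrDl [_ / A * d]mulrAC.
have -> : (1 + b * c + b * c + b * b * (c * c)) * d =
  d + b * c * d + b * (c * d) + b * (b * (c * c * d)) by ring.
by move: (_ / A) key gaw => y; lra.
Qed.

End dual_window.

(** * Riesz representation *)

Section riesz.
Context {R : realType} {E : lmodType R[i]} (s : semi_inner E) (cpl : hilbert s).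

(* Maximise [2 l phi - |phi|^2] over the real subspace [T]: by the
   parallelogram law maximising sequences are Cauchy. *)
Lemma riesz (T : E -> Prop) (l : E -> R) (C : R) :
  T 0 -> (forall p q (r : R), T p -> T q -> T (p + r%:C%C *: q)) ->
  (forall p q (r : R), T p -> T q -> l (p + r%:C%C *: q) = l p + r * l q) ->
  0 <= C -> (forall p, T p -> `|l p| <= C * nrm s p) ->
  exists2 v, (forall p, T p -> Re (s v p) = l p) & nrm s v <= C.
Proof.
move=> T0 TD lD C0 lC.
pose Q p := 2 * l p - nrm s p ^+ 2.
have Qup p : T p -> Q p <= C ^+ 2.
  move=> Tp; rewrite /Q; have := lC p Tp; rewrite ler_norml => /andP[_].
  have := sqr_ge0 (C - nrm s p); rewrite sqrrB; lra.
pose S : set R := [set Q p | p in T]%classic.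
have supS : has_sup S.
  by split; [exists (Q 0), 0|exists (C ^+ 2) => _ [p Tp <-]; exact: Qup].
have near_sup (n : nat) : exists p, T p /\ sup S - n.+1%:R^-1 < Q p.
  have [|_ [p Tp <-] ?] := @sup_adherent _ S n.+1%:R^-1 _ supS; first by rewrite invr_gt0.
  by exists p.
have [p pP] := choice near_sup.
have Tp n : T (p n) := (pP n).1.
have Qsup q : T q -> Q q <= sup S by move=> Tq; apply: ub_le_sup; [exact: supS.2|exists q].
have expand q r (t : R) : T q -> T r ->
    Q (q + t%:C%C *: r) = Q q + 2 * t * (l r - Re (s q r)) - t ^+ 2 * nrm s r ^+ 2.
  move=> Tq Tr; rewrite /Q lD// !nrm_sqr ipDl !ipDr !ipZl !ipZr conjc_real (ipC s q r).
  rewrite !(cReD, cReM)/=; case: (s q r) (s r r) => [x y] [x' y'] /=; ring.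
have small (e : R) : 0 < e -> exists N, forall n, (N <= n)%N -> n.+1%:R^-1 < e.
  move=> e0; exists (Num.truncn e^-1) => n Nn.
  rewrite -[e]invrK ltf_pV2 ?posrE ?invr_gt0//.
  by apply: lt_le_trans (truncnS_gt _) _; rewrite ler_nat.
have arith (u w k l1 l2 x x1 x2 : R) : k - w < 2 * l2 - x2 -> k - u < 2 * l1 - x1 ->
    2 * l1 - x1 + 2 * 2^-1 * (l2 - l1 - (x - x1)) - 2^-1 ^+ 2 * (x2 - x - (x - x1)) <= k ->
    x1 - x - (x - x2) <= 2 * (u + w).
  have -> : 2^-1 ^+ 2 = 4^-1 :> R by field.
  rewrite divff ?pnatr_eq0// mul1r; lra.
(* Compare with the midpoint p m + (p n - p m)/2, where Q is at most the supremum. *)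
have close m n : nrm s (p m - p n) ^+ 2 <= 2 * (m.+1%:R^-1 + n.+1%:R^-1).
  have T1 : T (p n + (-1)%:C%C *: p m) by exact: TD.
  have := Qsup _ (TD _ _ 2^-1 (Tp m) T1).
  rewrite expand// (_ : p n + _ = p n - p m); last by rewrite rmorphN1 scaleN1r.
  have lB : l (p n - p m) = l (p n) - l (p m).
    by have := lD _ _ (-1) (Tp n) (Tp m); rewrite rmorphN1 scaleN1r mulN1r.
  have := (pP m).2; have := (pP n).2; rewrite /Q lB !nrm_sqr !(ipBl, ipBr) (ipC s (p m) (p n)).
  case: (s (p m) (p n)) (s (p m) (p m)) (s (p n) (p n)) => [x y] [x1 y1] [x2 y2] /=.
  exact: arith.
have [e e0|v vP] := cpl (x := p).
  have [N HN] := small (e ^+ 2 / 4) (divr_gt0 (exprn_gt0 2 e0) (ltr0Sn _ 3)).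
  exists N => m n /HN Nm /HN Nn.
  rewrite -(@ltr_pXn2r _ 2)// ?nnegrE ?nrm_ge0 ?ltW// (le_lt_trans (close m n))//.
  have arith2 (a b x : R) : a < x / 4 -> b < x / 4 -> 2 * (a + b) < x by lra.
  exact: arith2.
have vl q : T q -> Re (s v q) = l q.
  move=> Tq; set x := l q; set k := nrm s q.
  have k0 : 0 <= k := nrm_ge0 s q.
  (* First variation: Q at [p n + t q] does not exceed the supremum; let n grow. Validity for all
     real t then forces x = Re <v, q>. *)
  have main (t : R) : 2 * t * (x - Re (s v q)) <= t ^+ 2 * k ^+ 2.
    apply/ler_addgt0Pl => e e0.
    pose M := 2 * `|t| * k + 1.
    have M0 : 0 < M by rewrite ltr_wpDl// !mulr_ge0.
    have [N1 H1] := small (e / 2) (divr_gt0 e0 (ltr0Sn _ 1)).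
    have [N2 H2] := vP (e / 2 / M) (divr_gt0 (divr_gt0 e0 (ltr0Sn _ 1)) M0).
    pose n := maxn N1 N2.
    have n1 := H1 n (leq_maxl _ _); have n2 := H2 n (leq_maxr _ _).
    have := Qsup _ (TD _ _ t (Tp n) Tq); rewrite expand// -/x -/k.
    have := (pP n).2.
    have : `|Re (s v q) - Re (s (p n) q)| <= nrm s (v - p n) * k.
      rewrite -cReN -cReD -ipNl -ipDl.
      by rewrite (le_trans (Re_le_normc _))// cauchy_schwarz.
    have : 2 * `|t| * (nrm s (v - p n) * k) <= e / 2.
      move: n2; rewrite ltr_pdivlMr// /M.
      have := nrm_ge0 s (v - p n); have := normr_ge0 t; nra.
    set y := Re (s v q); set y' := Re (s (p n) q) => b1 b2.
    have : 2 * t * (y' - y) <= 2 * `|t| * (nrm s (v - p n) * k).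
      rewrite (le_trans (ler_norm _))// !normrM ger0_norm// ler_wpM2l ?mulr_ge0//.
      by rewrite distrC.
    move: n1; move: (_^-1) (sup S) (Q _) => u1 u2 u3; lra.
  have [ke|kn] := eqVneq (k ^+ 2) 0.
    have := main (x - Re (s v q)); rewrite ke mulr0 => h.
    have : (x - Re (s v q)) ^+ 2 <= 0 by rewrite expr2; lra.
    move=> h2; apply/eqP; rewrite eq_sym -subr_eq0 -sqrf_eq0 eq_le h2 sqr_ge0//.
  have kp : 0 < k ^+ 2 by rewrite lt_neqAle eq_sym kn sqr_ge0.
  have := main ((x - Re (s v q)) / k ^+ 2); set z := x - _.
  rewrite (_ : 2 * _ * z = 2 * (z ^+ 2 / k ^+ 2)); last by ring.
  rewrite (_ : (z / _) ^+ 2 * _ = z ^+ 2 / k ^+ 2); last by field; rewrite sqrf_eq0 in kn.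
  move=> h; have : z ^+ 2 / k ^+ 2 <= 0 by lra.
  rewrite pmulr_lle0 ?invr_gt0// => h2.
  by apply/eqP; rewrite eq_sym -subr_eq0 -sqrf_eq0 eq_le h2 sqr_ge0.
exists v => //.
have [ve|vn] := eqVneq (nrm s v) 0; first by rewrite ve.
have vp : 0 < nrm s v by rewrite lt_neqAle eq_sym vn nrm_ge0.
(* [v] is only a limit of elements of [T], so the bound on l is used at a nearby [p N]: |v|^2 is
   within |v| |v - p N| of l (p N) <= C |p N|. *)
rewrite -(ler_pM2r vp) -expr2; apply/ler_addgt0Pl => e e0.
have M0 : 0 < nrm s v + C + 1 by rewrite ltr_wpDl// addr_ge0 ?nrm_ge0.
have [N /(_ N (leqnn _)) HN] := vP _ (divr_gt0 e0 M0).
have : nrm s v ^+ 2 <= l (p N) + nrm s v * nrm s (v - p N).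
  rewrite nrm_sqr -(vl _ (Tp N)) -lerBlDl -cReN -cReD -ipNr -ipDr.
  by rewrite (le_trans (ler_norm _))// (le_trans (Re_le_normc _))// cauchy_schwarz.
have := lC _ (Tp N); rewrite ler_norml => /andP[_].
have := nrm_triangle s v (p N) 0; rewrite !subr0 (nrm_distrC s (p N)).
move: HN; rewrite ltr_pdivlMr//; have := nrm_ge0 s (v - p N); nra.
Qed.

End riesz.

Local Open Scope classical_set_scope.
Local Open Scope ring_scope.

(** * The space L^2 *)

Section square_integrable.
Context d (T : measurableType d) (R : realType) (mu : {measure set T -> \bar R}).
Implicit Types f g : T -> R.

Definition sqint f := measurable_fun setT f /\
  mu.-integrable setT (EFin \o (fun x => f x ^+ 2)).

Lemma sqint_mul f g : sqint f -> sqint g ->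
  mu.-integrable setT (EFin \o (fun x => f x * g x)).
Proof.
move=> [mf if2] [mg ig2].
apply: (le_integrable _ _ _ (integrableD _ if2 ig2)) => //.
  by apply/measurable_EFinP; exact: measurable_funM.
move=> x _ /=; rewrite lee_fin [leRHS]ger0_norm ?addr_ge0 ?sqr_ge0//.
by rewrite ler_norml; have := sqr_ge0 (f x + g x); have := sqr_ge0 (f x - g x); nra.
Qed.

Lemma le_sqint f g : measurable_fun setT f -> (forall x, `|f x| <= `|g x|) ->
  sqint g -> sqint f.
Proof.
move=> mf fg [mg ig]; split=> //.
apply: (le_integrable _ _ _ ig) => //.
  by apply/measurable_EFinP; exact: measurable_funX.
by move=> x _ /=; rewrite lee_fin !normrX lerXn2r ?nnegrE.
Qed.

Lemma sqintZ (k : R) f : sqint f -> sqint (fun x => k * f x).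
Proof.
move=> [mf if2]; split; first exact: measurable_funM.
have := integrableZl measurableT (k ^+ 2) if2.
apply: eq_integrable => // x _ /=; by rewrite -EFinM exprMn.
Qed.

Lemma sqintD f g : sqint f -> sqint g -> sqint (fun x => f x + g x).
Proof.
move=> hf hg; have [[mf if2] [mg ig2]] := (hf, hg); split; first exact: measurable_funD.
have := integrableD measurableT (integrableD measurableT if2 ig2)
  (integrableZl measurableT 2 (sqint_mul hf hg)).
apply: eq_integrable => // x _ /=; rewrite -EFinM -!EFinD; congr EFin; ring.
Qed.

Lemma sqintN f : sqint f -> sqint (fun x => - f x).
Proof. by move=> /(sqintZ (-1)); under eq_fun do rewrite mulN1r. Qed.

Lemma sqintB f g : sqint f -> sqint g -> sqint (fun x => f x - g x).
Proof. by move=> hf hg; apply: sqintD => //; exact: sqintN. Qed.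

Lemma sqint0 : sqint (fun=> 0).
Proof.
split; first exact: measurable_cst.
by have := integrable0 mu setT; apply: eq_integrable => // x _ /=; rewrite expr0n.
Qed.

(** A bound on $L^2$ norms survives pointwise limits, by Fatou. The null set and the index [n0]
    serve the completeness proof, where convergence holds almost everywhere and the bounds hold for
    late indices. *)
Lemma le_fatou_sqr (N : set T) (h : nat -> T -> R) f (c : R) (n0 : nat) :
  measurable N -> mu N = 0%E ->
  (forall n, measurable_fun setT (h n)) -> measurable_fun setT f ->
  (forall x, ~ N x -> h n x @[n --> \oo] --> f x) ->
  (forall n, (n0 <= n)%N -> (\int[mu]_x (h n x ^+ 2)%:E <= c%:E)%E) ->
  (\int[mu]_x (f x ^+ 2)%:E <= c%:E)%E.
Proof.
move=> mN N0 mh mf hf hc.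
have mD : measurable (setT `\` N) by exact: measurableD.
have msq (k : T -> R) D : measurable_fun setT k -> measurable_fun D (fun x => (k x ^+ 2)%:E).
  by move=> mk; apply/measurable_EFinP/measurable_funX; exact: measurable_funTS.
have sq0 (k : T -> R) x : (0 <= (k x ^+ 2)%:E)%E by rewrite lee_fin sqr_ge0.
rewrite (@ge0_negligible_integral _ _ _ mu setT N)//; last exact: msq.
have -> : (\int[mu]_(x in setT `\` N) (f x ^+ 2)%:E =
    \int[mu]_(x in setT `\` N) limn_einf (fun n => (h n x ^+ 2)%:E))%E.
  apply: eq_integral => x; rewrite inE => -[_ Nx]; apply/esym.
  apply: (cvg_limn_einf_sup _).1; apply: cvg_EFin; first by apply: nearW.
  by under eq_fun do rewrite expr2; rewrite expr2; apply: cvgM; exact: hf.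
apply: (le_trans (fatou _ mD _ _)) => [n|n x _|]; [exact: msq|exact: sq0|].
rewrite limn_einf_lim; apply: lime_le; first exact: is_cvg_einfs.
exists n0 => // n /= n0n.
apply: (@le_trans _ _ (\int[mu]_(x in setT `\` N) (h n x ^+ 2)%:E)%E).
  by apply: ereal_inf_lbound; exists n => //=.
rewrite (le_trans _ (hc n n0n))// ge0_subset_integral//.
exact: msq.
Qed.

Lemma sqint_le f (c : R) : measurable_fun setT f ->
  (\int[mu]_x (f x ^+ 2)%:E <= c%:E)%E -> sqint f /\ \int[mu]_x (f x ^+ 2) <= c.
Proof.
move=> mf fc.
have ifin : mu.-integrable setT (EFin \o (fun x => f x ^+ 2)).
  apply/integrableP; split; first by apply/measurable_EFinP; exact: measurable_funX.
  rewrite (le_lt_trans _ (ltry c))// (le_trans _ fc)//.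
  by under eq_integral do rewrite /= ger0_norm ?sqr_ge0//.
split=> //; rewrite -lee_fin fineK//; exact: integrable_fin_num.
Qed.

Lemma sqint_fin f : sqint f ->
  (\int[mu]_x (f x ^+ 2)%:E = (\int[mu]_x (f x ^+ 2))%:E)%E.
Proof. by move=> [_ ?]; rewrite fineK//; exact: integrable_fin_num. Qed.

(* Riesz-Fischer *)
Lemma sqint_complete (f : nat -> T -> R) : (forall n, sqint (f n)) ->
  (forall e : R, 0 < e -> exists N, forall m n, (N <= m)%N -> (N <= n)%N ->
    \int[mu]_x ((f m x - f n x) ^+ 2) < e) ->
  exists2 g, sqint g & forall e : R, 0 < e -> exists N, forall n, (N <= n)%N ->
    \int[mu]_x ((g x - f n x) ^+ 2) <= e.
Proof.
move=> sf cauchy.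
(* The rate 8^-k leaves room for the weight 4^k in [t]: the integrals of [t k] are at most 2^-k,
   hence summable, and where the sum of the [t k x] is finite, |g k x - g (k+1) x| <= c 2^-k. *)
have /choice[N0 N0P] : forall k : nat, exists N, forall m n, (N <= m)%N -> (N <= n)%N ->
    \int[mu]_x ((f m x - f n x) ^+ 2) < 8^-1 ^+ k.
  by move=> k; apply: cauchy; rewrite exprn_gt0.
(* Partial sums give nondecreasing indices that still dominate [N0]. *)
pose N k := (\sum_(j < k.+1) N0 j)%N.
have N0N k : (N0 k <= N k)%N by rewrite /N big_ord_recr/= leq_addl.
have NS k : (N k <= N k.+1)%N by rewrite /N [X in (_ <= X)%N]big_ord_recr/= leq_addr.
have Nmon k l : (k <= l)%N -> (N k <= N l)%N by exact: (homo_leq leqnn leq_trans NS).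
pose g k := f (N k).
have gg k l : (k <= l)%N -> \int[mu]_x ((g k x - g l x) ^+ 2) < 8^-1 ^+ k.
  by move=> kl; apply: N0P; [exact: N0N|exact: leq_trans (N0N k) (Nmon _ _ kl)].
have gf k n : (N k <= n)%N -> \int[mu]_x ((g k x - f n x) ^+ 2) < 8^-1 ^+ k.
  by move=> kn; apply: N0P; [exact: N0N|exact: leq_trans (N0N k) kn].
have sg k : sqint (g k) by exact: sf.
have mg k : measurable_fun setT (g k) := (sg k).1.
pose t k x := (4 ^+ k * (g k x - g k.+1 x) ^+ 2)%:E.
have t0 k x : (0 <= t k x)%E by rewrite lee_fin mulr_ge0// sqr_ge0.
have mt k : measurable_fun setT (t k).
  apply/measurable_EFinP; apply: measurable_funM; first exact: measurable_cst.
  by apply: measurable_funX; exact: measurable_funB.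
pose G x := (\sum_(k <oo) t k x)%E.
have mG : measurable_fun setT G.
  by apply: (@ge0_emeasurable_sum _ _ _ setT t xpredT) => //.
have G0 x : (0 <= G x)%E by apply: nneseries_ge0 => k _ _; exact: t0.
have intG : mu.-integrable setT G.
  apply/integrableP; split=> //.
  under eq_integral do rewrite gee0_abs//.
  rewrite integral_nneseries//.
  have le k : (\int[mu]_x t k x <= (2^-1 ^+ k)%:E)%E.
    rewrite /t; under eq_integral do rewrite EFinM.
    have sgk := sqintB (sg k) (sg k.+1).
    rewrite ge0_integralZl//; last 2 first.
    - by apply/measurable_EFinP/measurable_funX; exact: measurable_funB.
    - by move=> x _; rewrite lee_fin sqr_ge0.
    rewrite sqint_fin// -EFinM lee_fin (_ : 2^-1 ^+ k = 4 ^+ k * 8^-1 ^+ k).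
      by rewrite ler_wpM2l// ltW// gg.
    by rewrite -exprMn; congr (_ ^+ k); field.
  apply: (@le_lt_trans _ _ 2%:E); last exact: ltry.
  have t1 k : (0 <= \int[mu]_x t k x)%E by exact: integral_ge0.
  apply: lime_le; first by apply: is_cvg_nneseries => k _ _.
  apply: nearW => n; apply: (@le_trans _ _ (2 - 2 * 2^-1 ^+ n)%:E); last first.
    by rewrite lee_fin; have : 0 <= 2^-1 ^+ n :> R by []; lra.
  elim: n => [|n IH]; first by rewrite big_geq// lee_fin expr0 mulr1 subrr.
  rewrite big_nat_recr//= (le_trans (leeD IH (le n)))// -EFinD lee_fin exprS.
  by rewrite mulrA divff// mul1r; lra.
have [Nul [mNul Nul0 NulP]] := integrable_ae measurableT intG.
have cvg_g x : ~ Nul x -> cvgn (fun k => g k x).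
  move=> Nx; have Gfin : G x \is a fin_num.
    by apply: contrapT => GNfin; apply: Nx; apply: NulP => /(_ I).
  have tG k : 4 ^+ k * (g k x - g k.+1 x) ^+ 2 <= fine (G x).
    rewrite -lee_fin fineK//.
    apply: le_trans (nneseries_lim_ge k.+1 (fun k _ _ => t0 k x)).
    rewrite big_nat_recr//= leeDr//; exact: sume_ge0.
  pose c := Num.sqrt (fine (G x)).
  have c0 : 0 <= c by exact: sqrtr_ge0.
  have fG0 : 0 <= fine (G x) by rewrite fine_ge0.
  have dk k : `|telescope (g^~ x) k| <= c * 2^-1 ^+ k.
    rewrite -(@ler_pXn2r _ 2)// ?nnegrE ?mulr_ge0 ?exprn_ge0//.
    rewrite exprMn sqr_sqrtr// -normrX ger0_norm ?sqr_ge0// -exprM mulnC exprM.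
    rewrite (_ : 2^-1 ^+ 2 = 4^-1); last by field.
    rewrite exprVn ler_pdivlMr ?exprn_gt0// mulrC (le_trans _ (tG k))//.
    by rewrite /telescope -sqrrN opprB.
  have : cvgn (series (telescope (g^~ x))).
    apply: normed_cvg; apply: (@series_le_cvg R _ (geometric c 2^-1)) => [k|k|k|].
    - exact: normr_ge0.
    - by rewrite /geometric /= mulr_ge0.
    - exact: dk.
    - by apply: is_cvg_geometric_series; rewrite ger0_norm// invf_lt1// ltr1n.
  rewrite telescopeK => cv.
  rewrite (_ : (fun k => g k x) = (fun k => (g k x - g 0%N x) + g 0%N x)); last first.
    by apply/funext => k; rewrite subrK.
  by apply: is_cvgD => //; exact: is_cvg_cst.
(* Setting the functions to 0 on the null set makes them converge at every point, so their limit is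
   measurable. *)
pose h k x := g k x * \1_(~` Nul) x.
have mh k : measurable_fun setT (h k).
  by apply: measurable_funM => //; apply: measurable_indic; exact: measurableC.
have cvg_h x : cvgn (fun k => h k x).
  have [Nx|Nx] := pselect (Nul x).
    rewrite /h indicE memNset/=; last by move=> /(_ Nx).
    by under eq_fun do rewrite mulr0; exact: is_cvg_cst.
  rewrite /h indicE mem_set//=; under eq_fun do rewrite mulr1.
  exact: cvg_g.
pose F x := limn (fun k => h k x).
have mF : measurable_fun setT F.
  by apply: measurable_fun_cvg mh _ => x _; exact: cvg_h.
have bound n k : (N k <= n)%N -> (\int[mu]_x ((F x - f n x) ^+ 2)%:E <= (8^-1 ^+ k)%:E)%E.
  move=> kn.
  apply: (@le_fatou_sqr Nul (fun l x => g l x - f n x) _ _ k) => //.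
  - by move=> l; apply: measurable_funB => //; exact: (sf n).1.
  - by apply: measurable_funB => //; exact: (sf n).1.
  - move=> x Nx; apply: cvgB; last exact: cvg_cst.
    rewrite (_ : F x = limn (fun k => g k x)); first exact: cvg_g.
    rewrite /F (_ : (fun k => h k x) = (fun k => g k x))//.
    by apply/funext => j; rewrite /h indicE mem_set// mulr1.
  - move=> l kl; rewrite sqint_fin; last exact: sqintB.
    by rewrite lee_fin ltW// N0P// ?(leq_trans (N0N k))// ?(leq_trans (Nmon _ _ kl)).
have mFf n : measurable_fun setT (fun x => F x - f n x).
  by apply: measurable_funB => //; exact: (sf n).1.
exists F.
  have [sFf _] := sqint_le (mFf (N 0%N)) (bound _ _ (leqnn _)).
  by have := sqintD sFf (sf (N 0%N)); under eq_fun do rewrite subrK.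
move=> e e0; have [k ke] : exists k, 8^-1 ^+ k <= e.
  have := truncnS_gt e^-1; move: (Num.truncn e^-1) => k ek; exists k.
  rewrite exprVn -[e]invrK lef_pV2 ?posrE ?invr_gt0 ?exprn_gt0//.
  apply: (le_trans (ltW ek)); rewrite -natrX ler_nat; exact: ltn_expl.
exists (N k) => n kn; have [_ /le_trans] := sqint_le (mFf n) (bound _ _ kn).
by apply.
Qed.

End square_integrable.

Section L2_space.
Context {R : realType} {d : nat}.
Local Notation Rd := 'rV[R]_d.
Local Notation C := R[i].
Local Notation mu := (lebesgue_rV d : {sigma_finite_measure set Rd -> \bar R}).
Local Notation sq := (sqint mu).
Implicit Types f g h : Rd -> C.

Lemma L2E f : L2 f <-> sq (fun x => Re (f x)) /\ sq (fun x => Im (f x)).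
Proof.
have mn (mr : measurable_fun setT (fun x => Re (f x))) (mi : measurable_fun setT (fun x => Im (f x))) :
    measurable_fun setT (fun x => ((normc (f x)) ^+ 2)%:E).
  apply/measurable_EFinP; under eq_fun do rewrite normc_sqr.
  by apply: measurable_funD; exact: measurable_funX.
have Nint : (\int[mu]_x (`|(EFin \o (fun x => normc (f x))) x| `^ 2) =
    \int[mu]_x ((normc (f x)) ^+ 2)%:E)%E.
  by apply: eq_integral => x _ /=; rewrite ger0_norm ?normc_ge0// powR_mulrn// normc_ge0.
split.
  move=> [mr mi fin].
  have int : mu.-integrable setT (fun x => ((normc (f x)) ^+ 2)%:E).
    apply/integrableP; split; first exact: mn.
    under eq_integral do rewrite gee0_abs ?lee_fin ?sqr_ge0//.
    rewrite -Nint -powR_Lnorm//; exact: poweR_lty.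
  split; split=> //; apply: (le_integrable _ _ _ int) => //.
  - by apply/measurable_EFinP; exact: measurable_funX.
  - move=> x _ /=; rewrite lee_fin normc_sqr !ger0_norm ?sqr_ge0 ?addr_ge0 ?sqr_ge0//.
    by rewrite lerDl sqr_ge0.
  - by apply/measurable_EFinP; exact: measurable_funX.
  - move=> x _ /=; rewrite lee_fin normc_sqr !ger0_norm ?sqr_ge0 ?addr_ge0 ?sqr_ge0//.
    by rewrite lerDr sqr_ge0.
move=> [[mr ir] [mi ii]]; split=> //.
rewrite /finite_norm; apply: (@lty_poweRy _ _ 2) => //.
rewrite powR_Lnorm// Nint.
have /integrableP[_] := integrableD measurableT ir ii.
apply: le_lt_trans; rewrite le_eqVlt; apply/orP; left; apply/eqP.
apply: eq_integral => x _ /=; rewrite normc_sqr ger0_norm// addr_ge0 ?sqr_ge0//.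
Qed.

Lemma L2norm_sqr f : L2 f ->
  L2norm f ^+ 2 = \int[mu]_x (Re (f x) ^+ 2) + \int[mu]_x (Im (f x) ^+ 2).
Proof.
move=> Lf; have [mr mi fin] := Lf; have [[_ ir] [_ ii]] := (L2E f).1 Lf.
have N0 : (0 <= Lnorm mu 2%:E (fun x => (normc (f x))%:E))%E by exact: Lnorm_ge0.
have Nfin : Lnorm mu 2%:E (fun x => (normc (f x))%:E) \is a fin_num.
  by rewrite ge0_fin_numE.
rewrite -RintegralD// /L2norm -[LHS]/(fine (_ ^+ 2)%:E) -powR_mulrn ?fine_ge0//.
rewrite -poweR_EFin fineK// powR_Lnorm//; congr fine.
apply: eq_integral => x _ /=; rewrite ger0_norm ?normc_ge0// powR_mulrn ?normc_ge0//.
by rewrite normc_sqr.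
Qed.

Definition L2pred : {pred Rd -> C} := [pred f | `[< L2 f >]].

Lemma L2predP f : reflect (L2 f) (f \in L2pred).
Proof. exact: asboolP. Qed.

Lemma L2_submod_closed : submod_closed L2pred.
Proof.
split.
  apply/L2predP/L2E; split; exact: sqint0.
move=> z f g /L2predP/L2E[fr fi] /L2predP/L2E[gr gi]; apply/L2predP/L2E; split.
  rewrite (_ : (fun x => _) = (fun x => (Re z * Re (f x) - Im z * Im (f x)) + Re (g x))).
    by apply: sqintD => //; apply: sqintB; exact: sqintZ.
  by apply/funext => x; rewrite /= cReD cReM.
rewrite (_ : (fun x => _) = (fun x => (Re z * Im (f x) + Im z * Re (f x)) + Im (g x))).
  by apply: sqintD => //; apply: sqintD; exact: sqintZ.
by apply/funext => x; rewrite /= cImD cImM.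
Qed.

HB.instance Definition _ := GRing.isSubmodClosed.Build C (Rd -> C) L2pred L2_submod_closed.

Definition L2space := {f : Rd -> C | f \in L2pred}.
HB.instance Definition _ := SubChoice.on L2space.
HB.instance Definition _ := [SubChoice_isSubLmodule of L2space by <:].

End L2_space.

Section L2_inner.
Context {R : realType} {d : nat}.
Local Notation Rd := 'rV[R]_d.
Local Notation C := R[i].
Local Notation mu := (lebesgue_rV d : {sigma_finite_measure set Rd -> \bar R}).
Local Notation E := (@L2space R d).
Implicit Types f g h : E.

Definition L2mk (p : Rd -> C) (Lp : L2 p) : E :=
  exist (fun p => is_true (p \in L2pred)) p (introT (L2predP p) Lp).

Definition rint (p q : Rd -> R) : R := \int[mu]_x (p x * q x).

Lemma rintD p p' q : sqint mu p -> sqint mu p' -> sqint mu q ->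
  rint (fun x => p x + p' x) q = rint p q + rint p' q.
Proof.
move=> sp sp' sq; rewrite /rint -RintegralD//; [|exact: sqint_mul..].
by apply: eq_Rintegral => x _; rewrite mulrDl.
Qed.

Lemma rintZ k p q : sqint mu p -> sqint mu q ->
  rint (fun x => k * p x) q = k * rint p q.
Proof.
move=> sp sq; rewrite /rint -RintegralZl//; last exact: sqint_mul.
by apply: eq_Rintegral => x _; rewrite mulrA.
Qed.

Lemma rintC p q : rint p q = rint q p.
Proof. by apply: eq_Rintegral => x _; rewrite mulrC. Qed.

Lemma L2_Re f : sqint mu (fun x => Re (val f x)).
Proof. by have /L2predP/L2E[] := valP f. Qed.

Lemma L2_Im f : sqint mu (fun x => Im (val f x)).
Proof. by have /L2predP/L2E[] := valP f. Qed.

Local Notation re f := (fun x => Re (val f x)).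
Local Notation im f := (fun x => Im (val f x)).

Lemma Re_inner f g : Re (inner (val f) (val g)) = rint (re f) (re g) + rint (im f) (im g).
Proof.
have [fr fi gr gi] := And4 (L2_Re f) (L2_Im f) (L2_Re g) (L2_Im g).
rewrite /inner /cintegral /= /rint -RintegralD//; [|exact: sqint_mul..].
by apply: eq_Rintegral => x _; rewrite cReM; case: (val g x) => a b /=; ring.
Qed.

Lemma Im_inner f g : Im (inner (val f) (val g)) = rint (im f) (re g) - rint (re f) (im g).
Proof.
have [fr fi gr gi] := And4 (L2_Re f) (L2_Im f) (L2_Re g) (L2_Im g).
rewrite /inner /cintegral /= /rint -RintegralB//; [|exact: sqint_mul..].
by apply: eq_Rintegral => x _; rewrite cImM; case: (val g x) => a b /=; ring.
Qed.

Lemma reD f g : re (f + g) = (fun x => Re (val f x) + Re (val g x)).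
Proof. by apply/funext => x; rewrite -cReD. Qed.

Lemma imD f g : im (f + g) = (fun x => Im (val f x) + Im (val g x)).
Proof. by apply/funext => x; rewrite -cImD. Qed.

Lemma reZ (z : C) f : re (z *: f) = (fun x => Re z * Re (val f x) + (- Im z) * Im (val f x)).
Proof. by apply/funext => x; rewrite mulNr -cReM. Qed.

Lemma imZ (z : C) f : im (z *: f) = (fun x => Re z * Im (val f x) + Im z * Re (val f x)).
Proof. by apply/funext => x; rewrite -cImM. Qed.

Let ipD f g h : inner (val (f + g)) (val h) = inner (val f) (val h) + inner (val g) (val h).
Proof.
have [fr fi gr gi] := And4 (L2_Re f) (L2_Im f) (L2_Re g) (L2_Im g).
have [hr hi] := (L2_Re h, L2_Im h).
apply: complex_eq.
  rewrite cReD !Re_inner reD imD !rintD//; ring.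
rewrite cImD !Im_inner reD imD !rintD//; ring.
Qed.

Let ipZ (z : C) f h : inner (val (z *: f)) (val h) = z * inner (val f) (val h).
Proof.
have [fr fi hr hi] := And4 (L2_Re f) (L2_Im f) (L2_Re h) (L2_Im h).
apply: complex_eq.
  rewrite cReM !Re_inner !Im_inner reZ imZ !rintD ?rintZ//; try exact: sqintZ.
  ring.
rewrite cImM !Re_inner !Im_inner reZ imZ !rintD ?rintZ//; try exact: sqintZ.
ring.
Qed.

Let ipC f g : inner (val g) (val f) = (inner (val f) (val g))^*%C.
Proof.
have conjE (z : C) : Re z^*%C = Re z /\ Im z^*%C = - Im z by case: z.
apply: complex_eq; first by rewrite (conjE _).1 !Re_inner [in LHS]rintC [X in _ + X]rintC.
by rewrite (conjE _).2 !Im_inner opprB [in LHS]rintC [X in _ - X]rintC.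
Qed.

Let ip_ge0 f : 0 <= Re (inner (val f) (val f)).
Proof.
rewrite Re_inner addr_ge0// /rint; apply: Rintegral_ge0 => x _; rewrite -expr2; exact: sqr_ge0.
Qed.

Definition L2ip : semi_inner E := SemiInner ipD ipZ ipC ip_ge0.

Lemma L2nrm_sqr f : nrm L2ip f ^+ 2 =
  \int[mu]_x (Re (val f x) ^+ 2) + \int[mu]_x (Im (val f x) ^+ 2).
Proof. by rewrite nrm_sqr Re_inner. Qed.

Lemma L2nrm f : nrm L2ip f = L2norm (val f).
Proof.
apply/eqP; rewrite -(@eqrXn2 _ 2)// ?nrm_ge0// ?fine_ge0 ?Lnorm_ge0//.
rewrite L2nrm_sqr L2norm_sqr//; apply/L2predP; exact: valP.
Qed.

Lemma L2_hilbert : hilbert L2ip.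
Proof.
move=> u cu.
have ge0 (p : Rd -> R) : 0 <= \int[mu]_x (p x ^+ 2).
  by apply: Rintegral_ge0 => x _; exact: sqr_ge0.
have small (e : R) : 0 < e -> exists N, forall m n, (N <= m)%N -> (N <= n)%N ->
    nrm L2ip (u m - u n) ^+ 2 < e.
  move=> e0; have [N HN] := cu (Num.sqrt e) ltac:(by rewrite sqrtr_gt0).
  exists N => m n Nm Nn; rewrite -(sqr_sqrtr (ltW e0)) ltr_pXn2r// ?nnegrE ?nrm_ge0 ?sqrtr_ge0//.
  exact: HN.
have ReB f g x : Re (val (f - g) x) = Re (val f x) - Re (val g x) by rewrite -cReN -cReD.
have ImB f g x : Im (val (f - g) x) = Im (val f x) - Im (val g x) by rewrite -cImN -cImD.
have [||p sp Hp] := @sqint_complete _ _ _ mu (fun n => re (u n)).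
- by move=> n; exact: L2_Re.
- move=> e /small[N HN]; exists N => m n Nm Nn; apply: le_lt_trans (HN m n Nm Nn).
  rewrite L2nrm_sqr; under [X in _ <= X + _]eq_Rintegral do rewrite ReB.
  by rewrite lerDl.
have [||q sq Hq] := @sqint_complete _ _ _ mu (fun n => im (u n)).
- by move=> n; exact: L2_Im.
- move=> e /small[N HN]; exists N => m n Nm Nn; apply: le_lt_trans (HN m n Nm Nn).
  rewrite L2nrm_sqr; under [X in _ <= _ + X]eq_Rintegral do rewrite ImB.
  by rewrite lerDr.
have Lpq : L2 (fun x => (p x +i* q x)%C) by apply/L2E.
exists (L2mk Lpq) => e e0.
have e3 : 0 < e ^+ 2 / 3 by rewrite divr_gt0// exprn_gt0.
have [N1 H1] := Hp _ e3; have [N2 H2] := Hq _ e3.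
exists (maxn N1 N2) => n; rewrite geq_max => /andP[/H1 h1 /H2 h2].
rewrite -(@ltr_pXn2r _ 2)// ?nnegrE ?nrm_ge0 ?ltW// L2nrm_sqr.
under eq_Rintegral do rewrite ReB /=.
under [X in _ + X]eq_Rintegral do rewrite ImB /=.
have arith (a b c : R) : a <= c / 3 -> b <= c / 3 -> 0 < c / 3 -> a + b < c by lra.
exact: arith e3.
Qed.

End L2_inner.

(** * Time-frequency shifts *)

Section translation_invariance.
Context {R : realType}.

Lemma measurable_shift (a : R) :
  measurable_fun [set: measurableTypeR R] (fun x : measurableTypeR R => x + a : measurableTypeR R).
Proof. by apply: measurable_funD => //; exact: measurable_cst. Qed.

Lemma lebesgue_measure_shift (a : R) (A : set R) : measurable A ->
  lebesgue_measure ((fun x => x + a) @^-1` A) = lebesgue_measure A.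
Proof.
pose nu := measure_function_pushforward__canonical__measure_function_Measure
  (@lebesgue_measure R) (measurable_shift a).
move=> mA; apply/esym; apply: (lebesgue_measure_unique (mu := nu)) => // X [[u v] _ <-] /=.
rewrite /pushforward (_ : _ @^-1` _ = `]u - a, v - a]%classic); last first.
  by apply/seteqP; split => x /=; rewrite !in_itv/= ltrBlDr lerBrDr.
by rewrite !lebesgue_measure_itv/= !lte_fin ltrD2r -!EFinB opprB addrA subrK.
Qed.

Lemma measurable_shift_rV d (a : 'rV[R]_d) :
  measurable_fun [set: 'rV[R]_d] (fun x : 'rV[R]_d => x + a).
Proof.
apply: measurable_fun_rVP => i; under eq_fun do rewrite mxE.
by apply: measurable_funD; [exact: measurable_coord|exact: measurable_cst].
Qed.

(** Induction on the dimension: the pushforward of the product measure under the translation agrees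
    with it on rectangles, and product measures are determined by rectangles. *)
Lemma lebesgue_rV_shift d (a : 'rV[R]_d) (A : set 'rV[R]_d) : measurable A ->
  lebesgue_rV d ((fun x => x + a) @^-1` A) = lebesgue_rV d A.
Proof.
elim: d a A => [|d IH] a A mA.
  rewrite (_ : _ @^-1` A = A)//; apply/seteqP; split=> x /=;
    by rewrite (thinmx0 (x + a)) (thinmx0 x).
pose a' : 'rV[R]_d := \row_j a ord0 (lift ord0 j).
pose phi (p : measurableTypeR R * 'rV[R]_d) : measurableTypeR R * 'rV[R]_d := (p.1 + a ord0 ord0, p.2 + a').
have mphi : measurable_fun setT phi.
  apply: measurable_fun_pair.
    by apply: measurable_funD; [exact: measurable_fst|exact: measurable_cst].
  exact: (measurableT_comp (measurable_shift_rV a') measurable_snd).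
pose nu := measure_function_pushforward__canonical__measure_function_Measure
  (lebesgue_measure \x lebesgue_rV d)%E mphi.
have nuE X : measurable X -> (lebesgue_measure \x lebesgue_rV d)%E X = nu X.
  apply: product_measure_unique => B C mB mC; rewrite /nu /= /pushforward.
  rewrite (_ : phi @^-1` (B `*` C) =
    ((fun x => x + a ord0 ord0) @^-1` B) `*` ((fun x => x + a') @^-1` C))//.
  have mB' : measurable ((fun x : measurableTypeR R => x + a ord0 ord0 : measurableTypeR R) @^-1` B).
    by rewrite -[X in measurable X]setTI; exact: measurable_shift.
  have mC' : measurable ((fun x => x + a') @^-1` C).
    by rewrite -[X in measurable X]setTI; exact: measurable_shift_rV.
  have := product_measure1E lebesgue_measure (lebesgue_rV d) mB' mC'.
  by move=> /= ->; rewrite lebesgue_measure_shift// IH.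
rewrite /= /lebesgue_cons /pushforward [RHS]nuE; last first.
  by rewrite -[X in measurable X]setTI; exact: measurable_cons_rV.
rewrite /nu /= /pushforward; congr (_ _); apply/seteqP; split => -[x v] /=;
  rewrite (_ : cons_rV (phi (x, v)) = cons_rV (x, v) + a)//;
  apply/rowP => i; rewrite !mxE; case: (unliftP ord0 i) => [j|] -> /=;
  by rewrite ?mxE.
Qed.

End translation_invariance.

Section tf_shifts.
Context {R : realType} {d : nat}.
Local Notation Rd := 'rV[R]_d.
Local Notation C := R[i].
Local Notation mu := (lebesgue_rV d : {sigma_finite_measure set Rd -> \bar R}).
Local Notation E := (@L2space R d).
Local Notation s := (@L2ip R d).

Lemma ge0_integral_shift (a : Rd) (f : Rd -> \bar R) :
  measurable_fun setT f -> (forall x, 0 <= f x)%E ->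
  (\int[mu]_x f (x + a)%R = \int[mu]_x f x)%E.
Proof.
move=> mf f0.
pose nu := measure_function_pushforward__canonical__measure_function_Measure
  mu (measurable_shift_rV a).
transitivity (\int[nu]_x f x)%E.
  by rewrite (ge0_integral_pushforward (measurable_shift_rV a)) ?preimage_setT//.
by apply: eq_measure_integral => A mA _; exact: lebesgue_rV_shift.
Qed.

Lemma integral_shift (a : Rd) (f : Rd -> \bar R) :
  measurable_fun setT f -> (\int[mu]_x f (x + a)%R = \int[mu]_x f x)%E.
Proof.
move=> mf; rewrite integralE [RHS]integralE.
congr (_ - _)%E.
  rewrite -(ge0_integral_shift a (measurable_funepos mf))//.
  by rewrite -[fun x => f (x + a)%R]/(f \o (fun x => x + a)%R) funepos_comp.
rewrite -(ge0_integral_shift a (measurable_funeneg mf))//.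
by rewrite -[fun x => f (x + a)%R]/(f \o (fun x => x + a)%R) funeneg_comp.
Qed.

Lemma Rintegral_shift (a : Rd) (f : Rd -> R) :
  measurable_fun setT f -> \int[mu]_x f (x + a) = \int[mu]_x f x.
Proof.
by move=> mf; rewrite /Rintegral (integral_shift a (f := EFin \o f))//; exact/measurable_EFinP.
Qed.

Lemma sqint_shift (a : Rd) (f : Rd -> R) : sqint mu f -> sqint mu (fun x : Rd => f (x + a)).
Proof.
move=> [mf if2].
have mfa : measurable_fun setT (fun x : Rd => f (x + a)).
  exact: (measurableT_comp mf (measurable_shift_rV a)).
split=> //; apply/integrableP; split.
  by apply/measurable_EFinP; exact: measurable_funX.
have /integrableP[mf2] := if2; apply: le_lt_trans.
rewrite le_eqVlt; apply/orP; left; apply/eqP.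
by apply: (@integral_shift a (abse \o (EFin \o (fun x => f x ^+ 2)))); exact: measurableT_comp.
Qed.

Lemma normc_cis (t : R) : normc (cis t) = 1.
Proof. by rewrite /= cos2Dsin2 sqrtr1. Qed.

Lemma cisD (t u : R) : cis (t + u) = cis t * cis u.
Proof. by rewrite /cis cosD sinD; simpc; congr (_ +i* _)%C; ring. Qed.

Lemma cis0 : cis (0 : R) = 1.
Proof. by rewrite /cis cos0 sin0. Qed.

Lemma dotDl (x y z : Rd) : dot (x + y) z = dot x z + dot y z.
Proof. by rewrite /dot -big_split; apply: eq_bigr => i _; rewrite mxE mulrDl. Qed.

Lemma dotC (x y : Rd) : dot x y = dot y x.
Proof. by apply: eq_bigr => i _; rewrite mulrC. Qed.

Lemma dotNl (x y : Rd) : dot (- x) y = - dot x y.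
Proof. by rewrite /dot -sumrN; apply: eq_bigr => i _; rewrite mxE mulNr. Qed.

Lemma dotBr (x y z : Rd) : dot x (y - z) = dot x y - dot x z.
Proof. by rewrite dotC dotDl dotNl !(dotC x). Qed.

Lemma measurable_dot (b : Rd) : measurable_fun setT (dot b).
Proof.
apply: measurable_sum => i; apply: measurable_funM; first exact: measurable_cst.
exact: measurable_coord.
Qed.

(** The real and imaginary parts of a unimodular function times an $L^2$ function have this
    shape. *)
Lemma sqint_unimodular (p q c t : Rd -> R) : measurable_fun setT c -> measurable_fun setT t ->
  (forall x, c x ^+ 2 + t x ^+ 2 = 1) -> sqint mu p -> sqint mu q ->
  sqint mu (fun x => c x * p x + t x * q x).
Proof.
move=> mc mt ct1 sp sq.
have bdd (u v : R) : u ^+ 2 + v ^+ 2 = 1 -> `|u| <= 1.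
  move=> uv; rewrite -(@ler_pXn2r _ 2)// ?nnegrE// expr1n -normrX ger0_norm ?sqr_ge0//.
  by rewrite -uv lerDl sqr_ge0.
apply: sqintD.
- apply: (le_sqint _ _ sp) => [|x].
    by apply: measurable_funM => //; exact: sp.1.
  by rewrite normrM ler_piMl// (bdd _ (t x)).
- apply: (le_sqint _ _ sq) => [|x].
    by apply: measurable_funM => //; exact: sq.1.
  by rewrite normrM ler_piMl// (bdd _ (c x))// addrC.
Qed.

Lemma measurable_phase (b : Rd) : measurable_fun setT (fun x : Rd => 2 * pi * dot b x).
Proof. by apply: measurable_funM; [exact: measurable_cst|exact: measurable_dot]. Qed.

Lemma L2_modulation (b : Rd) (f : Rd -> C) : L2 f -> L2 (modulation b f).
Proof.
move=> /L2E[fr fi]; apply/L2E.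
have mc : measurable_fun setT (fun x : Rd => cos (2 * pi * dot b x)).
  have mcos : measurable_fun setT (@cos R) := continuous_measurable_fun (@continuous_cos R).
  exact: (measurableT_comp mcos (measurable_phase b)).
have ms : measurable_fun setT (fun x : Rd => sin (2 * pi * dot b x)).
  have msin : measurable_fun setT (@sin R) := continuous_measurable_fun (@continuous_sin R).
  exact: (measurableT_comp msin (measurable_phase b)).
split.
- rewrite (_ : (fun x => _) = (fun x => cos (2 * pi * dot b x) * Re (f x) +
      (- sin (2 * pi * dot b x)) * Im (f x))).
    apply: sqint_unimodular => //; first exact: measurable_funN.
    by move=> x; rewrite sqrrN cos2Dsin2.
  by apply/funext => x; rewrite /modulation cReM mulNr.
- rewrite (_ : (fun x => _) = (fun x => cos (2 * pi * dot b x) * Im (f x) +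
      sin (2 * pi * dot b x) * Re (f x))).
    by apply: sqint_unimodular => // x; rewrite cos2Dsin2.
  by apply/funext => x; rewrite /modulation cImM.
Qed.

Lemma L2_translation (a : Rd) (f : Rd -> C) : L2 f -> L2 (translation a f).
Proof. by move=> /L2E[fr fi]; apply/L2E; split; [exact: (sqint_shift (- a) fr)|exact: (sqint_shift (- a) fi)]. Qed.

Lemma L2_tf_shift l (f : Rd -> C) : L2 f -> L2 (tf_shift l f).
Proof. by move=> Lf; exact/L2_translation/L2_modulation. Qed.

Lemma val_L2 (f : E) : L2 (val f). Proof. by apply/L2predP; exact: valP. Qed.

Definition tf (l : 'rV[R]_(d + d)) (f : E) : E := L2mk (L2_tf_shift l (val_L2 f)).

Lemma tfE l f x : val (tf l f) x =
  cis (2 * pi * dot (rsubmx l) (x - lsubmx l)) * val f (x - lsubmx l).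
Proof. by []. Qed.

Lemma L2space_eq (f g : E) : (forall x, val f x = val g x) -> f = g.
Proof. by move=> fg; apply: val_inj; apply/funext. Qed.

Lemma tfD l f g : tf l (f + g) = tf l f + tf l g.
Proof. by apply: L2space_eq => x; rewrite tfE mulrDr. Qed.

Lemma tfZ l (z : C) f : tf l (z *: f) = z *: tf l f.
Proof. by apply: L2space_eq => x; rewrite tfE mulrCA. Qed.

Lemma tf0 f : tf 0 f = f.
Proof.
apply: L2space_eq => x; rewrite tfE.
have -> : lsubmx (0 : 'rV[R]_(d + d)) = 0 by apply/rowP => i; rewrite !mxE.
have -> : rsubmx (0 : 'rV[R]_(d + d)) = 0 by apply/rowP => i; rewrite !mxE.
by rewrite subr0 -(subrr 0) dotDl dotNl subrr mulr0 cis0 mul1r.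
Qed.

Lemma tf_ip l f g : s (tf l f) (tf l g) = s f g.
Proof.
rewrite /= /inner.
have E1 : (fun x => val (tf l f) x * (val (tf l g) x)^*%C) =
    (fun x => (fun y => val f y * (val g y)^*%C) (x - lsubmx l)).
  by apply/funext => x; rewrite !tfE rmorphM/= mulrACA unimodularV ?mul1r// normc_cis.
rewrite E1 /cintegral.
have [fr fi gr gi] := And4 (L2_Re f).1 (L2_Im f).1 (L2_Re g).1 (L2_Im g).1.
congr (_ +i* _)%C; apply: (@Rintegral_shift (- lsubmx l) (fun y => _ (val f y * (val g y)^*%C))).
- rewrite (_ : (fun y => _) = (fun y => Re (val f y) * Re (val g y) + Im (val f y) * Im (val g y))).
    by apply: measurable_funD; exact: measurable_funM.
  by apply/funext => y; rewrite cReM; case: (val g y) => u v /=; rewrite mulrN opprK.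
- rewrite (_ : (fun y => _) = (fun y => Im (val f y) * Re (val g y) - Re (val f y) * Im (val g y))).
    by apply: measurable_funB; exact: measurable_funM.
  by apply/funext => y; rewrite cImM; case: (val g y) => u v /=; rewrite mulrN addrC.
Qed.

Lemma tfM l m : exists2 w : C, normc w = 1 & forall f, tf l (tf m f) = w *: tf (l + m) f.
Proof.
(* The phase paid for moving the modulation of [l] past the translation of [m]. *)
exists (cis (2 * pi * dot (rsubmx l) (lsubmx m))); first exact: normc_cis.
move=> f; apply: L2space_eq => x.
have lD : lsubmx (l + m) = lsubmx l + lsubmx m by apply/rowP => i; rewrite !mxE.
have rD : rsubmx (l + m) = rsubmx l + rsubmx m by apply/rowP => i; rewrite !mxE.
rewrite !tfE -[RHS]/(_ * val (tf (l + m) f) x) tfE lD rD !mulrA -!cisD.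
rewrite (_ : x - lsubmx l - lsubmx m = x - (lsubmx l + lsubmx m)); last by rewrite opprD addrA.
congr (cis _ * _); rewrite dotDl !dotBr !(dotC _ (_ + _)) !dotDl !(dotC (lsubmx _)); ring.
Qed.

Lemma tf_surj l f : exists g, f = tf l g.
Proof.
have [w w1 wP] := tfM l (- l).
have w0 : w != 0 by apply: contra_eq_neq w1 => ->; rewrite normc0 eq_sym oner_eq0.
exists (w^-1 *: tf (- l) f).
by rewrite tfZ wP scalerA mulVf// scale1r subrr tf0.
Qed.

(** This makes arbitrary, in particular arbitrarily small, time-frequency shifts admissible as the
    isometry [U] of [dual_lipschitz]. *)
Lemma tf_comm l m : exists2 w : C, normc w = 1 & forall f, tf l (tf m f) = w *: tf m (tf l f).
Proof.
have [w w1 wP] := tfM l m; have [z z1 zP] := tfM m l.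
exists (w * z^*%C); first by rewrite normcM normc_conj w1 z1 mulr1.
by move=> f; rewrite wP zP scalerA -mulrA [_ * z]mulrC unimodularV// mulr1 addrC.
Qed.

(** * Gabor frame sequences over a lattice *)

Section lattice.
Context (L : set 'rV[R]_(d + d)) (hL : is_lattice L).
Implicit Types (f ga v : E).

Lemma lattice0 : L 0.
Proof. by case: hL => A _ ->; exists 0 => //=; rewrite map_mx0 mul0mx. Qed.

Lemma latticeD l m : L l -> L m -> L (l + m).
Proof.
by case: hL => A _ -> [y _ <-] [z _ <-]; exists (y + z) => //; rewrite map_mxD mulmxDl.
Qed.

Lemma latticeN l : L l -> L (- l).
Proof. by case: hL => A _ -> [y _ <-]; exists (- y) => //; rewrite map_mxN mulNmx. Qed.

Let elt (l : 'rV[R]_(d + d)) (Ll : L l) : L := exist _ l (mem_set Ll).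

Let mem (i : L) : L (val i). Proof. exact: set_valP. Qed.

(** Ends with [Defined], so that [orb gabor_rep g i] computes to the corresponding element of the
    Gabor system. *)
Definition gabor_rep : twisted_rep L s.
Proof.
refine (@TwistedRep R L E s (fun i => tf (val i))
  (fun i j => elt (latticeD (mem i) (mem j))) (fun i => elt (latticeN (mem i)))
  (elt lattice0) _ _ _ _ _ _ _ _ _) => /=.
- by move=> i u v; exact: tfD.
- by move=> i a u; exact: tfZ.
- by move=> i u v; exact: tf_ip.
- by move=> u; exact: tf0.
- by move=> j i; exact: tfM.
- by move=> j i; apply: val_inj => /=; rewrite addKr.
- by move=> j i; apply: val_inj => /=; rewrite addrA subrr add0r.
- by move=> j; apply: val_inj => /=; rewrite subrr.
- by move=> j; apply: val_inj => /=; rewrite opprK.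
Defined.

Lemma val_comb (g : E) (c : L -> C) (F : {fset L}) :
  lincomb c (gabor (val g) L) F = val (\sum_(i <- F) c i *: orb gabor_rep g i).
Proof.
apply/funext => x; rewrite /lincomb.
elim: (enum_fset F) => [|i r IH]; first by rewrite !big_nil.
by rewrite !big_cons IH.
Qed.

Lemma closed_spanP (g : E) f : closed_span (gabor (val g) L) (val f) <->
  inspan s (orb gabor_rep g) f.
Proof.
split.
  move=> [_ gf] e /gf[F [c Fc]]; exists (\sum_(i <- F) c i *: orb gabor_rep g i).
    by exists F, c.
  by rewrite L2nrm; move: Fc; rewrite val_comb.
move=> gf; split; first exact: val_L2.
move=> e /gf[_ [F [c ->]] Fc]; exists F, c.
by rewrite val_comb; move: Fc; rewrite L2nrm.
Qed.

Section frame.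
Context (g : E) (hg : frame_sequence (gabor (val g) L)).

(** The hypothesis bounds analysis coefficients of vectors in the closed span, while [bess] is a
    synthesis bound. For a finite sum v with coefficients c, which lies in the span, |v|^2 is the
    pairing of c with the analysis coefficients of v; Young's inequality splits it, and the part
    proportional to |v|^2 is absorbed. *)
Lemma frame_bounds : exists A b : R, bess gabor_rep g b /\ frame_lower s (orb gabor_rep g) A.
Proof.
have [_ [A [B [A0 AB hAB]]]] := hg.
have B0 : 0 <= B by rewrite (le_trans (ltW A0)).
have fsetE (F : {fset L}) f :
    \sum_(i \in [set` F]) ((normc (inner (val f) (gabor (val g) L i)) ^+ 2)%:E : \bar R) =
    (\sum_(i <- F) normc (s f (orb gabor_rep g i)) ^+ 2)%:E.
  by rewrite fsbig_finite//= set_fsetK sumEFin.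
exists A, (Num.sqrt B); split.
  split; first exact: sqrtr_ge0.
  move=> F c; set v := \sum_(i <- F) _; set S := \sum_(i <- F) normc _ ^+ 2.
  have S0 : 0 <= S by apply: sumr_ge0 => i _; exact: sqr_ge0.
  rewrite (sqr_sqrtr B0).
  have gv : inspan s (orb gabor_rep g) v.
    by apply: inspan_sum => i; apply: inspanZ; exact: inspan_gen.
  have [_ hB] := hAB _ ((closed_spanP g v).2 gv).
  have vB : \sum_(i <- F) normc (s v (orb gabor_rep g i)) ^+ 2 <= B * nrm s v ^+ 2.
    rewrite -lee_fin L2nrm; apply: le_trans hB.
    by apply: esum_ge; exists [set` F]; rewrite ?fsetE//; split.
  have v2 : nrm s v ^+ 2 <= \sum_(i <- F) normc (c i) * normc (s v (orb gabor_rep g i)).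
    rewrite nrm_sqr (le_trans (ler_norm _))// (le_trans (Re_le_normc _))//.
    rewrite {1}/v ip_suml; apply: (le_trans (y := \sum_(i <- F) normc (c i *  s (orb gabor_rep g i) v))).
      under eq_bigr do rewrite ipZl.
      elim: (enum_fset F) => [|i r IH]; first by rewrite !big_nil normc0.
      by rewrite !big_cons (le_trans (normcD _ _))// lerD2l.
    by apply: ler_sum => i _; rewrite normcM (ipC s v) normc_conj.
  set q := nrm s v ^+ 2 in vB v2 *.
  have q0 : 0 <= q by exact: sqr_ge0.
  have amgm (t : R) : 0 < t -> q <= t * S + (4 * t)^-1 * (B * q).
    move=> t0; apply: (le_trans v2); rewrite /S mulr_sumr.
    apply: (@le_trans _ _ (\sum_(i <- F) (t * normc (c i) ^+ 2 +
        (4 * t)^-1 * normc (s v (orb gabor_rep g i)) ^+ 2))).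
      apply: ler_sum => i _; set a := normc _; set b := normc _.
      have -> : (4 * t)^-1 * b ^+ 2 = t * (b / (2 * t)) ^+ 2 by field; rewrite gt_eqF.
      have -> : a * b = t * (2 * a * (b / (2 * t))) by field; rewrite gt_eqF.
      rewrite -mulrDr ler_pM2l//; have := sqr_ge0 (a - b / (2 * t)); rewrite sqrrB; lra.
    by rewrite big_split/= lerD2l -mulr_sumr ler_wpM2l// invr_ge0 mulr_ge0// ltW.
  have [Be|Bn] := eqVneq B 0.
    by move: AB; rewrite Be leNgt A0.
  have Bp : 0 < B by rewrite lt_neqAle eq_sym Bn.
  (* This t makes the second term of [amgm] equal to q / 2, leaving q <= B S. *)
  have := amgm (B / 2) (divr_gt0 Bp (ltr0Sn _ 1)).
  have -> : (4 * (B / 2))^-1 * (B * q) = q / 2 by field; rewrite gt_eqF.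
  have arith (x y z : R) : z <= x / 2 * y + z / 2 -> z <= x * y by lra.
  exact: arith.
split=> // v gv e e0.
have [hA _] := hAB _ ((closed_spanP g v).2 gv).
(* The infinite sum is a supremum of finite ones: were all of them below A |v|^2 - e, it would be at
   most that. *)
apply: contrapT => noF.
have : A * L2norm (val v) ^+ 2 <= A * L2norm (val v) ^+ 2 - e.
  rewrite -lee_fin; apply: (le_trans hA); apply: ge_ereal_sup => _ [X [finX _] <-].
  rewrite -(fset_setK finX) fsetE lee_fin leNgt; apply/negP => /ltW h.
  by apply: noF; exists (fset_set X); rewrite L2nrm.
by rewrite lerDl oppr_ge0 leNgt e0.
Qed.

(** Being the element of index 0, [g] lies in the closed span, so its projection [p] is [g] up to a
    null function and the frame operator sends [ga] to [g]. *)
Lemma canonical_dual_props ga : canonical_dual_window (val g) L (val ga) ->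
  inspan s (orb gabor_rep g) ga /\
  nrm s (theta gabor_rep g g ga - g) = 0.
Proof.
have [A [b [gb gA]]] := frame_bounds.
move=> [gga [p [gp pg] [Lp Sp]]]; split; first exact/closed_spanP.
pose pE : E := L2mk Lp.
have gpE : inspan s (orb gabor_rep g) pE by apply/closed_spanP.
have ggE : inspan s (orb gabor_rep g) g.
  by have := inspan_gen s (orb gabor_rep g) (rep_one gabor_rep); rewrite /orb rep1.
have gp0 : nrm s (g - pE) = 0.
  have gB : inspan s (orb gabor_rep g) (g - pE) by exact: inspanB.
  have := pg _ ((closed_spanP g _).2 gB).
  rewrite -[inner _ _]/(s (g - pE) (g - pE)) => h.
  by rewrite /nrm h sqrtr0.
apply: nrm_eq_ip => w; rewrite (nrm_sub_eq0 gp0).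
apply: (csum_unique (theta_csum L2_hilbert gb gb ga w)).
have : vsum s (fun i => s ga (orb gabor_rep g i) *: orb gabor_rep g i) pE.
  move=> e e0; have := Sp _ (nbhsx_ballx _ _ e0).
  move=> [F0 _ F0P]; exists F0 => F /F0P /=; rewrite /ball/= sub0r normrN.
  rewrite val_comb -[X in L2norm X]/(val (pE - \sum_(i <- F) s ga (orb gabor_rep g i) *: orb gabor_rep g i)).
  by rewrite -L2nrm ger0_norm ?nrm_ge0.
move=> /(vsum_ip w); congr csum; apply/funext => i; exact: ipZl.
Qed.

Lemma gabor_lipschitz ga : canonical_dual_window (val g) L (val ga) ->
  exists K, forall m, nrm s (tf m ga - ga) <= K * nrm s (tf m g - g).
Proof.
have [A [b [gb gA]]] := frame_bounds.
move=> /canonical_dual_props[gga Sga].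
have [K HK] := dual_lipschitz L2_hilbert gb gA gga Sga.
exists K => m; apply: (HK (tf m)).
- exact: tfD.
- exact: tfZ.
- exact: tf_ip.
- exact: tf_surj.
- by move=> i; exact: tf_comm.
Qed.

End frame.
End lattice.
End tf_shifts.

(** * Difference quotients along 1/(n+1) and mean value estimates *)

Lemma difference_quotient_seq (R : realType) (V : normedModType R) (f : V -> R) (x v : V) :
  derivable f x v ->
  n.+1%:R * (f (x + n.+1%:R^-1 *: v) - f x) @[n --> \oo] --> 'D_v f x.
Proof.
move=> df.
have inv0 : n.+1%:R^-1 @[n --> \oo] --> (0 : R)^'.
  move=> A [e /= e0 Ae]; exists (Num.truncn e^-1) => // n /= en.
  apply: Ae => /=; last by rewrite invr_eq0 pnatr_eq0.
  rewrite sub0r normrN ger0_norm ?invr_ge0// -[e]invrK ltf_pV2 ?posrE ?invr_gt0//.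
  by apply: lt_le_trans (truncnS_gt _) _; rewrite ler_nat.
have := cvg_comp _ _ inv0 df; rewrite /= => h.
have -> : (fun n : nat => n.+1%:R * (f (x + n.+1%:R^-1 *: v) - f x)) =
   (fun n : nat => (n.+1%:R^-1)^-1 *: ((f \o shift x) (n.+1%:R^-1 *: v) - f x)).
  by apply/funext => n /=; rewrite invrK [x + _]addrC.
exact: h.
Qed.

Lemma derive_scale (R : realType) (f : R -> R) (x v : R) : derivable f x 1 ->
  derivable f x v /\ 'D_v f x = v * 'D_1 f x.
Proof.
move=> df; have dif : differentiable f x by exact/derivable1_diffP.
split; first exact: diff_derivable.
by rewrite !deriveE// -{1}[v]mulr1 -[v * 1]/(v *: (1 : R)) linearZ.
Qed.

Lemma MVT_lipschitz (R : realType) (f df : R -> R) (M a b : R) :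
  (forall x, is_derive (x : R) (1 : R) f (df x)) -> (forall x, `|df x| <= M) ->
  `|f b - f a| <= M * `|b - a|.
Proof.
move=> fdf dfM; wlog ab : a b / a <= b => [H|].
  by have [/H//|/ltW/H] := leP a b; rewrite distrC (distrC a).
have cf : {within `[a, b], continuous f}.
  apply: continuous_subspaceT => x; apply: differentiable_continuous.
  by apply/derivable1_diffP; have [] := fdf x.
have [c _ ->] := MVT_segment ab (fun x _ => fdf x) cf.
by rewrite normrM ler_wpM2r.
Qed.

(** * Weighted L^2 and modulations *)

Section weighted_L2.
Context {R : realType} {d : nat}.
Local Notation Rd := 'rV[R]_d.
Local Notation C := R[i].
Local Notation mu := (lebesgue_rV d : {sigma_finite_measure set Rd -> \bar R}).
Local Notation E := (@L2space R d).
Local Notation s := (@L2ip R d).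
Implicit Types f g : E.

Lemma L2nrm_normc f : nrm s f ^+ 2 = \int[mu]_x (normc (val f x) ^+ 2).
Proof.
have [[_ fr] [_ fi]] := (L2_Re f, L2_Im f).
by rewrite L2nrm_sqr -RintegralD//; apply: eq_Rintegral => x _; rewrite normc_sqr.
Qed.

Lemma sqint_normc f : sqint mu (fun x => normc (val f x)).
Proof.
have [[mr fr] [mi fi]] := (L2_Re f, L2_Im f).
have m2 : measurable_fun setT (fun x => Re (val f x) ^+ 2 + Im (val f x) ^+ 2).
  by apply: measurable_funD; exact: measurable_funX.
split.
  have -> : (fun x => normc (val f x)) = (fun x => Num.sqrt (Re (val f x) ^+ 2 + Im (val f x) ^+ 2)).
    by apply/funext => x; case: (val f x).
  apply: (measurableT_comp _ m2).
  exact: continuous_measurable_fun (@sqrt_continuous R).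
have := integrableD measurableT fr fi.
by apply: eq_integrable => // x _ /=; rewrite normc_sqr.
Qed.

Lemma le_L2nrm f g (K : R) : 0 <= K -> (forall x, normc (val f x) <= K * normc (val g x)) ->
  nrm s f <= K * nrm s g.
Proof.
move=> K0 fg; rewrite -(@ler_pXn2r _ 2)// ?nnegrE ?mulr_ge0 ?nrm_ge0//.
rewrite exprMn !L2nrm_normc.
have [_ i2] := sqint_normc g.
rewrite -RintegralZl//; apply: le_Rintegral => //.
- exact: (sqint_normc f).2.
- have := integrableZl measurableT (K ^+ 2) i2.
  by apply: eq_integrable => // x _ /=; rewrite EFinM.
- by move=> x _; rewrite -exprMn lerXn2r ?nnegrE ?mulr_ge0 ?normc_ge0.
Qed.

Lemma normc_cisB1 (t : R) : normc (cis t - 1) = 2 * `|sin (t / 2)|.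
Proof.
apply/eqP; rewrite -(@eqrXn2 _ 2)// ?normc_ge0 ?mulr_ge0//.
rewrite normc_sqr cReD cImD /= subr0 exprMn -normrX ger0_norm ?sqr_ge0//.
have := cos2Dsin2 t; have := cos2Dsin2 (t / 2).
have : cos t = cos (t / 2) ^+ 2 - sin (t / 2) ^+ 2.
  by rewrite {1}[t]splitr cosD -!expr2.
move=> -> h1 h2; apply/eqP.
have -> : (cos (t / 2) ^+ 2 - sin (t / 2) ^+ 2 - 1) ^+ 2 + sin t ^+ 2 =
  ((cos (t / 2) ^+ 2 - sin (t / 2) ^+ 2) ^+ 2 + sin t ^+ 2) + 1 - 2 * (cos (t / 2) ^+ 2 - sin (t / 2) ^+ 2).
  ring.
by rewrite h2; lra.
Qed.

Lemma abs_sin_le (t : R) : `|sin t| <= `|t|.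
Proof.
have := @MVT_lipschitz R sin cos 1 0 t (fun x => is_derive_sin x) (@cos_max R).
by rewrite sin0 !subr0 mul1r.
Qed.

Definition mod_shift (j : 'I_d) (t : R) : 'rV[R]_(d + d) := row_mx 0 (t *: delta_mx ord0 j).

Lemma tf_mod_shift j t f x : val (tf (mod_shift j t) f) x = cis (2 * pi * (t * x ord0 j)) * val f x.
Proof.
rewrite tfE row_mxKr row_mxKl subr0; congr (cis (_ * _) * _).
rewrite /dot (bigD1 j)//= !mxE !eqxx mulr1 big1 ?addr0// => i ij.
by rewrite !mxE (negbTE ij) andbF mulr0 mul0r.
Qed.

Lemma abs_coord_le (x : Rd) j : `|x ord0 j| <= enorm x.
Proof.
rewrite -sqrtr_sqr ler_wsqrtr// /dot (bigD1 j)//= -expr2 lerDl.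
by apply: sumr_ge0 => i _; rewrite -expr2 sqr_ge0.
Qed.

Lemma enorm_le_sum (x : Rd) : enorm x <= \sum_(j < d) `|x ord0 j|.
Proof.
rewrite -(@ler_pXn2r _ 2)// ?nnegrE ?sqrtr_ge0 ?sumr_ge0//.
have dot0 : 0 <= dot x x by apply: sumr_ge0 => i _; rewrite -expr2 sqr_ge0.
rewrite sqr_sqrtr// expr2 mulr_suml; apply: ler_sum => j _.
rewrite -expr2 -real_normK ?num_real// expr2 ler_wpM2l// (bigD1 j)//= lerDl.
exact: sumr_ge0.
Qed.

Lemma weight_gt0 (x : Rd) : 0 < weight x.
Proof. by rewrite ltr_pwDl// sqrtr_ge0. Qed.

Lemma measurable_weight : measurable_fun setT (@weight R d).
Proof.
apply: measurable_funD; first exact: measurable_cst.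
have m2 : measurable_fun setT (fun x : Rd => dot x x).
  by apply: measurable_sum => i; apply: measurable_funM; exact: measurable_coord.
apply: (measurableT_comp _ m2).
exact: continuous_measurable_fun (@sqrt_continuous R).
Qed.

(** Pointwise, $|e^{2\pi i t x_j}-1| = 2|\sin(\pi t x_j)| \le 2\pi|t||x_j|$, and $|x_j|$ is at most
    the weight. *)
Lemma L2w_mod_lipschitz g : L2w (val g) ->
  exists K, 0 <= K /\ forall j t, nrm s (tf (mod_shift j t) g - g) <= K * `|t|.
Proof.
move=> Lg; pose h : E := L2mk Lg.
exists (2 * pi * nrm s h); split.
  by rewrite !mulr_ge0 ?nrm_ge0// pi_ge0.
move=> j t; rewrite mulrAC; apply: le_L2nrm.
  by rewrite !mulr_ge0// pi_ge0.
move=> x.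
have -> : val (tf (mod_shift j t) g - g) x = (cis (2 * pi * (t * x ord0 j)) - 1) * val g x.
  by rewrite -[LHS]/(val (tf (mod_shift j t) g) x - val g x) tf_mod_shift mulrBl mul1r.
rewrite !normcM normcR [leRHS]mulrA ler_wpM2r ?normc_ge0// normc_cisB1.
apply: (@le_trans _ _ (2 * `|2 * pi * (t * x ord0 j) / 2|)).
  by rewrite ler_wpM2l// abs_sin_le.
rewrite (_ : 2 * pi * (t * x ord0 j) / 2 = pi * t * x ord0 j); last by field.
rewrite !normrM (ger0_norm (pi_ge0 R)) (ger0_norm (ltW (weight_gt0 x))) !mulrA.
rewrite ler_wpM2l ?mulr_ge0 ?pi_ge0// (le_trans (abs_coord_le x j))//.
by rewrite /weight lerDr.
Qed.

(** The difference quotients of the modulations at 0 have modulus tending to $2\pi|x_j||g|$ and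
    bounded norms, so Fatou makes each $x_j g$ square-integrable; the weight is at most
    $1+\sum_j|x_j|$. *)
Lemma mod_lipschitz_L2w g K : (forall j t, nrm s (tf (mod_shift j t) g - g) <= K * `|t|) ->
  L2w (val g).
Proof.
move=> gK.
have [mr mi] := ((L2_Re g).1, (L2_Im g).1).
have sg := sqint_normc g.
have sj j : sqint mu (fun x => 2 * pi * x ord0 j * normc (val g x)).
  (* Up to sign, the modulus of n+1 times the difference for the shift 1/(n+1). Keeping the sign of
     the sine makes the pointwise limit a derivative of sine at 0. *)
  pose h n (x : Rd) := n.+1%:R * (2 * sin (pi * (n.+1%:R^-1 * x ord0 j))) * normc (val g x).
  have mh n : measurable_fun setT (h n).
    apply: measurable_funM; last exact: sg.1.
    apply: measurable_funM; first exact: measurable_cst.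
    apply: measurable_funM; first exact: measurable_cst.
    have msin : measurable_fun setT (@sin R) := continuous_measurable_fun (@continuous_sin R).
    apply: (measurableT_comp msin); apply: measurable_funM; first exact: measurable_cst.
    by apply: measurable_funM; [exact: measurable_cst|exact: measurable_coord].
  have mf : measurable_fun setT (fun x : Rd => 2 * pi * x ord0 j * normc (val g x)).
    apply: measurable_funM; last exact: sg.1.
    by apply: measurable_funM; [exact: measurable_cst|exact: measurable_coord].
  apply: (sqint_le mf (c := K ^+ 2) _).1.
  apply: (@le_fatou_sqr _ _ _ mu set0 h _ _ 0%N) => // [x _|n _].
    apply: cvgM; last exact: cvg_cst.
    have [dsin Dsin] := derive_scale (pi * x ord0 j) (@derivable_sin R 0).
    have := difference_quotient_seq dsin; rewrite Dsin derive_val cos0 mulr1 => H.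
    rewrite (_ : (fun n => _) = (fun n => 2 * (n.+1%:R *
        (sin (0 + n.+1%:R^-1 *: (pi * x ord0 j)) - sin 0)))); last first.
      apply/funext => n; rewrite sin0 subr0 add0r mulrCA; congr (_ * (_ * sin _)).
      by rewrite mulrCA.
    by rewrite -mulrA; apply: cvgM => //; exact: cvg_cst.
  have -> : (\int[mu]_x (h n x ^+ 2)%:E =
      (\int[mu]_x (normc (val (n.+1%:R%:C%C *: (tf (mod_shift j n.+1%:R^-1) g - g)) x) ^+ 2))%:E)%E.
    rewrite -sqint_fin; last exact: sqint_normc.
    apply: eq_integral => x _; congr EFin.
    rewrite -[val _ x]/(n.+1%:R%:C%C * (val (tf (mod_shift j n.+1%:R^-1) g) x - val g x)).
    rewrite tf_mod_shift -{2}[val g x]mul1r -mulrBl !normcM normcR normc_cisB1 /h !exprMn.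
    rewrite -!normrX !(ger0_norm (sqr_ge0 _)).
    have half (y : R) : 2 * pi * y / 2 = pi * y by field.
    by rewrite half !mulrA.
  rewrite -L2nrm_normc lee_fin nrmZ normcR.
  rewrite lerXn2r ?nnegrE ?mulr_ge0 ?nrm_ge0//.
    have := gK j 1; rewrite normr1 mulr1; apply: le_trans; exact: nrm_ge0.
  rewrite mulrC -ler_pdivlMr ?normr_gt0 ?pnatr_eq0// -normfV; exact: gK.
have mw := measurable_weight.
have sw : sqint mu (fun x => weight x * normc (val g x)).
  have ssum : sqint mu (fun x => normc (val g x) + \sum_(j < d) `|2 * pi * x ord0 j * normc (val g x)|).
    apply: sqintD => //; elim: (index_enum _) => [|j r IH].
      by under eq_fun do rewrite big_nil; exact: sqint0.
    under eq_fun do rewrite big_cons; apply: sqintD => //.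
    apply: (le_sqint _ _ (sj j)) => [|x]; last by rewrite normr_id.
    by apply: measurableT_comp => //; exact: (sj j).1.
  apply: (le_sqint _ _ ssum) => [|x].
    by apply: measurable_funM => //; exact: sg.1.
  have n0 := normc_ge0 (val g x); have e0 : 0 <= enorm x by exact: sqrtr_ge0.
  rewrite !ger0_norm ?mulr_ge0 ?addr_ge0 ?sumr_ge0 ?(ltW (weight_gt0 x))//.
  rewrite mulrDl mul1r lerD2l (le_trans (ler_wpM2r n0 (enorm_le_sum x)))//.
  rewrite mulr_suml; apply: ler_sum => j _.
  rewrite !normrM (ger0_norm n0) ler_wpM2r// ler_peMl// (ger0_norm (pi_ge0 R)) ger0_norm//.
  by have := pi_ge2 R; lra.
apply/L2E; split.
- apply: (le_sqint _ _ sw) => [|x].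
    by under eq_fun do rewrite cReM /= mul0r subr0; exact: measurable_funM.
  rewrite cReM /= mul0r subr0 !normrM (ger0_norm (normc_ge0 _)) ler_wpM2l//.
  exact: Re_le_normc.
- apply: (le_sqint _ _ sw) => [|x].
    by under eq_fun do rewrite cImM /= mul0r addr0; exact: measurable_funM.
  rewrite cImM /= mul0r addr0 !normrM (ger0_norm (normc_ge0 _)) ler_wpM2l//.
  exact: Im_le_normc.
Qed.

End weighted_L2.

(** * Test functions *)

Section continuous_measurable.
Context {R : realType} {d : nat}.
Local Notation Rd := 'rV[R]_d.

(** The sigma-algebra on row vectors is generated by the coordinates, so openness is bypassed: round
    each point down to the grid of mesh 1/(n+1). The rounded functions take one value on each of
    countably many measurable cells and converge to [f] by continuity. *)
Lemma continuous_measurable_rV (f : Rd -> R) : continuous f -> measurable_fun setT f.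
Proof.
move=> cf.
pose grid (n : nat) (z : 'rV[int]_d) : Rd := \row_j ((z ord0 j)%:~R / n.+1%:R).
pose cell (n : nat) (x : Rd) : 'rV[int]_d := \row_j Num.floor (x ord0 j * n.+1%:R).
have mcell n (z : 'rV[int]_d) : measurable [set x | cell n x = z].
  have -> : [set x | cell n x = z] = \bigcap_(j in [set: 'I_d])
      ((fun x : Rd => x ord0 j) @^-1`
        `[(z ord0 j)%:~R / n.+1%:R, (z ord0 j + 1)%:~R / n.+1%:R[%classic).
    apply/seteqP; split => x /=.
      move=> <- j _ /=; rewrite in_itv/= !mxE ler_pdivrMr// ltr_pdivlMr//.
      by rewrite -floor_ge_int lexx -floor_lt_int ltzD1 lexx.
    move=> xz; apply/rowP => j; have := xz j I.
    rewrite /= in_itv/= !mxE ler_pdivrMr// ltr_pdivlMr// -floor_ge_int -floor_lt_int ltzD1.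
    by move=> zz; apply/le_anti; rewrite andbC.
  apply: fin_bigcap_measurable => // j _.
  by rewrite -[X in measurable X]setTI; exact: measurable_coord.
apply: (@measurable_fun_cvg _ _ _ setT (fun n x => f (grid n (cell n x)))).
  move=> n _ B mB; rewrite setTI.
  have -> : (fun x => f (grid n (cell n x))) @^-1` B =
      \bigcup_(z in [set z | B (f (grid n z))]) [set x | cell n x = z].
    apply/seteqP; split => x /=; first by move=> Bx; exists (cell n x).
    by move=> [z /= Bz xz]; rewrite /preimage/= xz.
  rewrite bigcup_mkcond; apply: countable_bigcupT_measurable => [|z].
    exact: countableP.
  by case: ifP => _; [exact: mcell|exact: measurable0].
move=> x _; apply: (cvg_comp _ f _ (cf x)).
apply/cvg_ballP => e e0; exists (Num.truncn e^-1) => // n /= en; split=> // i j.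
rewrite (ord1 i) /ball/= !mxE; set y := x ord0 j; set z := Num.floor _.
have n0 : (0 : R) < n.+1%:R by [].
have zy : z%:~R <= y * n.+1%:R by rewrite -floor_ge_int.
have yz : y * n.+1%:R < z%:~R + 1 by rewrite -(intrD _ z 1) -floor_lt_int ltzD1.
have -> : y - z%:~R / n.+1%:R = (y * n.+1%:R - z%:~R) / n.+1%:R.
  by rewrite mulrBl mulfK// gt_eqF.
rewrite ger0_norm; last by rewrite divr_ge0// subr_ge0.
rewrite ltr_pdivrMr//; apply: (@lt_le_trans _ _ 1); first by rewrite ltrBlDl.
rewrite -ler_pdivrMl// mulr1 (le_trans (ltW (truncnS_gt _)))// ler_nat.
exact: en.
Qed.

End continuous_measurable.

Lemma sqint_indic d (T : measurableType d) (R : realType) (mu : {measure set T -> \bar R})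
  (A : set T) : measurable A -> (mu A < +oo)%E -> sqint mu (\1_A : T -> R).
Proof.
move=> mA Afin; split; first exact: measurable_indic.
apply/integrableP; split.
  by apply/measurable_EFinP; apply: measurable_funX; exact: measurable_indic.
rewrite (eq_integral (fun x => (\1_A x)%:E)); last first.
  by move=> x _ /=; rewrite indicE; case: (x \in A); rewrite /= ?expr1n ?expr0n/= ?normr1 ?normr0.
by rewrite integral_indic// setIT.
Qed.

Section test_functions.
Context {R : realType} {d : nat}.
Local Notation Rd := 'rV[R]_d.
Local Notation mu := (lebesgue_rV d : {sigma_finite_measure set Rd -> \bar R}).
Implicit Types (p q phi psi : Rd -> R) (j : 'I_d).

Local Notation e_ j := (delta_mx ord0 j : Rd).

Definition cube (N : R) : set Rd := [set x | forall j, `|x ord0 j| <= N].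

Lemma cube_compact N : compact (cube N).
Proof.
have -> : cube N = [set x : Rd | forall j, `[- N, N]%classic (x ord0 j)].
  by apply/seteqP; split => x xN j; have := xN j; rewrite /= in_itv/= ler_norml.
by apply: (@rV_compact _ _ (fun=> `[- N, N]%classic)) => j; exact: segment_compact.
Qed.

Lemma cube_closed N : closed (cube N).
Proof. by apply: compact_closed; [exact: norm_hausdorff|exact: cube_compact]. Qed.

Lemma cube_measure N : measurable (cube N) /\ (mu (cube N) < +oo)%E.
Proof.
have cE : cube N = [set x : Rd | forall j, `[- N, N]%classic (x ord0 j)].
  by apply/seteqP; split => x xN j; have := xN j; rewrite /= in_itv/= ler_norml.
split.
  have -> : cube N = \bigcap_(j in [set: 'I_d]) ((fun x : Rd => x ord0 j) @^-1` `[- N, N]%classic).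
    by rewrite cE; apply/seteqP; split => x /= xN j => [_|]; exact: xN.
  apply: fin_bigcap_measurable => // j _.
  by rewrite -[X in measurable X]setTI; exact: measurable_coord.
rewrite cE (@lebesgue_rV_box R d (fun=> `[- N, N]%classic))//.
have fin : (@lebesgue_measure R `[- N, N]%classic) \is a fin_num.
  rewrite lebesgue_measure_itv/=; case: ifP => _ //.
elim: (index_enum _) => [|j r IH]; first by rewrite big_nil ltry.
rewrite big_cons lte_mul_pinfty//.
Qed.

Definition supported phi := exists N : R, forall x, phi x != 0 -> cube N x.

(** Vanishing outside a cube is easier to carry through shifts, sums and derivatives than a compact
    closure. *)
Lemma test_functionE phi : test_function phi <-> smooth phi /\ supported phi.
Proof.
split=> [[sm cs]|[sm [N HN]]]; split=> //.
  have /compact_bounded[M [_ MP]] := cs.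
  exists (M + 1) => x x0 j.
  have := MP (M + 1); rewrite ltrDl ltr01 => /(_ isT x (@subset_closure _ [set x | phi x != 0] x x0)) /=.
  apply: le_trans; have /mapP[k Hk ->] : `|x ord0 j| \in [seq `|x y.1 y.2| | y : 'I_1 * 'I_d].
    by apply/mapP; exists (ord0, j) => //=; rewrite mem_enum.
  by rewrite [leRHS]/Num.norm /= mx_normrE; apply/bigmax_geP; right => /=; exists k.
apply: (@subclosed_compact _ _ (cube N) _ (@cube_compact N)); first exact: closed_closure.
rewrite (closure_id (cube N)).1; last exact: cube_closed.
exact: closureS.
Qed.

Lemma smooth_continuous phi : smooth phi -> continuous phi.
Proof. by move=> /(_ [::])[]. Qed.

Lemma smooth_partial phi j : smooth phi -> smooth (partial j phi).
Proof. by move=> sm s; rewrite -foldr_rcons; exact: sm. Qed.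

Lemma supported_partial phi j : supported phi -> supported (partial j phi).
Proof.
move=> [N HN]; exists N => x; apply: contraNP => xN.
have : \forall y \near x, phi y = 0.
  have : open (~` cube N) by apply: closed_openC; exact: cube_closed.
  rewrite openE => /(_ x xN); apply: filterS => y yN.
  by apply/eqP; apply: contrapT => /negP /HN.
move=> near0; apply/eqP; rewrite /partial.
rewrite (@near_eq_derive _ _ _ phi (fun=> 0))//; first exact: derive_cst.
Qed.

Lemma bounded_test phi : continuous phi -> supported phi -> exists2 M : R, 0 <= M & forall x, `|phi x| <= M.
Proof.
move=> cphi [N HN].
have : compact (phi @` cube N).
  by apply: continuous_compact (@cube_compact N); apply: continuous_subspaceT.
move=> /compact_bounded[M [_ MP]]; exists (`|M| + 1); first by rewrite addr_ge0.
move=> x; have [->|x0] := eqVneq (phi x) 0; first by rewrite normr0 addr_ge0.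
apply: MP; last by exists x => //; exact: HN.
by rewrite (le_lt_trans (ler_norm _))// ltrDl.
Qed.

Lemma sqint_test phi : continuous phi -> supported phi -> sqint mu phi.
Proof.
move=> cphi sphi; have [M M0 phiM] := bounded_test cphi sphi.
have mphi := continuous_measurable_rV cphi.
have [N HN] := sphi; have [mQ Qfin] := cube_measure N.
apply: (le_sqint mphi _ (sqintZ M (sqint_indic mQ Qfin))) => x.
have [->|x0] := eqVneq (phi x) 0; first by rewrite normr0.
by rewrite indicE mem_set ?mulr1 ?(ger0_norm M0)//; exact: HN.
Qed.

Lemma partial_shift phi j a : partial j (fun x => phi (x + a)) = (fun x => partial j phi (x + a)).
Proof.
apply/funext => x; rewrite /partial /derive.
rewrite (_ : (fun y => phi (y + a)) \o shift x = phi \o shift (x + a))//.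
by apply/funext => h /=; rewrite addrA.
Qed.

Lemma test_shift phi a : test_function phi -> test_function (fun x => phi (x + a)).
Proof.
move=> /test_functionE[sm [N HN]]; apply/test_functionE; split.
  have E s : foldr partial (fun x => phi (x + a)) s = (fun x => foldr partial phi s (x + a)).
    by elim: s => //= j s ->; rewrite partial_shift.
  move=> s; rewrite E; have [cs ds] := sm s; split.
    move=> x; apply: (cvg_comp (fun y => y + a) _ _ (cs (x + a))).
    exact: (cvgD (@cvg_id _ (nbhs x)) (cvg_cst a)).
  move=> x j; have := ds (x + a) j; rewrite /derivable.
  rewrite (_ : (fun y => foldr partial phi s (y + a)) \o shift x =
    foldr partial phi s \o shift (x + a))//.
  by apply/funext => h /=; rewrite addrA.
exists (N + \sum_j `|a ord0 j|) => x /HN xN j.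
have := xN j; rewrite mxE => xaN.
rewrite -(addrK (a ord0 j) (x ord0 j)) (le_trans (ler_normB _ _))// lerD//.
by rewrite (bigD1 j)//= lerDl sumr_ge0.
Qed.

Lemma test_lin phi psi (r : R) : test_function phi -> test_function psi ->
  test_function (fun x => phi x + r * psi x) /\
  forall j, partial j (fun x => phi x + r * psi x) = (fun x => partial j phi x + r * partial j psi x).
Proof.
move=> /test_functionE[sm [N HN]] /test_functionE[sm' [N' HN']].
have PD p q j : (forall x, derivable p x (e_ j)) -> (forall x, derivable q x (e_ j)) ->
    partial j (fun x => p x + r * q x) = (fun x => partial j p x + r * partial j q x).
  move=> dp dq; apply/funext => x; rewrite /partial.
  have -> : (fun y => p y + r * q y) = p + r \*: q by [].
  by rewrite deriveD// ?deriveZ//; exact: derivableZ.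
have E s : foldr partial (fun x => phi x + r * psi x) s =
    (fun x => foldr partial phi s x + r * foldr partial psi s x).
  elim: s => //= j s ->; apply: PD => x; [exact: (sm s).2|exact: (sm' s).2].
split; last by move=> j; exact: (E [:: j]).
apply/test_functionE; split.
  move=> s; rewrite E; have [[cs ds] [cs' ds']] := (sm s, sm' s); split.
    by move=> x; exact: (cvgD (cs x) (cvgM (cvg_cst r) (cs' x))).
  move=> x j; have -> : (fun y => foldr partial phi s y + r * foldr partial psi s y) =
    foldr partial phi s + r \*: foldr partial psi s by [].
  by apply: derivableD; [exact: ds|apply: derivableZ; exact: ds'].
exists (Num.max N N') => x x0 j; rewrite le_max.
have [p0|/HN/(_ j)->//] := eqVneq (phi x) 0.
have [q0|/HN'/(_ j)->] := eqVneq (psi x) 0; last by rewrite orbT.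
by move: x0; rewrite p0 q0 mulr0 addr0 eqxx.
Qed.

Lemma test_zero : test_function (fun _ : Rd => 0 : R).
Proof.
apply/test_functionE; split; last by exists 0 => x; rewrite eqxx.
have E s : foldr partial (fun _ : Rd => 0 : R) s = (fun=> 0).
  by elim: s => //= j s ->; apply/funext => x; rewrite /partial derive_cst.
move=> s; rewrite E; split=> [x|x j]; first exact: cst_continuous.
exact: (@derivable_cst _ _ _ (0 : R)).
Qed.

End test_functions.

(** * Smooth bump functions *)

Section bumps.
Context {R : realType}.
Implicit Types (P : {poly R}) (x y c a : R).

(** The functions $P(1/y)e^{-1/y}$ extended by 0. The polynomial factor makes the family closed
    under differentiation, with P becoming $X^2(P-P')$. *)
Definition flat P y : R := if 0 < y then P.[y^-1] * expR (- y^-1) else 0.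

(** With z = 1/y >= 1, P(z) is at most a constant times z^n, while e^z >= z^(n+2)/(n+2)!. The
    exponent 2 makes the difference quotient at 0 tend to 0. *)
Lemma flat_small P : exists2 C : R, 0 <= C & forall y, y <= 1 -> `|flat P y| <= C * y ^+ 2.
Proof.
pose n := size P; pose S := \sum_(i < n) `|P`_i|.
have S0 : 0 <= S by exact: sumr_ge0.
exists (S * (n.+2)`!%:R); first by rewrite mulr_ge0.
move=> y y1; rewrite /flat; case: ltP => y0; last by rewrite normr0 mulr_ge0 ?sqr_ge0// mulr_ge0.
set z := y^-1; have z1 : 1 <= z by rewrite invf_ge1.
have z0 : 0 < z by rewrite invr_gt0.
have Pz : `|P.[z]| <= S * z ^+ n.
  rewrite horner_coef (le_trans (ler_norm_sum _ _ _))// mulr_suml.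
  apply: ler_sum => i _; rewrite normrM ler_wpM2l// normrX (ger0_norm (ltW z0)).
  by rewrite ler_weXn2l// ltnW.
have ez : z ^+ n.+2 / (n.+2)`!%:R <= expR z.
  by rewrite (le_trans _ (expR_ge1Dxn n.+1 (ltW z0)))// lerDr.
rewrite normrM (ger0_norm (expR_ge0 _)) expRN ler_pdivrMr ?expR_gt0//.
apply: (le_trans Pz).
have -> : S * (n.+2)`!%:R * y ^+ 2 * expR z = S * ((n.+2)`!%:R * y ^+ 2 * expR z) by rewrite !mulrA.
rewrite ler_wpM2l//; have -> : y ^+ 2 = (z ^+ 2)^-1 by rewrite -exprVn invrK.
rewrite mulrAC ler_pdivlMr ?exprn_gt0// -exprD addn2 -ler_pdivrMl ?ltr0n ?fact_gt0//.
by rewrite mulrC.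
Qed.

Lemma is_derive_flat P y :
  is_derive y 1 (flat P) (flat ('X^2 * (P - P^`())) y).
Proof.
have [y0|y0|->] := ltgtP y 0.
- rewrite {2}/flat ltNge (ltW y0)/=.
  apply: (@near_eq_is_derive _ _ _ (fun=> 0)).
    near=> z; rewrite /flat ltNge ltW//.
    by near: z; exact: lt_nbhsl.
- have dinv : is_derive y 1 (fun z : R => z^-1) (- y ^- 2).
    apply: DeriveDef; first by apply: derivableV => //; rewrite gt_eqF.
    by rewrite deriveV ?gt_eqF// derive_id scaler1.
  have dP := is_derive1_comp (is_derive_poly P y^-1) dinv.
  have dN : is_derive y 1 (fun z : R => - z^-1) (y ^- 2).
    by rewrite -[y ^- 2]opprK; exact: is_deriveN.
  have dE := @is_derive1_comp R expR (fun z => - z^-1) y _ _ (is_derive_expR (- y^-1)) dN.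
  have dPE := is_deriveM dP dE.
  have E : flat ('X^2 * (P - P^`())) y = P.[y^-1] *: (expR (- y^-1) * y ^- 2) +
      expR (- y^-1) *: (P^`().[y^-1] * - y ^- 2).
    rewrite /flat y0 !hornerE /= exprVn; rewrite /GRing.scale /=; ring.
  rewrite E; apply: near_eq_is_derive dPE.
  by near=> z; rewrite /flat ifT//; near: z; exact: lt_nbhsr.
- have [C C0 HC] := flat_small P.
  have flat0 Q : flat Q 0 = 0 by rewrite /flat ltxx.
  have cv : h^-1 *: ((flat P \o shift 0) (h *: (1 : R)) - flat P 0) @[h --> 0^'] --> (0 : R).
    apply/cvgrPdist_lt => e e0.
    have eC : 0 < Num.min 1 (e / (C + 1)) by rewrite lt_min ltr01 divr_gt0// ltr_wpDl.
    exists (Num.min 1 (e / (C + 1))) => //= h; rewrite /ball_/= sub0r normrN lt_min => /andP[h1 he] h0.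
    rewrite flat0 subr0 sub0r normrN addr0 normrM.
    rewrite -[h *: 1]/(h * 1) mulr1 normfV.
    have hn0 : 0 < `|h| by rewrite normr_gt0.
    rewrite mulrC ltr_pdivrMr// (le_lt_trans (HC h (le_trans (ler_norm _) (ltW h1))))//.
    rewrite -real_normK ?num_real// expr2 mulrA ltr_pM2r//.
    move: he; rewrite ltr_pdivlMr ?ltr_wpDl// mulrC; apply: le_lt_trans.
    by rewrite ler_wpM2r// lerDl.
  rewrite flat0; apply: DeriveDef; first by apply/cvg_ex; exists 0.
  exact: cvg_lim cv.
Unshelve. all: by end_near.
Qed.

(** A class generated syntactically so that each member has a derivative in the class; smoothness
    then follows by iteration, without formulas for higher derivatives. *)
Inductive smooth1 : (R -> R) -> Prop :=
| smooth1_flat P c a : smooth1 (fun y => flat P (c * (y - a)))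
| smooth1D u v : smooth1 u -> smooth1 v -> smooth1 (fun y => u y + v y)
| smooth1M u v : smooth1 u -> smooth1 v -> smooth1 (fun y => u y * v y).

Lemma smooth1_derive u : smooth1 u ->
  exists v, smooth1 v /\ forall x, is_derive x 1 u (v x).
Proof.
elim=> [P c a|{}u v _ [u' [su' du']] _ [v' [sv' dv']]|{}u v su [u' [su' du']] sv [v' [sv' dv']]].
- exists (fun y => flat (c *: ('X^2 * (P - P^`()))) (c * (y - a))); split.
    exact: smooth1_flat.
  move=> y.
  have daff : is_derive y 1 (fun y : R => c * (y - a)) c.
    have := is_deriveZ c (is_derive_shift y 1 (- a)).
    by rewrite -[c *: 1]/(c * 1) mulr1.
  have := @is_derive1_comp R (flat P) (fun y => c * (y - a)) y _ _ (is_derive_flat P _) daff.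
  congr is_derive; rewrite /flat; case: ifP => _; last by rewrite mul0r.
  by rewrite hornerZ; ring.
- exists (fun y => u' y + v' y); split; first exact: smooth1D.
  by move=> x; exact: is_deriveD.
- exists (fun y => u y * v' y + v y * u' y); split.
    by apply: smooth1D; exact: smooth1M.
  by move=> x; exact: is_deriveM.
Qed.

Lemma smooth1_continuous u : smooth1 u -> continuous u.
Proof.
move=> /smooth1_derive[v [_ dv]] x; apply: differentiable_continuous.
by apply/derivable1_diffP; have [] := dv x.
Qed.

Lemma is_derive_line (V : normedModType R) (f : V -> R) (x v : V) (l : R) :
  is_derive (0 : R) 1 (fun t : R => f (t *: v + x)) l -> is_derive x v f l.
Proof.
have E : (fun h : R => h^-1 *: (((fun t : R => f (t *: v + x)) \o shift 0) (h *: 1) - f (0 *: v + x))) =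
    (fun h : R => h^-1 *: ((f \o shift x) (h *: v) - f x)).
  by apply/funext => h /=; rewrite addr0 scale0r add0r -[h *: 1]/(h * 1) mulr1.
case=> dl <-; split; first by move: dl; rewrite /derivable E.
by rewrite /derive E.
Qed.

Context {d : nat}.
Local Notation Rd := 'rV[R]_d.

Definition prodf (u : 'I_d -> R -> R) (x : Rd) : R := \prod_i u i (x ord0 i).

Lemma partial_prodf (u : 'I_d -> R -> R) j (v : R -> R) :
  (forall y : R, is_derive y (1 : R) (u j) (v y)) ->
  forall x : Rd, is_derive x (delta_mx ord0 j : Rd) (prodf u)
    (prodf (fun i => if i == j then v else u i) x).
Proof.
move=> duv x; apply: is_derive_line.
pose K := \prod_(i | i != j) u i (x ord0 i).
have -> : (fun t : R => prodf u (t *: delta_mx ord0 j + x)) = K *: (u j \o shift (x ord0 j)).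
  apply/funext => t; rewrite /prodf (bigD1 j)//= mulrC; congr (_ * _).
    apply: eq_bigr => i ij; congr (u i _).
    by rewrite !mxE (negbTE ij) andbF mulr0 add0r.
  by rewrite !mxE !eqxx mulr1.
have -> : prodf (fun i => if i == j then v else u i) x = K *: (v (x ord0 j) * 1).
  rewrite /prodf (bigD1 j)//= eqxx mulrC mulr1; congr (_ * _).
  by apply: eq_bigr => i /negbTE ->.
apply: is_deriveZ; apply: is_derive1_comp; last exact: is_derive_shift.
by rewrite /= add0r; exact: duv.
Qed.

(** A partial derivative replaces one factor by its derivative, so every iterated partial derivative
    is again a product of [smooth1] functions. *)
Lemma smooth_prodf u : (forall i, smooth1 (u i)) -> smooth (prodf u).
Proof.
move=> su.
have E s : exists2 u', (forall i, smooth1 (u' i)) & foldr partial (prodf u) s = prodf u'.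
  elim: s => [|j s [u' su' E]]; first by exists u.
  have [v [sv dv]] := smooth1_derive (su' j).
  exists (fun i => if i == j then v else u' i) => [i|]; first by case: ifP.
  apply/funext => x; rewrite /= E /partial.
  by have := partial_prodf dv x; move=> ?; rewrite derive_val.
move=> s; have [u' su' ->] := E s; split.
  rewrite /prodf; elim: (index_enum _) => [|i r IH].
    by under eq_fun do rewrite big_nil; exact: cst_continuous.
  have ci : continuous (fun y : Rd => u' i (y ord0 i)).
    move=> y; apply: (@continuous_comp _ _ _ (fun y : Rd => y ord0 i) (u' i)).
      exact: coord_continuous.
    exact: smooth1_continuous.
  by under eq_fun do rewrite big_cons; move=> x; exact: (cvgM (ci x) (IH x)).
move=> x j; have [v [sv dv]] := smooth1_derive (su' j).
by have [] := partial_prodf dv x.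
Qed.

End bumps.

(** * Fundamental lemma of the calculus of variations *)

Section density_measure.
Context d (T : measurableType d) (R : realType) (mu : {measure set T -> \bar R}).
Context (f : T -> \bar R) (mf : measurable_fun setT f) (f0 : forall x, (0 <= f x)%E).

Definition density_measure (A : set T) : \bar R := (\int[mu]_(x in A) f x)%E.

Let density0 : density_measure set0 = 0%E.
Proof. exact: integral_set0. Qed.

Let density_ge0 A : (0 <= density_measure A)%E.
Proof. exact: integral_ge0. Qed.

Let density_sigma_additive : semi_sigma_additive density_measure.
Proof. exact: semi_sigma_additive_nng_induced. Qed.

HB.instance Definition _ := isMeasure.Build _ _ _ density_measure
  density0 density_ge0 density_sigma_additive.

Definition density : {measure set T -> \bar R} := density_measure.

End density_measure.

Section rays.
Context {R : realType} {d : nat}.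
Local Notation Rd := 'rV[R]_d.

Definition ray (a : 'I_d -> R) : set Rd := [set x | forall i, a i < x ord0 i].

Lemma measurable_ray a : measurable (ray a).
Proof.
have -> : ray a = \bigcap_(i in [set: 'I_d]) ((fun x : Rd => x ord0 i) @^-1` `]a i, +oo[%classic).
  by apply/seteqP; split => x /= xa i => [_|]; have := xa i; rewrite /= in_itv/= andbT //; apply.
apply: fin_bigcap_measurable => // i _.
by rewrite -[X in measurable X]setTI; exact: measurable_coord.
Qed.

(** Together with [setI_closed_ray] this makes the rays a generating pi-system, so finite measures
    that agree on rays are equal. A coordinate half-space is the union of rays whose other endpoints
    tend to minus infinity. *)
Lemma ray_generates : @measurable _ Rd = <<s range ray >>.
Proof.
apply/seteqP; split; last first.
  apply: smallest_sub; first exact: sigma_algebra_measurable.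
  by move=> _ [a _ <-]; exact: measurable_ray.
apply: smallest_sub; first exact: smallest_sigma_algebra.
move=> B; rewrite -bigcup_seq/= => -[i _ [C mC <-]] /=; rewrite setTI.
have {}mC : (@RGenOInfty.G R).-sigma.-measurable C by rewrite -RGenOInfty.measurableE.
suff : smallest (sigma_algebra setT) (@RGenOInfty.G R) `<=`
    [set A | <<s range ray >> ((fun x : Rd => x ord0 i) @^-1` A)] by apply.
apply: smallest_sub.
  split=> /=.
  - by rewrite preimage_set0; exact: sigma_algebra0.
  - by move=> A sA; rewrite setTD preimage_setC; exact: sigma_algebraC.
  - by move=> F sF; rewrite preimage_bigcup; exact: sigma_algebra_bigcup.
move=> _ [y ->] /=.
have -> : (fun x : Rd => x ord0 i) @^-1` `]y, +oo[%classic =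
    \bigcup_n ray (fun j => if j == i then y else - n%:R).
  apply/seteqP; split => x /=.
    rewrite in_itv/= andbT => yx.
    exists (Num.truncn (\sum_j `|x ord0 j|)).+1 => // j /=.
    case: eqP => [->//|_]; rewrite ltrNl.
    apply: (le_lt_trans _ (truncnS_gt _)).
    rewrite (le_trans (ler_norm _))// normrN (bigD1 j)//= lerDl.
    exact: sumr_ge0.
  by move=> [n _ /(_ i)]; rewrite eqxx in_itv/= andbT.
apply: sigma_algebra_bigcup => n; apply: sub_sigma_algebra.
by exists (fun j => if j == i then y else - n%:R).
Qed.

Lemma setI_closed_ray : setI_closed (range ray).
Proof.
move=> _ _ [a _ <-] [b _ <-]; exists (fun i => Num.max (a i) (b i)) => //.
apply/seteqP; split => x /=.
  by move=> abx; split => i; have := abx i; rewrite gt_max => /andP[].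
by move=> [ax bx] i; rewrite gt_max ax bx.
Qed.

Lemma ray_cover : \bigcup_k ray (fun=> - k%:R) = setT.
Proof.
apply/seteqP; split=> // x _; exists (Num.truncn (\sum_j `|x ord0 j|)).+1 => // j /=.
rewrite ltrNl; apply: (le_lt_trans _ (truncnS_gt _)).
rewrite (le_trans (ler_norm _))// normrN (bigD1 j)//= lerDl.
exact: sumr_ge0.
Qed.

(** One upper bound for all coordinates suffices: a ray meets the cube with sides ]-N, N[ in a box
    of this form. *)
Definition obox (a : 'I_d -> R) (b : R) : set Rd := ray a `&` [set x | forall i, x ord0 i < b].

Lemma oboxE a b x : obox a b x <-> forall i, a i < x ord0 i < b.
Proof.
split=> [[ax xb] i|axb]; first by rewrite ax xb.
by split => i; have /andP[] := axb i.
Qed.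

Lemma measurable_obox a b : measurable (obox a b).
Proof.
have E : obox a b = ray a `&` \bigcap_(i in [set: 'I_d]) ((fun x : Rd => x ord0 i) @^-1` `]-oo, b[%classic).
  apply/seteqP; split => x [xa xb]; split=> // i.
    by move=> _ /=; rewrite in_itv/=; exact: xb.
  by have := xb i I; rewrite /= in_itv.
rewrite E; apply: measurableI; first exact: measurable_ray.
apply: fin_bigcap_measurable => // i _.
by rewrite -[X in measurable X]setTI; exact: measurable_coord.
Qed.

Lemma obox_cube a b : obox a b `<=` cube (`|b| + \sum_j `|a j|).
Proof.
move=> x /oboxE axb j; have /andP[ax xb] := axb j.
have s0 : `|a j| <= \sum_j `|a j| by rewrite (bigD1 j)//= lerDl sumr_ge0.
have := ler_norm b; have := ler_norm (- a j); rewrite normrN => h1 h2.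
have := normr_ge0 b; have := normr_ge0 (a j); rewrite ler_norml => h3 h4.
by apply/andP; split; lra.
Qed.

End rays.

Section fundamental_lemma.
Context {R : realType} {d : nat}.
Local Notation Rd := 'rV[R]_d.
Local Notation mu := (lebesgue_rV d : {sigma_finite_measure set Rd -> \bar R}).
Implicit Types (f : Rd -> R).

Lemma obox_fin a b : (mu (@obox R d a b) < +oo)%E.
Proof.
have [mQ Qfin] := @cube_measure R d (`|b| + \sum_j `|a j|).
apply: le_lt_trans Qfin; apply: le_measure; rewrite ?inE//.
  exact: measurable_obox.
exact: obox_cube.
Qed.

Lemma flat1_itv (y : R) : 0 <= flat 1 y <= 1.
Proof.
rewrite /flat; case: ifP => [y0|_]; last by rewrite lexx ler01.
by rewrite hornerC mul1r expR_ge0/= -expR0 ler_expR oppr_le0 invr_ge0 ltW.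
Qed.

Lemma flat1_cvg (t : R) : flat 1 (n.+1%:R * t) @[n --> \oo] --> ((0 < t)%R%:R : R).
Proof.
have [t0|t0] := ltP 0 t; last first.
  rewrite (_ : (fun n => _) = (fun=> 0)); first exact: cvg_cst.
  by apply/funext => n; rewrite /flat ltNge mulr_ge0_le0.
rewrite (_ : (fun n => _) = (fun n => expR (n.+1%:R^-1 * - t^-1))); last first.
  by apply/funext => n; rewrite /flat mulr_gt0// hornerC mul1r invfM mulrN.
rewrite (_ : _%:R = expR (0 * - t^-1)); last by rewrite mul0r expR0.
have H : n.+1%:R^-1 * - t^-1 @[n --> \oo] --> (0 * - t^-1 : R).
  by apply: cvgM; [exact: cvg_harmonic|exact: cvg_cst].
exact: (cvg_comp _ _ H (@continuous_expR R _)).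
Qed.

(** [flat 1] is $e^{-1/y}$ on the positive axis, so rescaling by n+1 makes it tend to the indicator
    of that axis; the product tends to the indicator of the open box from below. *)
Definition bump (a : 'I_d -> R) (b : R) (n : nat) : Rd -> R :=
  prodf (fun i y => flat 1 (n.+1%:R * (y - a i)) * flat 1 (- n.+1%:R * (y - b))).

Lemma bump_itv a b n x : 0 <= bump a b n x <= \1_(obox a b) x.
Proof.
have fac i : 0 <= flat 1 (n.+1%:R * (x ord0 i - a i)) * flat 1 (- n.+1%:R * (x ord0 i - b)) <= 1.
  have /andP[p0 p1] := flat1_itv (n.+1%:R * (x ord0 i - a i)).
  have /andP[q0 q1] := flat1_itv (- n.+1%:R * (x ord0 i - b)).
  by rewrite mulr_ge0//= mulr_ile1.
rewrite /bump /prodf prodr_ge0/=; last by move=> i _; have /andP[] := fac i.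
have [xB|xB] := pselect (obox a b x).
  rewrite indicE mem_set//; apply: prodr_ile1 => i _; exact: fac.
rewrite indicE memNset//.
have [i Hi] : exists i, ~~ (a i < x ord0 i < b).
  by apply: contrapT => /forallNP H; apply: xB; apply/oboxE => i; have /negP/negPn := H i.
rewrite (bigD1 i)//= [X in X * _](_ : _ = 0) ?mul0r//.
move: Hi; rewrite negb_and -!leNgt => /orP[h|h].
  by rewrite {1}/flat ltNge mulr_ge0_le0// ?subr_le0//= mul0r.
by rewrite {2}/flat ltNge mulr_le0_ge0// ?oppr_le0 ?subr_ge0//= mulr0.
Qed.

Lemma bump_cvg a b x : bump a b n x @[n --> \oo] --> (\1_(obox a b) x : R).
Proof.
have fac i : flat 1 (n.+1%:R * (x ord0 i - a i)) * flat 1 (- n.+1%:R * (x ord0 i - b)) @[n --> \oo]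
    --> ((a i < x ord0 i < b)%R%:R : R).
  rewrite -mulnb natrM; apply: cvgM.
    by rewrite -subr_gt0; exact: flat1_cvg.
  rewrite -(subr_gt0 _ b) -(opprB (x ord0 i)).
  by under eq_fun do rewrite mulNr -mulrN; exact: flat1_cvg.
have -> : (\1_(obox a b) x : R) = \prod_i (a i < x ord0 i < b)%R%:R.
  have [xB|xB] := pselect (obox a b x).
    rewrite indicE mem_set// big1// => i _.
    by move/oboxE : xB => ->.
  rewrite indicE memNset//.
  have [i Hi] : exists i, ~~ (a i < x ord0 i < b).
    by apply: contrapT => /forallNP H; apply: xB; apply/oboxE => i; have /negP/negPn := H i.
  by rewrite (bigD1 i)//= (negbTE Hi) mul0r.
rewrite /bump /prodf; elim: (index_enum _) => [|i r IH].
  by rewrite big_nil; under eq_fun do rewrite big_nil; exact: cvg_cst.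
by rewrite big_cons; under eq_fun do rewrite big_cons; exact: (cvgM (fac i) IH).
Qed.

Lemma bump_test a b n : test_function (bump a b n).
Proof.
apply/test_functionE; split.
  by apply: smooth_prodf => i; apply: smooth1M; exact: smooth1_flat.
exists (`|b| + \sum_j `|a j|) => x bx; apply: obox_cube.
apply: contrapT => xB; move: bx; have := bump_itv a b n x.
rewrite indicE memNset//= => h; move/negP; apply.
by rewrite eq_le andbC.
Qed.

Lemma obox_orthogonal f a b : sqint mu f ->
  (forall phi, test_function phi -> rint f phi = 0) ->
  (\int[mu]_x (f x * \1_(obox a b) x)%:E = 0)%E.
Proof.
move=> sf forth.
have mB := measurable_obox a b.
have s1 := sqint_indic mB (obox_fin a b).
have sbump n : sqint mu (bump a b n).
  have /test_functionE[sm sp] := bump_test a b n.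
  by apply: sqint_test => //; exact: smooth_continuous.
have iF n : mu.-integrable setT (fun x => (f x * bump a b n x)%:E).
  exact: sqint_mul.
have i1 := sqint_mul sf s1.
have cv (x : Rd) : (f x * bump a b n x)%:E @[n --> \oo] --> (f x * \1_(obox a b) x)%:E.
  apply: cvg_EFin; first exact: nearW.
  by apply: cvgM; [exact: cvg_cst|exact: bump_cvg].
have dom (x : Rd) n : (`|(f x * bump a b n x)%:E| <= `|(f x * \1_(obox a b) x)%:E|)%E.
  have /andP[b0 b1] := bump_itv a b n x.
  by rewrite lee_fin !normrM ler_wpM2l// !ger0_norm.
have [_ _] := dominated_convergence measurableT (fun n => measurable_int _ (iF n))
  (measurable_int _ i1) (aeW mu (fun x _ => cv x)) (integrable_abse i1) (aeW mu (fun x n _ => dom x n)).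
rewrite (_ : (fun n => _) = (fun=> 0%E)); last first.
  apply/funext => n; rewrite -(@fineK _ (\int[mu]_x _)%E).
    by congr EFin; exact: forth (bump_test a b n).
  exact: integrable_fin_num (iF n).
by move=> /cvg_lim <-//; rewrite lim_cst.
Qed.

(** Cut [f] off to a cube [Q N], which makes it integrable. Orthogonality to bumps says that its
    positive and negative parts have the same integral over every ray; being densities of finite
    measures, they have the same integral over every measurable set. Letting N grow removes the
    cut-off by Fatou. *)
Lemma orthogonal_test_eq0 f : sqint mu f ->
  (forall phi, test_function phi -> rint f phi = 0) ->
  \int[mu]_x (f x ^+ 2) = 0.
Proof.
move=> sf forth.
pose Q N : set Rd := obox (fun=> - N%:R) N%:R.
pose h N x := f x * \1_(Q N) x.
have mh N : measurable_fun setT (h N).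
  by apply: measurable_funM; [exact: sf.1|apply: measurable_indic; exact: measurable_obox].
have ih N : mu.-integrable setT (EFin \o h N).
  by apply: sqint_mul => //; apply: sqint_indic; [exact: measurable_obox|exact: obox_fin].
have mEh N : measurable_fun setT (EFin \o h N) := measurable_int _ (ih N).
have mp N := measurable_funepos (mEh N); have mn N := measurable_funeneg (mEh N).
have eqd N A : measurable A ->
    (\int[mu]_(x in A) (EFin \o h N)^\+ x = \int[mu]_(x in A) (EFin \o h N)^\- x)%E.
  move=> mA.
  apply: (@measure_unique _ R _ (range ray) (fun k => ray (fun=> - k%:R)) ray_generates
    setI_closed_ray _ ray_cover (density mu (mp N) (funepos_ge0 _))
    (density mu (mn N) (funeneg_ge0 _)) _ _ A mA).
  - by move=> k; exists (fun=> - k%:R).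
  - move=> _ [a _ <-]; rewrite /density /= /density_measure.
    have ia : mu.-integrable (ray a) (EFin \o h N).
      by apply: integrableS (ih N) => //; exact: measurable_ray.
    have ra0 : (\int[mu]_(x in ray a) (EFin \o h N) x = 0)%E.
      rewrite integral_mkcond -(@obox_orthogonal f (fun i => Num.max (a i) (- N%:R)) N%:R)//.
      apply: eq_integral => x _; rewrite patchE /h /=.
      have Q1 : (\1_(obox (fun i => Num.max (a i) (- N%:R)) N%:R) x : R) = \1_(ray a) x * \1_(Q N) x.
        rewrite !indicE -natrM mulnb; congr (_%:R); congr nat_of_bool.
        apply/idP/andP; rewrite !inE.
          move=> /oboxE xm; split; [move=> i|apply/oboxE => i];
            by have := xm i; rewrite gt_max => /andP[/andP[xa xN] xN']; rewrite ?xa// xN.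
        move=> [xa /oboxE xQ]; apply/oboxE => i; have /andP[? ?] := xQ i.
        by rewrite gt_max; apply/andP; split => //; apply/andP; split.
      rewrite Q1 [\1_(ray a) x]indicE /h; case: (x \in ray a) => /=; first by rewrite mul1r.
      by rewrite mul0r mulr0.
    have fp := integrable_pos_fin_num (measurable_ray a) ia.
    have fn := integrable_neg_fin_num (measurable_ray a) ia.
    rewrite integralE -(fineK fp) -(fineK fn) -EFinB in ra0.
    have {}ra0 := EFin_inj ra0; move/subr0_eq : ra0 => ra0.
    by rewrite -[LHS](fineK fp) ra0 (fineK fn).
  - move=> k; rewrite /density /= /density_measure.
    apply: integral_funepos_lt_pinfty; first exact: measurable_ray.
    by apply: integrableS (ih N) => //; exact: measurable_ray.
have h0 N : (\int[mu]_x (h N x ^+ 2)%:E = 0)%E.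
  (* On this set the negative part vanishes and off it the positive part does; equality of the
     integrals over the set and over its complement makes both parts integrate to 0. *)
  pose A : set Rd := [set x | 0 < h N x].
  have mA : measurable A.
    have := mh N measurableT _ (measurable_itv `]0, +oo[).
    rewrite setTI; congr measurable; apply/seteqP; split => x; rewrite /A/= in_itv/= andbT//.
  have pA x : ~ A x -> ((EFin \o h N)^\+ x = 0)%E.
    move=> /negP; rewrite -leNgt => hx; rewrite funeposE /=.
    by apply/max_idPr; rewrite lee_fin.
  have nA x : A x -> ((EFin \o h N)^\- x = 0)%E.
    move=> hx; rewrite funenegE /=.
    by apply/max_idPr; rewrite lee_fin oppr_le0 ltW.
  have intp : (\int[mu]_x (EFin \o h N)^\+ x = 0)%E.
    transitivity (\int[mu]_(x in A) (EFin \o h N)^\+ x)%E.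
      rewrite [RHS]integral_mkcond; apply: eq_integral => x _; rewrite patchE.
      by case: ifPn => //; rewrite notin_setE => /pA.
    rewrite eqd//; apply: integral0_eq => x; exact: nA.
  have intn : (\int[mu]_x (EFin \o h N)^\- x = 0)%E.
    transitivity (\int[mu]_(x in ~` A) (EFin \o h N)^\- x)%E.
      rewrite [RHS]integral_mkcond; apply: eq_integral => x _; rewrite patchE.
      by case: ifPn => //; rewrite notin_setE => /contrapT /nA.
    rewrite -eqd; last exact: measurableC.
    by apply: integral0_eq => x; exact: pA.
  have : (\int[mu]_x `|(EFin \o h N) x| = 0)%E.
    rewrite -[fun x => _]/(abse \o (EFin \o h N)) fune_abse ge0_integralD//.
    by rewrite intp intn adde0.
  move=> /(ae_eq_integral_abs mu measurableT (mEh N)) hae.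
  rewrite -(integral0 mu setT); apply: ge0_ae_eq_integral => //.
  - by apply/measurable_EFinP; exact: measurable_funX.
  - by move=> x _; rewrite lee_fin sqr_ge0.
  - apply: filterS hae => x /= H _; have [->] := H I.
    by rewrite expr0n.
have [_ le0] : sqint mu f /\ \int[mu]_x (f x ^+ 2) <= 0.
  apply: sqint_le; first exact: sf.1.
  apply: (@le_fatou_sqr _ _ _ mu set0 h _ _ 0%N) => // [|x _|n _]; first exact: sf.1.
    apply: cvg_near_cst; exists (Num.truncn (\sum_j `|x ord0 j|)).+1 => // n /= xn.
    rewrite /h indicE mem_set ?mulr1//; apply/oboxE => i.
    have : `|x ord0 i| < n%:R.
      apply: (@le_lt_trans _ _ (\sum_j `|x ord0 j|)).
        by rewrite (bigD1 i)//= lerDl sumr_ge0.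
      by apply: (lt_le_trans (truncnS_gt _)); rewrite ler_nat.
    by rewrite ltr_norml.
  by rewrite h0.
by apply/eqP; rewrite eq_le le0/= Rintegral_ge0// => x _; exact: sqr_ge0.
Qed.

End fundamental_lemma.

(** * H^1 and translations *)

Section real_L2.
Context {R : realType} {d : nat}.
Local Notation Rd := 'rV[R]_d.
Local Notation mu := (lebesgue_rV d : {sigma_finite_measure set Rd -> \bar R}).
Local Notation E := (@L2space R d).
Local Notation s := (@L2ip R d).
Implicit Types (p q u w phi : Rd -> R).

Definition rnrm p : R := Num.sqrt (\int[mu]_x (p x ^+ 2)).

Lemma rnrm_ge0 p : 0 <= rnrm p.
Proof. exact: sqrtr_ge0. Qed.

Lemma rnrm_sqr p : rnrm p ^+ 2 = \int[mu]_x (p x ^+ 2).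
Proof. by rewrite sqr_sqrtr// Rintegral_ge0// => x _; exact: sqr_ge0. Qed.

Lemma L2_real p : sqint mu p -> L2 (fun x => (p x)%:C%C).
Proof. by move=> sp; apply/L2E; split => //; exact: sqint0. Qed.

Definition emb p (sp : sqint mu p) : E := L2mk (L2_real sp).

Lemma rint0r p : rint p (fun=> 0) = 0 :> R.
Proof. by rewrite /rint /Rintegral integral0_eq// => x _; rewrite mulr0. Qed.

Lemma Re_ip_real (v f : E) : (forall x, Im (val f x) = 0) ->
  Re (s v f) = rint (fun x => Re (val v x)) (fun x => Re (val f x)).
Proof.
move=> f0; rewrite [LHS]Re_inner (_ : (fun x => Im (val f x)) = fun=> 0); last exact/funext.
by rewrite rint0r addr0.
Qed.

Lemma nrm_real (f : E) : (forall x, Im (val f x) = 0) ->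
  nrm s f = rnrm (fun x => Re (val f x)).
Proof.
move=> f0; apply/eqP; rewrite -(eqrXn2 (n := 2))// ?nrm_ge0 ?rnrm_ge0//.
rewrite L2nrm_sqr rnrm_sqr (_ : \int[mu]_x (Im (val f x) ^+ 2) = 0) ?addr0//.
by rewrite /Rintegral integral0_eq// => x _; rewrite f0 expr0n.
Qed.

Lemma nrm_emb p (sp : sqint mu p) : nrm s (emb sp) = rnrm p.
Proof. exact: nrm_real. Qed.

Lemma nrm_Re_Im (f : E) :
  nrm s f ^+ 2 = rnrm (fun x => Re (val f x)) ^+ 2 + rnrm (fun x => Im (val f x)) ^+ 2.
Proof. by rewrite L2nrm_sqr !rnrm_sqr. Qed.

Lemma rint_le p q : sqint mu p -> sqint mu q -> `|rint p q| <= rnrm p * rnrm q.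
Proof.
move=> sp sq; rewrite -(nrm_emb sp) -(nrm_emb sq).
rewrite (_ : rint p q = Re (s (emb sp) (emb sq))); last by rewrite Re_ip_real.
exact: le_trans (Re_le_normc _) (cauchy_schwarz _ _ _).
Qed.

Lemma rnrmD p q : sqint mu p -> sqint mu q ->
  rnrm (fun x => p x + q x) <= rnrm p + rnrm q.
Proof.
move=> sp sq; rewrite -(nrm_emb sp) -(nrm_emb sq) -(nrm_emb (sqintD sp sq)).
rewrite (_ : emb _ = emb sp + emb sq); first exact: nrmD.
by apply: L2space_eq => x; apply/eqP; rewrite eq_complex /= addr0 !eqxx.
Qed.

Lemma rnrm_shift p a : sqint mu p -> rnrm (fun x : Rd => p (x + a)) = rnrm p.
Proof.
move=> sp; congr Num.sqrt.
by rewrite (@Rintegral_shift _ _ a (fun x => p x ^+ 2))//; apply: measurable_funX; exact: sp.1.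
Qed.

Lemma rint_shift p q a : sqint mu p -> sqint mu q ->
  rint p (fun x : Rd => q (x + a)) = rint (fun x : Rd => p (x - a)) q.
Proof.
move=> sp sq.
rewrite /rint -(@Rintegral_shift _ _ a (fun x : Rd => p (x - a) * q x)).
  by apply: eq_Rintegral => x _; rewrite addrK.
by apply: measurable_funM; [exact: (sqint_shift (- a) sp).1|exact: sq.1].
Qed.

(** Riesz representation on the real subspace of real test functions inside the complex space; [w]
    is the real part of the representing vector. *)
Lemma functional_repr (l : (Rd -> R) -> R) (C : R) : 0 <= C ->
  (forall phi psi r, test_function phi -> test_function psi ->
    l (fun x => phi x + r * psi x) = l phi + r * l psi) ->
  (forall phi, test_function phi -> `|l phi| <= C * rnrm phi) ->
  exists2 w, sqint mu w & (forall phi, test_function phi -> rint w phi = l phi) /\ rnrm w <= C.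
Proof.
move=> C0 lD lC.
pose T (f : E) := test_function (fun x => Re (val f x)) /\ forall x, Im (val f x) = 0.
have lin (f g : E) (r : R) : (fun x => Re (val (f + r%:C%C *: g) x)) =
    (fun x => Re (val f x) + r * Re (val g x)).
  by apply/funext => x /=; rewrite cReD cReM /= mul0r subr0.
have [||||f Tf|v vl vC] := @riesz _ _ s (L2_hilbert) T (fun f => l (fun x => Re (val f x))) C.
- by split; [exact: test_zero|].
- move=> f g r [tf f0] [tg g0]; split; first by rewrite lin; exact: (test_lin r tf tg).1.
  by move=> x; rewrite /= cImD cImM f0 g0 /= !(mulr0, mul0r, addr0).
- by move=> f g r [tf _] [tg _]; rewrite lin; exact: lD.
- exact: C0.
- by rewrite nrm_real; [exact: lC Tf.1|exact: Tf.2].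
exists (fun x => Re (val v x)); first exact: L2_Re.
split=> [phi tphi|].
  have /test_functionE[sm sp] := tphi.
  have sphi := sqint_test (smooth_continuous sm) sp.
  have := vl (emb sphi) (conj tphi (fun=> erefl)).
  by rewrite Re_ip_real.
apply: le_trans vC.
by rewrite -ler_sqr ?nnegrE ?rnrm_ge0 ?nrm_ge0// nrm_Re_Im lerDl sqr_ge0.
Qed.

(** Duality with test functions. The functional of [u] has a representative [w] with norm at most C,
    and [u - w] is orthogonal to all test functions, hence null. This takes the place of a density
    argument. *)
Lemma rnrm_test_le u (C : R) : sqint mu u -> 0 <= C ->
  (forall phi, test_function phi -> `|rint u phi| <= C * rnrm phi) -> rnrm u <= C.
Proof.
move=> su C0 uC.
have st phi : test_function phi -> sqint mu phi.
  by move=> /test_functionE[sm sp]; exact: sqint_test (smooth_continuous sm) sp.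
have [w sw [wu wC]] : exists2 w, sqint mu w &
    (forall phi, test_function phi -> rint w phi = rint u phi) /\ rnrm w <= C.
  apply: functional_repr => // phi psi r /st sphi /st spsi.
  rewrite !(rintC u) rintD//; last exact: sqintZ.
  by rewrite rintZ.
have suw := sqintB su sw.
have : rnrm (fun x => u x - w x) = 0.
  rewrite /rnrm orthogonal_test_eq0 ?sqrtr0// => phi tphi.
  have sphi := st _ tphi.
  rewrite (_ : (fun x => u x - w x) = (fun x => u x + -1 * w x)).
    by rewrite rintD ?rintZ// ?wu ?mulN1r ?subrr//; exact: sqintZ.
  by apply/funext => x; rewrite mulN1r.
move=> uw0; apply: (le_trans _ wC); rewrite -[leRHS]add0r -uw0.
rewrite [X in rnrm X <= _](_ : u = fun x => (u x - w x) + w x).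
  exact: rnrmD.
by apply/funext => x; rewrite subrK.
Qed.

End real_L2.

Lemma is_derive_along (R : realType) (V : normedModType R) (f : V -> R) (x v : V) (t : R) :
  derivable f (x + t *: v) v ->
  is_derive t (1 : R) (fun r : R => f (x + r *: v)) ('D_v f (x + t *: v)).
Proof.
have E : (fun h : R => h^-1 *: (((fun r : R => f (x + r *: v)) \o shift t) (h *: 1) - f (x + t *: v))) =
    (fun h : R => h^-1 *: ((f \o shift (x + t *: v)) (h *: v) - f (x + t *: v))).
  by apply/funext => h /=; rewrite [h *: 1](mulr1 h) scalerDl addrCA.
move=> df; split; first by rewrite /derivable E.
by rewrite /derive E.
Qed.

(** * Difference quotients of test functions and weak derivatives *)

Section difference_quotients.
Context {R : realType} {d : nat}.
Local Notation Rd := 'rV[R]_d.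
Local Notation mu := (lebesgue_rV d : {sigma_finite_measure set Rd -> \bar R}).
Implicit Types (p q phi : Rd -> R) (j : 'I_d).
Local Notation e_ j := (delta_mx ord0 j : Rd).

Lemma sqint_test_function phi : test_function phi -> sqint mu phi.
Proof.
by move=> /test_functionE[sm sp]; exact: sqint_test (smooth_continuous sm) sp.
Qed.

Lemma test_partial phi j : test_function phi -> test_function (partial j phi).
Proof.
move=> /test_functionE[sm sp]; apply/test_functionE.
by split; [exact: smooth_partial|exact: supported_partial].
Qed.

Definition dquot j phi (n : nat) : Rd -> R :=
  fun x => n.+1%:R * (phi (x + n.+1%:R^-1 *: e_ j) - phi x) - partial j phi x.

Lemma sqint_dquot phi j n : test_function phi -> sqint mu (dquot j phi n).
Proof.
move=> tphi; have sphi := sqint_test_function tphi.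
apply: sqintB; last exact/sqint_test_function/test_partial.
by apply: sqintZ; apply: sqintB => //; exact: sqint_shift.
Qed.

Lemma dquot_dominated phi j : test_function phi ->
  exists (M N : R), 0 <= M /\ forall n x, `|dquot j phi n x| <= M * \1_(cube N) x.
Proof.
move=> tphi; have /test_functionE[sm [N supp]] := tphi.
have tp := test_partial j tphi; have /test_functionE[sm' sp'] := tp; have [N' supp'] := sp'.
have [M M0 bM] := bounded_test (smooth_continuous sm') sp'.
(* By the mean value theorem quotient and derivative are each at most M; the cube grows by 1 because
   steps 1/(n+1) are at most 1. *)
exists (M + M), (`|N| + `|N'| + 1); split=> [|n x]; first exact: addr_ge0.
have n0 : 0 < n.+1%:R :> R by rewrite ltr0n.
have n1 : n.+1%:R^-1 <= 1 :> R by rewrite invf_le1// ler1n.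
have lip : `|phi (x + n.+1%:R^-1 *: e_ j) - phi x| <= M * n.+1%:R^-1.
  have dphi (t : R) : is_derive t (1 : R) (fun t => phi (x + t *: e_ j)) (partial j phi (x + t *: e_ j)).
    by apply: is_derive_along; exact: (sm [::]).2.
  have := MVT_lipschitz 0 n.+1%:R^-1 dphi (fun t => bM _).
  by rewrite scale0r addr0 subr0 (@ger0_norm _ n.+1%:R^-1)// ltW// invr_gt0.
have [xN|xN] := pselect (cube (`|N| + `|N'| + 1) x).
  rewrite indicE mem_set// mulr1 (le_trans (ler_normB _ _))// lerD//.
  by rewrite normrM gtr0_norm// mulrC -ler_pdivlMr.
rewrite indicE memNset// mulr0 normr_le0 /dquot.
have NN : N <= `|N| + `|N'| by rewrite (le_trans (ler_norm _))// lerDl.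
have NN' : N' <= `|N| + `|N'| by rewrite (le_trans (ler_norm _))// lerDr.
have z1 : phi x = 0.
  apply/eqP; apply: contra_notT xN => /supp xN i.
  by rewrite (le_trans (xN i))// (le_trans NN)// lerDl.
have z2 : phi (x + n.+1%:R^-1 *: e_ j) = 0.
  apply/eqP; apply: contra_notT xN => /supp xN i.
  have := xN i; rewrite !mxE => h.
  set a := n.+1%:R^-1 * _ in h.
  have a1 : `|a| <= 1.
    rewrite /a eqxx/=; case: (i == j); rewrite ?mulr1 ?mulr0 ?normr0 ?ler01//.
    by rewrite ger0_norm// invr_ge0 ltW.
  have -> : x ord0 i = (x ord0 i + a) - a by rewrite addrK.
  by rewrite (le_trans (ler_normB _ _))// lerD// (le_trans h).
have z3 : partial j phi x = 0.
  apply/eqP; apply: contra_notT xN => /supp' xN i.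
  by rewrite (le_trans (xN i))// (le_trans NN')// lerDl.
by rewrite z1 z2 z3 !subrr mulr0 subrr.
Qed.


Lemma dquot_cvg phi j : test_function phi -> rnrm (dquot j phi n) @[n --> \oo] --> (0 : R).
Proof.
move=> tphi; have [M [N [M0 dom]]] := dquot_dominated j tphi.
have /test_functionE[sm _] := tphi.
have [mQ Qfin] := @cube_measure R d N.
have sG : sqint mu (fun x => M * \1_(cube N) x) by apply/sqintZ/sqint_indic.
have cv (x : Rd) : (dquot j phi n x ^+ 2)%:E @[n --> \oo] --> (0 : \bar R).
  apply: cvg_EFin; first exact: nearW.
  have H : dquot j phi n x @[n --> \oo] --> (0 : R).
    rewrite -(subrr (partial j phi x)); apply: cvgB; last exact: cvg_cst.
    by apply: difference_quotient_seq; exact: (sm [::]).2.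
  by rewrite -(mulr0 (0 : R)); exact: (cvgM H H).
have dm (x : Rd) n : (`|(dquot j phi n x ^+ 2)%:E| <= ((M * \1_(cube N) x) ^+ 2)%:E)%E.
  rewrite lee_fin ger0_norm ?sqr_ge0// -real_normK ?num_real// lerXn2r// nnegrE//.
  by rewrite mulr_ge0.
have m0 : measurable_fun setT (cst 0%E : Rd -> \bar R) by exact: measurable_cst.
have [_ _] := dominated_convergence measurableT
  (fun n => measurable_int _ (sqint_dquot j n tphi).2)
  m0 (aeW mu (fun x _ => cv x)) sG.2 (aeW mu (fun x n _ => dm x n)).
rewrite integral0 => /fine_cvg /= H.
by have := cvg_comp _ _ H (@sqrt_continuous R _); rewrite sqrtr0.
Qed.

End difference_quotients.

Section translation_H1.
Context {R : realType} {d : nat}.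
Local Notation Rd := 'rV[R]_d.
Local Notation C := R[i].
Local Notation mu := (lebesgue_rV d : {sigma_finite_measure set Rd -> \bar R}).
Local Notation E := (@L2space R d).
Local Notation s := (@L2ip R d).
Implicit Types (p q phi : Rd -> R) (j : 'I_d).
Local Notation e_ j := (delta_mx ord0 j : Rd).

Lemma rint_dquot p phi j n : sqint mu p -> test_function phi ->
  rint p (fun x : Rd => phi (x + n.+1%:R^-1 *: e_ j)) - rint p phi =
  n.+1%:R^-1 * (rint p (dquot j phi n) + rint p (partial j phi)).
Proof.
move=> sp tphi; have sphi := sqint_test_function tphi.
have sd := sqint_dquot j n tphi; have spa := sqint_test_function (test_partial j tphi).
rewrite !(rintC p) -rintD// -rintZ//; last exact: sqintD.
apply/eqP; rewrite subr_eq; apply/eqP; rewrite -rintD//; last exact/sqintZ/sqintD.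
apply: eq_Rintegral => x _; rewrite /dquot subrK mulKf ?subrK//.
Qed.

Lemma rint_translate p phi a : sqint mu p -> sqint mu phi ->
  rint (fun x : Rd => p (x - a) - p x) phi = rint p (fun x : Rd => phi (x + a)) - rint p phi.
Proof.
move=> sp sphi; rewrite rint_shift//.
have st := sqint_shift (- a) sp.
apply/eqP; rewrite eq_sym subr_eq -rintD//; last exact: sqintB.
by apply/eqP/eq_Rintegral => x _; rewrite subrK.
Qed.

(** Tested against [phi], one step of size 1/(n+1) would leave the error of its difference quotient.
    So the step is cut into m+1 equal pieces: each contributes at most its length times |q| |phi|
    plus an error, the lengths add up to 1/(n+1), and the error tends to 0 as m grows. *)
Lemma weak_derivative_translate p q j : sqint mu p -> sqint mu q ->
  (forall phi, test_function phi -> rint p (partial j phi) = - rint q phi) ->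
  forall n, rnrm (fun x : Rd => p (x - n.+1%:R^-1 *: e_ j) - p x) <= rnrm q * n.+1%:R^-1.
Proof.
move=> sp sq hpq n.
have d0 : 0 <= n.+1%:R^-1 :> R by rewrite invr_ge0.
apply: rnrm_test_le; first by apply: sqintB => //; exact: sqint_shift.
  by rewrite mulr_ge0// rnrm_ge0.
move=> phi tphi; have sphi := sqint_test_function tphi; rewrite rint_translate//.
have step psi M : test_function psi ->
    `|rint p (fun x : Rd => psi (x + M.+1%:R^-1 *: e_ j)) - rint p psi| <=
    M.+1%:R^-1 * (rnrm q * rnrm psi + rnrm p * rnrm (dquot j psi M)).
  move=> tpsi; rewrite rint_dquot// hpq// normrM ger0_norm ?invr_ge0//.
  rewrite ler_wpM2l ?invr_ge0// addrC (le_trans (ler_normD _ _))// normrN lerD//.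
    by apply: rint_le => //; exact: sqint_test_function.
  by apply: rint_le => //; exact: sqint_dquot.
have shifted (psi : Rd -> R) a M : test_function psi ->
    rnrm (dquot j (fun x : Rd => psi (x + a)) M) = rnrm (dquot j psi M).
  move=> tpsi; rewrite -(rnrm_shift a (sqint_dquot j M tpsi)).
  congr (rnrm _); apply/funext => x; rewrite /dquot partial_shift.
  by rewrite (addrAC x a).
have tele m M : M.+1 = (n.+1 * m.+1)%N ->
    `|rint p (fun x : Rd => phi (x + n.+1%:R^-1 *: e_ j)) - rint p phi| <=
    n.+1%:R^-1 * (rnrm q * rnrm phi + rnrm p * rnrm (dquot j phi M)).
  move=> MM; pose D k := rint p (fun x : Rd => phi (x + k%:R *: (M.+1%:R^-1 *: e_ j))).
  have Mm : n.+1%:R^-1 = m.+1%:R * M.+1%:R^-1 :> R.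
    by rewrite MM natrM invfM mulrCA divff ?mulr1// pnatr_eq0.
  have -> : rint p phi = D 0%N.
    by rewrite /D; apply: eq_Rintegral => x _; rewrite scale0r addr0.
  have -> : rint p (fun x : Rd => phi (x + n.+1%:R^-1 *: e_ j)) = D m.+1.
    by apply: eq_Rintegral => x _; rewrite scalerA -Mm.
  rewrite -(telescope_sumr D (leq0n m.+1)) (le_trans (ler_norm_sum _ _ _))//.
  rewrite (le_trans (ler_sum_nat (n := m.+1)
    (G := fun=> M.+1%:R^-1 * (rnrm q * rnrm phi + rnrm p * rnrm (dquot j phi M))) _))//.
    move=> k _; pose psi (x : Rd) := phi (x + k%:R *: (M.+1%:R^-1 *: e_ j)).
    have := step psi M (test_shift _ tphi).
    rewrite shifted// (rnrm_shift _ sphi).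
    rewrite (_ : rint p (fun x => psi _) = D k.+1)//.
    apply: eq_Rintegral => x _; rewrite /psi -addrA; congr (_ * phi (_ + _)).
    by rewrite -[k.+1]add1n natrD scalerDl scale1r.
  by rewrite sumr_const_nat subn0 Mm -mulrA mulr_natl.
apply/ler_addgt0Pr => eps eps0.
have := dquot_cvg j tphi => /cvgrPdist_lt /(_ (eps / (rnrm p + 1))).
have p1 : 0 < rnrm p + 1 by rewrite ltr_wpDl// rnrm_ge0.
rewrite divr_gt0// => /(_ isT) [N _ HN].
(* Index M stands for the step 1/(M+1), hence the predecessor. *)
have MM : (n.+1 * N.+1).-1.+1 = (n.+1 * N.+1)%N by rewrite prednK.
have NM : (N <= (n.+1 * N.+1).-1)%N by rewrite -ltnS MM leq_pmull.
apply: (le_trans (tele N _ MM)); rewrite mulrDr.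
rewrite [X in X + _ <= _](_ : _ = rnrm q / n.+1%:R * rnrm phi); last by rewrite mulrA [X in X * _]mulrC.
rewrite lerD2l.
have := HN _ NM; rewrite /= sub0r normrN ger0_norm ?rnrm_ge0// => hr.
have pr : rnrm p * rnrm (dquot j phi (n.+1 * N.+1).-1) <= eps.
  apply: le_trans (ler_wpM2l (rnrm_ge0 _) (ltW hr)) _.
  by rewrite mulrCA (ler_piMr (ltW eps0))// ler_pdivrMr// mul1r lerDl.
have n1 : n.+1%:R^-1 <= 1 :> R by rewrite invf_le1// ler1n.
apply: le_trans pr; rewrite ler_piMl// mulr_ge0// rnrm_ge0//.
Qed.

(** Moving the difference quotients from [phi] to [p] and letting the step tend to 0 bounds the
    functional phi -> -<p, d_j phi> by K |phi|; its representative is the weak derivative. *)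
Lemma translate_weak_derivative p j (K : R) : sqint mu p -> 0 <= K ->
  (forall n, rnrm (fun x : Rd => p (x - n.+1%:R^-1 *: e_ j) - p x) <= K * n.+1%:R^-1) ->
  exists2 q, sqint mu q & forall phi, test_function phi -> rint p (partial j phi) = - rint q phi.
Proof.
move=> sp K0 hK.
have [|phi psi r tphi tpsi|phi tphi|q sq [hq _]] :=
  @functional_repr R d (fun phi => - rint p (partial j phi)) K.
- exact: K0.
- have [_ ->] := test_lin r tphi tpsi.
  have sphi := sqint_test_function (test_partial j tphi).
  have spsi := sqint_test_function (test_partial j tpsi).
  rewrite [in LHS]rintC rintD//; last exact: sqintZ.
  by rewrite rintZ// (rintC (partial j phi)) (rintC (partial j psi)) opprD mulrN.
- rewrite normrN; apply/ler_addgt0Pr => eps eps0.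
  have sphi := sqint_test_function tphi.
  have := dquot_cvg j tphi => /cvgrPdist_lt /(_ (eps / (rnrm p + 1))).
  have p1 : 0 < rnrm p + 1 by rewrite ltr_wpDl// rnrm_ge0.
  rewrite divr_gt0// => /(_ isT) [n _ /(_ _ (leqnn n))].
  rewrite /= sub0r normrN ger0_norm ?rnrm_ge0// => hr.
  have pr : rnrm p * rnrm (dquot j phi n) <= eps.
    apply: le_trans (ler_wpM2l (rnrm_ge0 _) (ltW hr)) _.
    by rewrite mulrCA (ler_piMr (ltW eps0))// ler_pdivrMr// mul1r lerDl.
  have := rint_dquot j n sp tphi; rewrite -rint_translate// => E1.
  have -> : rint p (partial j phi) = n.+1%:R *
      rint (fun x : Rd => p (x - n.+1%:R^-1 *: e_ j) - p x) phi - rint p (dquot j phi n).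
    by rewrite E1 mulrA divff ?pnatr_eq0// mul1r addrC addKr.
  rewrite (le_trans (ler_normB _ _))// lerD//; last first.
    by apply: le_trans pr; apply: rint_le => //; exact: sqint_dquot.
  rewrite normrM ger0_norm// mulrC -ler_pdivlMr ?ltr0n//.
  have su : sqint mu (fun x : Rd => p (x - n.+1%:R^-1 *: e_ j) - p x).
    by apply: sqintB => //; exact: sqint_shift.
  apply: le_trans (rint_le su sphi) _.
  by rewrite mulrAC ler_wpM2r ?rnrm_ge0.
by exists q => // phi tphi; rewrite hq// opprK.
Qed.

End translation_H1.

Section H1_translations.
Context {R : realType} {d : nat}.
Local Notation Rd := 'rV[R]_d.
Local Notation C := R[i].
Local Notation mu := (lebesgue_rV d : {sigma_finite_measure set Rd -> \bar R}).
Local Notation E := (@L2space R d).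
Local Notation s := (@L2ip R d).
Implicit Types (f g : E) (j : 'I_d).
Local Notation e_ j := (delta_mx ord0 j : Rd).

Definition trans_shift j (t : R) : 'rV[R]_(d + d) := row_mx (t *: e_ j) 0.

Lemma tf_trans_shift j t f x : val (tf (trans_shift j t) f) x = val f (x - t *: e_ j).
Proof.
rewrite tfE row_mxKl row_mxKr (_ : dot 0 _ = 0) ?mulr0 ?cis0 ?mul1r//.
by rewrite /dot big1// => i _; rewrite mxE mul0r.
Qed.

Lemma cintegral_real (f : E) (phi : Rd -> R) :
  cintegral (fun x => val f x * (phi x)%:C%C) =
  (rint (fun x => Re (val f x)) phi +i* rint (fun x => Im (val f x)) phi)%C.
Proof.
congr (_ +i* _)%C; apply: eq_Rintegral => x _; first by rewrite cReM /= mulr0 subr0.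
by rewrite cImM /= mulr0 add0r.
Qed.

Lemma H1_trans_lipschitz f j : H1 (val f) ->
  exists K, 0 <= K /\ forall n, nrm s (tf (trans_shift j n.+1%:R^-1) f - f) <= K * n.+1%:R^-1.
Proof.
move=> [_ /(_ j)[gj Lg dp]]; pose g : E := L2mk Lg.
have dg phi : test_function phi ->
    rint (fun x => Re (val f x)) (partial j phi) = - rint (fun x => Re (val g x)) phi /\
    rint (fun x => Im (val f x)) (partial j phi) = - rint (fun x => Im (val g x)) phi.
  by move=> /dp; rewrite (cintegral_real f) (cintegral_real g) => -[].
pose a := rnrm (fun x => Re (val g x)); pose b := rnrm (fun x => Im (val g x)).
have a0 : 0 <= a := rnrm_ge0 _; have b0 : 0 <= b := rnrm_ge0 _.
(* Real and imaginary parts are estimated separately, and the square root of a^2 + b^2 is at most a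
   + b. *)
exists (a + b); split=> [|n]; first exact: addr_ge0.
have n0 : 0 <= n.+1%:R^-1 :> R by rewrite invr_ge0.
rewrite -ler_sqr ?nnegrE ?nrm_ge0 ?mulr_ge0 ?addr_ge0// nrm_Re_Im.
have hr := weak_derivative_translate (L2_Re f) (L2_Re g) (fun phi h => (dg phi h).1) n.
have hi := weak_derivative_translate (L2_Im f) (L2_Im g) (fun phi h => (dg phi h).2) n.
rewrite (_ : (fun x => Re _) = fun x : Rd => Re (val f (x - n.+1%:R^-1 *: e_ j)) - Re (val f x)); last first.
  by apply/funext => x; rewrite -(tf_trans_shift j) /= cReD cReN.
rewrite (_ : (fun x => Im _) = fun x : Rd => Im (val f (x - n.+1%:R^-1 *: e_ j)) - Im (val f x)); last first.
  by apply/funext => x; rewrite -(tf_trans_shift j) /= cImD cImN.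
move: hr hi; rewrite -/a -/b; set u := rnrm _; set v := rnrm _ => hr hi.
have u0 : 0 <= u := rnrm_ge0 _; have v0 : 0 <= v := rnrm_ge0 _.
have : u ^+ 2 <= (a * n.+1%:R^-1) ^+ 2 by rewrite ler_sqr ?nnegrE ?mulr_ge0.
have : v ^+ 2 <= (b * n.+1%:R^-1) ^+ 2 by rewrite ler_sqr ?nnegrE ?mulr_ge0.
have := mulr_ge0 (mulr_ge0 a0 n0) (mulr_ge0 b0 n0).
rewrite mulrDl sqrrD; set A := a * _; set B := b * _.
have arith (x y z w t : R) : 0 <= z -> x <= y -> w <= t -> w + x <= t + z *+ 2 + y.
  by move=> h1 h2 h3; rewrite mulr2n; lra.
exact: arith.
Qed.

Lemma trans_lipschitz_H1 f : (forall j, exists K, 0 <= K /\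
    forall n, nrm s (tf (trans_shift j n.+1%:R^-1) f - f) <= K * n.+1%:R^-1) ->
  H1 (val f).
Proof.
move=> hf; split; first exact: val_L2.
move=> j; have [K [K0 hK]] := hf j.
have bnd n : let t := n.+1%:R^-1 *: e_ j in
    rnrm (fun x : Rd => Re (val f (x - t)) - Re (val f x)) <= K * n.+1%:R^-1 /\
    rnrm (fun x : Rd => Im (val f (x - t)) - Im (val f x)) <= K * n.+1%:R^-1.
  move=> t; have Kn0 : 0 <= K * n.+1%:R^-1 by rewrite mulr_ge0// invr_ge0.
  have := hK n; rewrite -ler_sqr ?nnegrE ?nrm_ge0// nrm_Re_Im.
  rewrite (_ : (fun x => Re _) = fun x : Rd => Re (val f (x - t)) - Re (val f x)); last first.
    by apply/funext => x; rewrite -(tf_trans_shift j) /= cReD cReN.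
  rewrite (_ : (fun x => Im _) = fun x : Rd => Im (val f (x - t)) - Im (val f x)); last first.
    by apply/funext => x; rewrite -(tf_trans_shift j) /= cImD cImN.
  move=> h; rewrite -(ler_sqr (x := rnrm _)) ?nnegrE ?rnrm_ge0//.
  rewrite -(ler_sqr (x := rnrm (fun x => Im _ - _))) ?nnegrE ?rnrm_ge0//.
  by split; apply: le_trans h; rewrite ?lerDl ?lerDr sqr_ge0.
have [q1 sq1 h1] := translate_weak_derivative (L2_Re f) K0 (fun n => (bnd n).1).
have [q2 sq2 h2] := translate_weak_derivative (L2_Im f) K0 (fun n => (bnd n).2).
have Lq : L2 (fun x => (q1 x +i* q2 x)%C) by apply/L2E.
exists (fun x => (q1 x +i* q2 x)%C) => // phi tphi.
rewrite (cintegral_real f) (cintegral_real (L2mk Lq)) h1// h2//.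
Qed.

End H1_translations.

Theorem proposition4p6 (R : realType) (d : nat)
    (V : set ('rV[R]_d -> R[i])) (hV : V = H1 \/ V = L2w \/ V = HH1)
    (Lambda : set 'rV[R]_(d + d)) (hLambda : is_lattice Lambda)
    (g : 'rV[R]_d -> R[i]) (hg : V g)
    (hframe : frame_sequence (gabor g Lambda))
    (gamma : 'rV[R]_d -> R[i]) (hgamma : canonical_dual_window g Lambda gamma) :
  V gamma.
Proof.
have Lg : L2 g.
  (* The lattice contains 0 and the shift by 0 fixes [g], so [g] is itself an element of the frame
     sequence. *)
  have := hframe.1 (exist _ 0 (mem_set (lattice0 hLambda))).
  rewrite (_ : gabor _ _ _ = tf_shift 0 g)//; congr L2; apply/funext => x.
  rewrite /tf_shift /translation /modulation.
  have [-> ->] : lsubmx (0 : 'rV[R]_(d + d)) = 0 /\ rsubmx (0 : 'rV[R]_(d + d)) = 0.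
    by split; apply/rowP => i; rewrite !mxE.
  by rewrite subr0 (_ : dot 0 x = 0) ?mulr0 ?cis0 ?mul1r// /dot big1// => i _; rewrite mxE mul0r.
have Lgamma : L2 gamma := hgamma.1.1.
pose f := L2mk Lg; pose h := L2mk Lgamma.
have [K hK] := @gabor_lipschitz R d Lambda hLambda f hframe h hgamma.
(* The Lipschitz constant [K] comes without a sign, hence [|K|]. *)
have transfer m (c t : R) : 0 <= t -> nrm (@L2ip R d) (tf m f - f) <= c * t ->
    nrm (@L2ip R d) (tf m h - h) <= `|K| * c * t.
  move=> t0 ct; apply: le_trans (hK m) _.
  apply: le_trans (ler_wpM2r (nrm_ge0 _ _) (ler_norm K)) _.
  by rewrite -mulrA ler_wpM2l.
have HL2w : L2w g -> L2w gamma.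
  move=> /(@L2w_mod_lipschitz _ _ f)[c [_ hc]].
  by apply: (@mod_lipschitz_L2w _ _ h (`|K| * c)) => j t; exact: transfer.
have HH1' : H1 g -> H1 gamma.
  move=> Hg; apply: (@trans_lipschitz_H1 _ _ h) => j.
  have [c [c0 hc]] := @H1_trans_lipschitz _ _ f j Hg.
  exists (`|K| * c); split=> [|n]; first exact: mulr_ge0.
  by apply: transfer; [rewrite invr_ge0|exact: hc].
case: hV => [|[|]] VE; rewrite VE in hg *.
- exact: HH1'.
- exact: HL2w.
- by case: hg => hg1 hg2; split; [exact: HH1'|exact: HL2w].
Qed.
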